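(* Let $0<\alpha<n$, $1<r\le r_0<\infty$, $1<p\le p_0<\infty$ with $\frac1{r_0}=\frac1{p_0}-\frac\alpha n$ and $\frac r{r_0}=\frac p{p_0}$, and let $a\in{\rm BMO}_{\rm dyadic}$. Write $u'=u/(u-1)$ for conjugate exponents. (i) The operator $I_{\alpha,{\rm dyadic}}$, originally defined on $L^{r_0'}$, is bounded from $\mathcal H^{r_0'}_{r'}$ to $\mathcal H^{p_0'}_{p'}$: there is $C>0$ with $\|I_{\alpha,{\rm dyadic}}f\|_{\mathcal H^{p_0'}_{p'}}\le C\|f\|_{\mathcal H^{r_0'}_{r'}}$ for all $f\in\mathcal H^{r_0'}_{r'}\cap L^{r_0'}$ (hence it extends to a bounded operator $\mathcal H^{r_0'}_{r'}\to\mathcal H^{p_0'}_{p'}$). (ii) The commutator $[a,I_{\alpha,{\rm dyadic}}]$, originally defined on $L^{r_0'}$, is likewise bounded from $\mathcal H^{r_0'}_{r'}$ to $\mathcal H^{p_0'}_{p'}$.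
   Context: Dyadic cubes: $Q_{jm}=\prod_{\nu=1}^n[m_\nu2^{-j},(m_\nu+1)2^{-j})$, $\mathcal D_j=\{Q_{jm}:m\in\mathbb Z^n\}$, $\mathcal D=\bigcup_j\mathcal D_j$. Haar functions: $h^{\epsilon_i}(t)=\chi_{[0,1)}(2t)+(-1)^{\epsilon_i}\chi_{[1,2)}(2t)$ for $\epsilon_i\in\{0,1\}$; $E=\{0,1\}^n\setminus\{(0,\dots,0)\}$; $h^\varepsilon(x)=\prod_i h^{\varepsilon_i}(x_i)$; $h^\varepsilon_{Q_{jm}}(x)=2^{jn/2}h^\varepsilon(2^jx-m)$. $\langle f,g\rangle=\int fg$, $m_Q(f)=|Q|^{-1}\int_Qf$. Dyadic BMO: $M^{\sharp,{\rm dyadic}}a(x)=\sup_{Q\in\mathcal D,\,x\in Q}m_Q(|a-m_Q(a)|)$, $a\in{\rm BMO}_{\rm dyadic}$ iff $a\in L^1_{\rm loc}$ and $\|M^{\sharp,{\rm dyadic}}a\|_{L^\infty}<\infty$. Dyadic fractional integral: $I_{\alpha,{\rm dyadic}}f=\sum_{\varepsilon\in E}\sum_{j\in\mathbb Z}\sum_{Q\in\mathcal D_j}|Q|^{\alpha/n}\langle f,h^\varepsilon_Q\rangle h^\varepsilon_Q$ (limit of partial sums over $-M\le j\le M$); commutator $[a,I_{\alpha,{\rm dyadic}}]f=a\,I_{\alpha,{\rm dyadic}}f-I_{\alpha,{\rm dyadic}}[af]$, understood as $\lim_{M}\sum_{\varepsilon}\sum_{j=-M}^M\sum_{Q\in\mathcal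 D_j}\langle a I_{\alpha,{\rm dyadic}}f-I_{\alpha,{\rm dyadic}}[af],h^\varepsilon_Q\rangle h^\varepsilon_Q$. Block spaces (preduals of Morrey spaces): for $1<u\le v<\infty$, a function $A\in L^v$ is a $(u,v)$-block if there is $Q\in\mathcal D$ with ${\rm supp}\,A\subset Q$ and $\|A\|_{L^v}\le|Q|^{1/v-1/u}$; $\mathcal H^u_v$ is the set of $f=\sum_{j\ge1}\lambda_ja_j$ with $\sum_j|\lambda_j|<\infty$ and each $a_j$ a $(u,v)$-block, normed by $\|f\|_{\mathcal H^u_v}=\inf\sum_j|\lambda_j|$ over all such decompositions. *)

(* Defs.v *)
From HB Require Import structures.
From mathcomp Require Import all_boot all_order all_algebra.
From mathcomp Require Import all_classical all_reals all_analysis.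
Set Implicit Arguments. Unset Strict Implicit. Unset Printing Implicit Defensive.
Import Order.TTheory GRing.Theory Num.Theory.
Import numFieldNormedType.Exports.
Local Open Scope classical_set_scope.
Local Open Scope ring_scope.

Section Defs.
Context {R : realType}.
Local Notation RR := (measurableTypeR R).

Fixpoint lebn (n : nat) : set (n.-tuple RR) -> \bar R :=
  match n with
  | 0 => \d_ [tuple]
  | n'.+1 => pushforward ((@lebesgue_measure R) \x (@lebn n'))%E
               (fun p : RR * n'.-tuple RR => [tuple of p.1 :: p.2])
  end.

Variable n : nat.
Local Notation Rn := (n.-tuple RR).

Definition dvol (j : int) : R := (2 : R) ^ (- (j * n%:Z)).

Definition dcube (j : int) (m : n.-tuple int) : set Rn :=
  [set x | forall i : 'I_n,
     (tnth m i)%:~R * (2 : R) ^ (- j) <= tnth x i /\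
     tnth x i < ((tnth m i) + 1)%:~R * (2 : R) ^ (- j)].

Definition haar1 (e : bool) (t : R) : R :=
  (if (0 <= 2 * t) && (2 * t < 1) then 1 else 0) +
  (- 1) ^+ e * (if (1 <= 2 * t) && (2 * t < 2) then 1 else 0).

Definition haar (e : n.-tuple bool) (x : Rn) : R :=
  \prod_(i < n) haar1 (tnth e i) (tnth x i).

Definition haarQ (e : n.-tuple bool) (j : int) (m : n.-tuple int) (x : Rn) : R :=
  Num.sqrt ((2 : R) ^ (j * n%:Z)) *
  haar e [tuple (2 : R) ^ j * tnth x i - (tnth m i)%:~R | i < n].

Definition inner (f g : Rn -> R) : R :=
  fine (\int[@lebn n]_x (f x * g x)%:E).

Definition dmean (j : int) (m : n.-tuple int) (f : Rn -> R) : R :=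
  (dvol j)^-1 * fine (\int[@lebn n]_(x in dcube j m) (f x)%:E).

Definition haar_psum (w : int -> R) (F : Rn -> R) (M : nat) (x : Rn) : R :=
  \sum_(e : n.-tuple bool | e != [tuple false | _ < n])
   \sum_(k < (M.*2).+1)
    let j := (k%:Z - M%:Z)%R in
    \sum_(m \in [set: n.-tuple int])
      w j * inner F (haarQ e j m) * haarQ e j m x.

Definition Idyad (alpha : R) (f : Rn -> R) (x : Rn) : R :=
  limn (fun M => haar_psum (fun j => (dvol j) `^ (alpha / n%:R)) f M x).

Definition commut (a : Rn -> R) (alpha : R) (f : Rn -> R) (x : Rn) : R :=
  limn (fun M => haar_psum (fun _ => 1)
          (fun y => a y * Idyad alpha f y - Idyad alpha (fun z => a z * f z) y)
          M x).

Definition LpN (q : R) (f : Rn -> R) : \bar R :=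
  ((\int[@lebn n]_x ((`|f x|) `^ q)%:E) `^ q^-1)%E.

Definition is_block (u v : R) (A : Rn -> R) : Prop :=
  measurable_fun setT A /\
  exists (j : int) (m : n.-tuple int),
    (forall x, ~ dcube j m x -> A x = 0) /\
    (LpN v A <= ((dvol j) `^ (v^-1 - u^-1))%:E)%E.

Definition block_decomp (u v : R) (f : Rn -> R) (lam : nat -> R)
    (A : nat -> Rn -> R) : Prop :=
  (forall k, is_block u v (A k)) /\
  (\sum_(0 <= k <oo) (`|lam k|)%:E < +oo)%E /\
  almost_everywhere (@lebn n) (fun x =>
    (fun N => \sum_(k < N) lam k * A k x) @ \oo --> f x).

(* ||f||_{H^u_v}; f belongs to H^u_v iff this is finite *)
Definition Hnorm (u v : R) (f : Rn -> R) : \bar R :=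
  ereal_inf [set s | exists lam A, block_decomp u v f lam A /\
                      s = (\sum_(0 <= k <oo) (`|lam k|)%:E)%E].

Definition loc_integrable (a : Rn -> R) : Prop :=
  measurable_fun setT a /\
  forall k : nat,
    (\int[@lebn n]_(x in [set x : Rn | forall i, (- k%:R <= tnth x i <= k%:R)%R])
       (`|a x|)%:E < +oo)%E.

Definition Msharp (a : Rn -> R) (x : Rn) : \bar R :=
  ereal_sup [set (dmean jm.1 jm.2 (fun y => `|a y - dmean jm.1 jm.2 a|))%:E |
             jm in [set jm : int * n.-tuple int | dcube jm.1 jm.2 x]].

Definition BMO_dyadic (a : Rn -> R) : Prop :=
  loc_integrable a /\
  exists K : R, almost_everywhere (@lebn n) (fun x => (Msharp a x <= K%:E)%E).

End Defs.

Definition conjexp {R : realType} (u : R) : R := u / (u - 1).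

(* Main.v *)
Require Import Defs.
From HB Require Import structures.
From mathcomp Require Import all_boot all_order all_algebra.
From mathcomp Require Import all_classical all_reals all_analysis.
From mathcomp Require Import measurable_realfun zify ring lra.
Import Order.TTheory GRing.Theory Num.Theory.
Import numFieldNormedType.Exports.
Local Open Scope classical_set_scope.
Local Open Scope ring_scope.

(* Write q = r', P = p', delta = 1 - r/r0 = 1 - p/p0 and gamma = 1/p - 1/r, so that
   alpha/n = gamma (1 - delta). At scale j the operators I_alpha and [a, I_alpha] are
   bounded pointwise by |Q|^(alpha/n) X_j(x) E_j(X_j |f|)(x), where E_j averages over the
   cube Q of side 2^-j around x, and X_j = 1 + |a - E_j a| has uniformly bounded moments by
   the John-Nirenberg inequality. For a block f the sum of these terms over all scales
   is at most w^(1/p) G^(1/P), where w is a combination of weights |Q|^-delta 1_Q of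
   total mass C and \int G <= C. In the form "h <= kappa^p w + kappa^-P G for all
   kappa > 0" this domination survives summation over the blocks of a decomposition.
   Conversely, if |g| <= w^(1/p) G^(1/P) with w = \sum_k m_k |Q_k|^-delta 1_{Q_k}, then
   g is the sum of the functions g m_k |Q_k|^-delta 1_{Q_k} / w, which are multiples of
   blocks with summable coefficients by Hoelder's inequality. That the limit defining the
   commutator is a I_alpha f - I_alpha(a f) is dyadic Lebesgue differentiation, since
   the Haar sums telescope. *)

(** * Power inequalities *)

(** Let [v] be the volume of the cube of the block and take [1 < s < r0']; note that [r0' <= q].
    Because [s < q], Doob's maximal inequality acts on the averages of [f^s] below the block;
    because [s < r0'], there is geometric decay above it. Below the block let [t_k] be [1/v] plus
    the power [q/s] of the running maximum of normalised averages of [f^s], so that [\int t_k <= C]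
    on the block. Weighting each increment of [t] by [V = |Q|^(1-delta)] at its own generation
    yields weights [W_k >= V_k t_k] of mass at most [C], and with [y_k = V_k t_k / W_k <= 1] the
    k-th term is at most a constant times [X_k W_k^(1/p) y_k^gamma t_k^(1/P)]. Two obstacles remain.
    The number of scales is unbounded: [y_k] decreases geometrically while [t_k] stays put, and
    growth of [t_k] is paid for by [t_N], a Carleson packing argument. And [X_k] is unbounded, only
    averages of its powers being controlled: Young's inequality splits off a high power of [X_k],
    which is integrated against quantities constant on cubes and goes into [G]. *)

Section RealInequalities.
Context {R : realType}.
Implicit Types (x y z t c kappa p P : R).

Lemma powRK_inv x p : 0 <= x -> p != 0 -> (x `^ p^-1) `^ p = x.
Proof. by move=> x0 p0; rewrite -powRrM mulVf// powRr1. Qed.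

Lemma powRK x p : 0 <= x -> p != 0 -> (x `^ p) `^ p^-1 = x.
Proof. by move=> x0 p0; rewrite -powRrM mulfV// powRr1. Qed.

Lemma powR1x x : 1 `^ x = 1 :> R.
Proof. by rewrite powR1. Qed.

Lemma le_powR x y p : 0 <= x -> x <= y -> 0 <= p -> x `^ p <= y `^ p.
Proof.
move=> x0 xy p0; apply: ge0_ler_powR; rewrite ?nnegrE//.
exact: le_trans xy.
Qed.

Lemma powR_le1 x p : 0 <= x -> x <= 1 -> 0 <= p -> x `^ p <= 1.
Proof.
by move=> x0 x1 p0; rewrite -(powR1x p) ge0_ler_powR ?nnegrE.
Qed.

Lemma powR_lt1 x p : 0 <= x -> x < 1 -> 0 < p -> x `^ p < 1.
Proof.
by move=> x0 x1 p0; rewrite -(powR1x p) gt0_ltr_powR ?nnegrE.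
Qed.

Lemma powR_gt1 x p : 1 < x -> 0 < p -> 1 < x `^ p.
Proof.
move=> x1 p0; rewrite -(powR1x p) gt0_ltr_powR ?nnegrE//.
by rewrite ltW// (lt_trans _ x1).
Qed.

Lemma powR_ge1 x p : 1 <= x -> 0 <= p -> 1 <= x `^ p.
Proof.
move=> x1 p0; rewrite -(powR1x p) ge0_ler_powR ?nnegrE//.
by rewrite (le_trans _ x1).
Qed.

Lemma powRV x p : 0 <= x -> x^-1 `^ p = x `^ (- p).
Proof. by move=> x0; rewrite -powR_inv1// -powRrM mulN1r. Qed.

Lemma powRDp x p P : 0 < x -> x `^ (p + P) = x `^ p * x `^ P.
Proof. by move=> x0; rewrite powRD// (gt_eqF x0) implybT. Qed.

Lemma young_powR x y p P : 0 <= x -> 0 <= y -> 0 < p -> 0 < P ->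
  p^-1 + P^-1 = 1 -> x `^ p^-1 * y `^ P^-1 <= x + y.
Proof.
move=> x0 y0 p0 P0 pP.
have := conjugate_powR (powR_ge0 x p^-1) (powR_ge0 y P^-1) p0 P0 pP.
rewrite !powRK_inv ?gt_eqF// => /le_trans; apply.
have p1 : p^-1 <= 1 by rewrite -pP lerDl invr_ge0 ltW.
have P1 : P^-1 <= 1 by rewrite -pP lerDr invr_ge0 ltW.
by apply: lerD; rewrite ler_piMr.
Qed.

(** The left-hand side is unchanged under [x -> kappa^p x], [y -> kappa^-P y], so this is Young's
    inequality at a free scale. *)
Lemma young_powR_scaled kappa x y p P : 0 < kappa -> 0 <= x -> 0 <= y ->
  0 < p -> 0 < P -> p^-1 + P^-1 = 1 ->
  x `^ p^-1 * y `^ P^-1 <= kappa `^ p * x + kappa `^ (- P) * y.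
Proof.
move=> k0 x0 y0 p0 P0 pP.
have -> : x `^ p^-1 * y `^ P^-1 =
    (kappa `^ p * x) `^ p^-1 * (kappa `^ (- P) * y) `^ P^-1.
  rewrite !powRM ?powR_ge0// -!powRrM mulfV ?gt_eqF// mulNr mulfV ?gt_eqF//.
  by rewrite powRN !powRr1 ?(ltW k0)//; field; rewrite gt_eqF.
by apply: young_powR => //; rewrite mulr_ge0 ?powR_ge0.
Qed.

(* Optimise the bound in [kappa]; the degenerate cases let [kappa] tend to [0] or [+oo]. *)
Lemma le_powR_young (g w G : R) p P : 0 <= w -> 0 <= G ->
  0 < p -> 0 < P -> p^-1 + P^-1 = 1 ->
  (forall kappa, 0 < kappa -> g <= kappa `^ p * w + kappa `^ (- P) * G) ->
  g <= 2 * (w `^ p^-1 * G `^ P^-1).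
Proof.
move=> w0 G0 p0 P0 pP H.
have small c h : 0 <= c -> (forall e, 0 < e -> h <= e * c) -> h <= 0.
  move=> c0 He; rewrite leNgt; apply/negP => h0.
  have := He (h / (2 * (c + 1))).
  have c1 : 0 < 2 * (c + 1) by lra.
  rewrite divr_gt0// => /(_ isT).
  rewrite mulrAC ler_pdivlMr// ler_pM2l//; lra.
have [w0'|wN0] := eqVneq w 0.
  rewrite w0' in H *.
  rewrite powR0 ?invr_eq0 ?gt_eqF// mul0r mulr0; apply: (small G) => // e e0.
  have := H (e `^ (- P^-1)); rewrite powR_gt0// mulr0 add0r => /(_ isT).
  by rewrite -powRrM mulrNN mulVf ?gt_eqF// powRr1// ltW.
have [G0'|GN0] := eqVneq G 0.
  rewrite G0' in H *.
  rewrite [0 `^ _]powR0 ?invr_eq0 ?gt_eqF// !mulr0; apply: (small w) => // e e0.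
  have := H (e `^ p^-1); rewrite powR_gt0// mulr0 addr0 => /(_ isT).
  by rewrite powRK_inv ?gt_eqF// ltW.
have wp : 0 < w by rewrite lt_neqAle eq_sym wN0.
have Gp : 0 < G by rewrite lt_neqAle eq_sym GN0.
have pE : p^-1 = 1 - P^-1 by lra.
have sE : p + P = p * P.
  have : (p^-1 + P^-1) * (p * P) = p * P by rewrite pP mul1r.
  by move=> <-; field; rewrite !gt_eqF.
(* This [kappa] balances the two terms: both become [w^(1/p) G^(1/P)], whence the factor 2. *)
have := H ((G / w) `^ (p * P)^-1); rewrite powR_gt0 ?divr_gt0// => /(_ isT).
rewrite -!powRrM.
have -> : (p * P)^-1 * p = P^-1 by field; rewrite !gt_eqF.
have -> : (p * P)^-1 * - P = - p^-1 by field; rewrite !gt_eqF.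
have wE : w = w `^ P^-1 * w `^ p^-1.
  by rewrite -powRDp// addrC pP powRr1// ltW.
have GE : G = G `^ p^-1 * G `^ P^-1.
  by rewrite -powRDp// pP powRr1// ltW.
rewrite !powRM ?invr_ge0// !powRV// opprK (powRN G) (powRN w).
rewrite [X in _ * X + _]wE [X in _ + _ * X]GE.
move/le_trans; apply; rewrite le_eqVlt; apply/orP; left; apply/eqP.
by field; rewrite !gt_eqF ?powR_gt0.
Qed.

(** Split at [c = e z] with [(1 + e)^T = 3/2]. What matters about 3/2 is that it is below 2: the
    John-Nirenberg induction multiplies it by the proportion 1/2 of the stopped set and must end
    with a factor below 1. *)
Lemma powR_add_bound (c T : R) : 0 <= c -> 0 < T ->
  exists2 C, 0 <= C & forall z, 0 <= z -> (c + z) `^ T <= C + 3 / 2 * z `^ T.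
Proof.
move=> c0 T0; pose e := (3 / 2) `^ T^-1 - 1 : R.
have e0 : 0 < e.
  by rewrite subr_gt0 powR_gt1 ?invr_gt0//; lra.
exists ((c + c / e) `^ T) => [|z z0]; first exact: powR_ge0.
have [cz|zc] := leP c (e * z).
  apply: (@le_trans _ _ (((1 + e) * z) `^ T)).
    by apply: ge0_ler_powR; rewrite ?nnegrE//; [exact: ltW|nra..].
  rewrite powRM//; last by lra.
  have -> : 1 + e = (3 / 2) `^ T^-1 by rewrite /e; lra.
  by rewrite powRK_inv ?gt_eqF// lerDr powR_ge0.
apply: (@le_trans _ _ ((c + c / e) `^ T)).
  apply: ge0_ler_powR; rewrite ?nnegrE; first exact: ltW.
  - exact: addr_ge0.
  - by rewrite addr_ge0// divr_ge0// ltW.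
  - by rewrite lerD2l ler_pdivlMr// mulrC ltW.
by rewrite lerDl mulr_ge0 ?powR_ge0//; lra.
Qed.

(** Young's inequality for [x^(r-1) y] with exponents [r/(r-1)] and [r]. With [x] and [y]
    consecutive values of a running maximum it is one step of the pathwise proof of Doob's
    inequality, [y] then being the current average. *)
Lemma powR_increment x y r : 1 < r -> 0 <= x -> 0 <= y ->
  y `^ r - x `^ r <= r / (r - 1) * ((y `^ (r - 1) - x `^ (r - 1)) * y).
Proof.
move=> r1 x0 y0.
have r10 : 0 < r - 1 by lra.
have := @conjugate_powR _ (x `^ (r - 1)) y (r / (r - 1)) r (powR_ge0 _ _) y0.
have -> : 0 < r / (r - 1) by rewrite divr_gt0//; lra.
have -> : 0 < r by lra.
rewrite -powRrM; have -> : (r - 1) * (r / (r - 1)) = r by field; rewrite gt_eqF.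
move=> /(_ isT isT); have -> : (r / (r - 1))^-1 + r^-1 = 1.
  by field; rewrite !gt_eqF//; lra.
move=> /(_ erefl) Y.
have yE : y `^ (r - 1) * y = y `^ r.
  have [->|yN0] := eqVneq y 0; first by rewrite mulr0 powR0// gt_eqF//; lra.
  rewrite -[X in _ * X](@powRr1 _ y)// -powRDp ?subrK//.
  by rewrite lt_neqAle eq_sym yN0.
rewrite mulrBl yE.
have : r / (r - 1) * (x `^ (r - 1) * y) <= x `^ r + (r - 1)^-1 * y `^ r.
  apply: (@le_trans _ _ (r / (r - 1) * (x `^ r / (r / (r - 1)) + y `^ r / r))).
    by rewrite ler_pM2l// divr_gt0//; lra.
  rewrite le_eqVlt; apply/orP; left; apply/eqP.
  by field; rewrite !gt_eqF//; lra.
have -> : r / (r - 1) = 1 + (r - 1)^-1 by field; rewrite gt_eqF.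
set u := (r - 1)^-1; lra.
Qed.

(* Either [t] grows by a definite factor, and [t k.+1 ^ A] is paid for by the
   increment of [t ^ A], or [y] decreases by a definite factor. *)
Lemma carleson_sum (rho A B : R) : 0 < rho -> rho < 1 -> 0 < A -> 0 < B ->
  exists2 C, 0 < C & forall t y : nat -> R,
    (forall k, 0 < t k) -> (forall k, t k <= t k.+1) ->
    (forall k, 0 <= y k) -> (forall k, y k <= 1) ->
    (forall k, y k.+1 <= y k * (t k.+1 / t k) * rho) ->
    forall N, \sum_(k < N.+1) t k `^ A * y k `^ B <= C * t N `^ A.
Proof.
move=> r0 r1 A0 B0.
pose lam := rho `^ (B / 2).
have lam1 : lam < 1.
  by rewrite powR_lt1 ?ltW// divr_gt0.
have lam0 : 0 < lam by rewrite powR_gt0.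
pose k0 := rho `^ (A * (B / 2) / (A + B)).
have k01 : k0 < 1.
  by rewrite powR_lt1 ?(ltW r0)// divr_gt0 ?mulr_gt0//; lra.
have k00 : 0 < k0 by rewrite powR_gt0.
pose D := (1 - k0)^-1.
have D1 : 1 <= D by rewrite /D invf_ge1 ?subr_gt0//; lra.
exists (D / (1 - lam)) => [|t y t0 tt y0 y1 yr N].
  by rewrite divr_gt0// ?subr_gt0//; lra.
pose u k := t k `^ A * y k `^ B.
have uS k : u k.+1 <= lam * u k + D * (t k.+1 `^ A - t k `^ A).
  have tA : t k `^ A <= t k.+1 `^ A.
    by rewrite le_powR// ltW.
  set q := t k.+1 / t k.
  have q1 : 1 <= q by rewrite /q ler_pdivlMr ?mul1r.
  have tE : t k.+1 = t k * q by rewrite /q mulrC divfK ?gt_eqF.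
  (* One has [u k.+1 <= q^(A+B) rho^B u k], and below this threshold the factor is at most
     [lam = rho^(B/2)]. Above it [q^-A <= k0], so the increment of [t^A] is at least [1 - k0] times
     the new value, which dominates [u k.+1]. *)
  have [ql|ql] := leP (q `^ (A + B)) (rho `^ (- (B / 2))).
    apply: (@le_trans _ _ (lam * u k)); last first.
      by rewrite lerDl mulr_ge0 ?subr_ge0//; lra.
    apply: (@le_trans _ _ ((t k * q) `^ A * (y k * q * rho) `^ B)).
      by rewrite /u -tE ler_wpM2l ?powR_ge0// le_powR// ltW.
    have qp : 0 < q by lra.
    rewrite (@powRM _ _ _ _ (ltW (t0 k)) (ltW qp)).
    rewrite (@powRM _ _ _ _ (mulr_ge0 (y0 k) (ltW qp)) (ltW r0)).
    rewrite (@powRM _ _ _ _ (y0 k) (ltW qp)).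
    have -> : t k `^ A * q `^ A * (y k `^ B * q `^ B * rho `^ B) =
       u k * (q `^ (A + B) * rho `^ B) by rewrite /u powRDp//; ring.
    rewrite mulrC ler_wpM2r ?mulr_ge0 ?powR_ge0//.
    apply: (@le_trans _ _ (rho `^ (- (B / 2)) * rho `^ B)).
      by rewrite ler_wpM2r ?powR_ge0.
    by rewrite -powRDp// /lam; have -> : - (B / 2) + B = B / 2 by field.
  have kt : t k `^ A <= k0 * t k.+1 `^ A.
    have qA : 1 <= k0 * q `^ A.
      have -> : q `^ A = (q `^ (A + B)) `^ (A / (A + B)).
        by rewrite -powRrM; congr (_ `^ _); field; rewrite gt_eqF//; lra.
      have -> : k0 = (rho `^ (B / 2)) `^ (A / (A + B)).
        by rewrite -powRrM /k0; congr (_ `^ _); field; rewrite gt_eqF//; lra.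
      rewrite -powRM ?powR_ge0//.
      apply: powR_ge1; last by rewrite divr_ge0//; lra.
      move: ql; rewrite powRN => /ltW; rewrite -ler_pdivrMl ?powR_gt0//.
      by rewrite mulr1.
    rewrite tE (@powRM _ _ _ _ (ltW (t0 k)) (le_trans ler01 q1)).
    by rewrite mulrCA ler_peMr ?powR_ge0.
  apply: (@le_trans _ _ (t k.+1 `^ A)).
    rewrite /u ler_piMr ?powR_ge0//.
    by rewrite powR_le1// ltW.
  apply: (@le_trans _ _ (D * (t k.+1 `^ A - t k `^ A))); last first.
    by rewrite lerDr mulr_ge0 ?mulr_ge0 ?powR_ge0 ?ltW.
  by rewrite /D mulrC ler_pdivlMr ?subr_gt0//; lra.
(* The extra [lam * u N] is what [uS] consumes in the inductive step. *)
have : (1 - lam) * (\sum_(k < N.+1) u k) + lam * u N <= D * t N `^ A.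
  elim: N => [|N IH].
    rewrite big_ord_recl big_ord0 addr0 -mulrDl subrK mul1r /u.
    apply: (@le_trans _ _ (t 0%N `^ A)).
      rewrite ler_piMr ?powR_ge0//.
      by rewrite powR_le1// ltW.
    by rewrite ler_peMl ?powR_ge0.
  rewrite big_ord_recr/=.
  have := uS N; lra.
rewrite -/u => H.
rewrite mulrAC ler_pdivlMr ?subr_gt0// mulrC.
apply: le_trans H; rewrite lerDl; apply: mulr_ge0; first exact: ltW.
by rewrite mulr_ge0 ?powR_ge0.
Qed.

(** Young's inequality with exponent [L] for [(z X^L)^(1/L)] times the remaining power of [z]; the
    last exponent, positive as [P < L], makes the powers of [z] add up to [1/P]. This separates [X],
    of which only averages of powers are controlled, from the summation over scales. *)
Lemma mul_powR_le_split (P L z X : R) : 1 < P -> P < L -> 0 <= z -> 0 <= X ->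
  z `^ P^-1 * X <= z * X `^ L + z `^ ((P^-1 - L^-1) / (1 - L^-1)).
Proof.
move=> P1 PL z0 X0.
have L1 : L^-1 < 1 by rewrite invf_lt1; lra.
have l0 : 0 < L by lra.
have LP : L^-1 < P^-1 by rewrite ltf_pV2 ?posrE//; lra.
set e := (_ / _).
have e0 : 0 < e by rewrite divr_gt0 ?subr_gt0.
have [->|zN0] := eqVneq z 0.
  rewrite powR0 ?mul0r ?add0r ?powR_ge0// invr_eq0 gt_eqF//; lra.
have zp : 0 < z by rewrite lt_neqAle eq_sym zN0.
have := @young_powR (z * X `^ L) (z `^ e) L ((1 - L^-1)^-1).
rewrite mulr_ge0 ?powR_ge0// => /(_ isT isT l0).
rewrite invr_gt0 subr_gt0 L1 invrK => /(_ isT).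
have -> : L^-1 + (1 - L^-1) = 1 by lra.
move=> /(_ erefl).
rewrite powRM ?powR_ge0// powRK ?gt_eqF// -powRrM mulrAC -powRDp//.
by have -> : L^-1 + e * (1 - L^-1) = P^-1
  by rewrite /e; field; rewrite ?subr_eq0 ?gt_eqF//; lra.
Qed.

(* The sum is compared with [T = t N + \sum y^gamma t X^L] rather than with [t N], so
   that no Hoelder inequality for sums is needed. *)
Lemma weighted_sum_bound (rho gamma p P r : R) : 0 < rho -> rho < 1 ->
  0 < gamma -> 0 < p -> 1 < P -> p^-1 + P^-1 = 1 -> p^-1 = gamma + r^-1 ->
  exists2 C, 0 < C & forall (t V W X : nat -> R) c,
    (forall k, 0 < t k) -> (forall k, t k <= t k.+1) ->
    (forall k, 0 < V k) -> (forall k, V k.+1 = rho * V k) ->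
    (forall k, W k <= W k.+1) -> (forall k, V k * t k <= W k) ->
    (forall k, 0 <= X k) -> 0 <= c -> (forall k, c <= W k `^ r^-1) ->
    forall N kappa, 0 < kappa ->
    \sum_(k < N.+1) c * ((V k * t k) `^ gamma * t k `^ P^-1) * X k <=
    C * (kappa `^ p * W N + kappa `^ (- P) *
      (t N + \sum_(k < N.+1) (V k * t k / W k) `^ gamma * t k * X k `^ (2 * P))).
Proof.
move=> rho0 rho1 g0 p0 P1 pP pr.
pose L := 2 * P; pose e := (P^-1 - L^-1) / (1 - L^-1).
have P0 : 0 < P by lra.
have LP : P < L by rewrite /L; lra.
have L1 : L^-1 < 1 by rewrite invf_lt1; lra.
have e0 : 0 < e by rewrite divr_gt0 ?subr_gt0// ltf_pV2// posrE; lra.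
have [C C0 HC] := carleson_sum rho e gamma rho0 rho1 e0 g0.
exists (1 + C) => [|t V W X c t0 tt V0 VS WW tW X0 c0 cW N kappa k0].
  by lra.
have W0 k : 0 < W k by apply: lt_le_trans (tW k); rewrite mulr_gt0.
pose y k := V k * t k / W k.
have y0 k : 0 <= y k by rewrite divr_ge0 ?mulr_ge0 ?(ltW (W0 k)) ?(ltW (t0 k)) ?(ltW (V0 k)).
have y1 k : y k <= 1 by rewrite ler_pdivrMr// mul1r.
have yS k : y k.+1 <= y k * (t k.+1 / t k) * rho.
  have -> : y k * (t k.+1 / t k) * rho = V k.+1 * t k.+1 / W k.
    by rewrite /y VS; field; rewrite !gt_eqF.
  by rewrite ler_wpM2l ?mulr_ge0 ?(ltW (V0 _)) ?(ltW (t0 _))// lef_pV2 ?posrE.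
have tmon : {homo t : m n / (m <= n)%N >-> m <= n} by apply/nondecreasing_seqP.
have Wmon : {homo W : m n / (m <= n)%N >-> m <= n} by apply/nondecreasing_seqP.
set S := \sum_(k < N.+1) y k `^ gamma * t k * X k `^ L.
have S0 : 0 <= S.
  by apply: sumr_ge0 => k _; rewrite mulr_ge0 ?mulr_ge0 ?powR_ge0 ?ltW.
pose T := t N + S.
have T0 : 0 < T by rewrite ltr_wpDr.
apply: (@le_trans _ _ ((1 + C) * (W N `^ p^-1 * T `^ P^-1))); last first.
  by rewrite ler_pM2l; [exact: young_powR_scaled (ltW (W0 N)) (ltW T0) p0 P0 pP|lra].
(* Divided by [W_N^(1/p) T^(1/P)], the k-th term is at most [y^gamma (t/T) X^L + y^gamma (t/T)^e].
   The first part sums to [S / T <= 1], the second to at most [C (t_N / T)^e <= C] by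
   [carleson_sum]. *)
apply: (@le_trans _ _ (W N `^ p^-1 * T `^ P^-1 *
    (S / T + \sum_(k < N.+1) (t k `^ e * y k `^ gamma) / T `^ e))); last first.
  rewrite mulrC ler_wpM2r ?mulr_ge0 ?powR_ge0//; apply: lerD.
    by rewrite ler_pdivrMr// mul1r /T lerDr ltW.
  rewrite -mulr_suml ler_pdivrMr ?powR_gt0//.
  apply: (le_trans (HC t y t0 tt y0 y1 yS N)).
  rewrite ler_pM2l// le_powR ?(ltW (t0 _)) ?(ltW e0)//.
  by rewrite /T lerDl.
rewrite /S mulr_suml -big_split/= mulr_sumr; apply: ler_sum => -[k kN] _ /=.
have zk0 : 0 <= t k / T by rewrite divr_ge0 ?ltW.
have -> : t k `^ P^-1 = T `^ P^-1 * (t k / T) `^ P^-1.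
  by rewrite -powRM ?(ltW T0)//; congr (_ `^ _); field; rewrite gt_eqF.
have -> : V k * t k = W k * y k by rewrite /y; field; rewrite gt_eqF.
rewrite (@powRM _ _ _ _ (ltW (W0 k)) (y0 k)).
apply: (@le_trans _ _ (W N `^ p^-1 * T `^ P^-1 *
    (y k `^ gamma * ((t k / T) `^ P^-1 * X k)))).
  have -> : c * (W k `^ gamma * y k `^ gamma * (T `^ P^-1 * (t k / T) `^ P^-1)) * X k
    = (c * W k `^ gamma) * (T `^ P^-1 * (y k `^ gamma * ((t k / T) `^ P^-1 * X k))).
    by ring.
  rewrite -[leRHS]mulrA ler_wpM2r ?mulr_ge0 ?powR_ge0//.
  rewrite pr addrC powRDp//.
  have kN' : (k <= N)%N by [].
  apply: (ler_pM c0 (powR_ge0 _ _) (cW N)).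
  by rewrite le_powR ?(ltW (W0 _)) ?(ltW g0)//; exact: Wmon.
rewrite ler_wpM2l ?mulr_ge0 ?powR_ge0//.
apply: (@le_trans _ _ (y k `^ gamma * (t k / T * X k `^ L + (t k / T) `^ e))).
  by rewrite ler_wpM2l ?powR_ge0//; exact: mul_powR_le_split.
rewrite mulrDr (@powRM _ (t k)) ?invr_ge0 ?(ltW (t0 _)) ?(ltW T0)//.
rewrite powRV ?(ltW T0)// powRN.
rewrite le_eqVlt; apply/orP; left; apply/eqP.
by field; rewrite !gt_eqF ?powR_gt0.
Qed.

End RealInequalities.

(** * Dyadic systems and averages *)

(* [cell j x] is the index of the cube of generation [j] that contains [x]. *)
Record dyadicSystem (R : realType) (d : measure_display) (T : measurableType d)
    (mu : {measure set T -> \bar R}) := DyadicSystem {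
  idx : countType;
  cell : int -> T -> idx;
  ratio : R;
  idx0 : idx;
  ratio_gt1 : 1 < ratio;
  measurable_cube : forall j i, measurable [set x | cell j x = i];
  mu_cube : forall j i, mu [set x | cell j x = i] = (ratio ^ (- j))%:E;
  cell_nest : forall j x y, cell (j + 1) x = cell (j + 1) y -> cell j x = cell j y;
  cube_gen : measurable `<=`
    <<s [set A | exists j i, A = [set x | cell j x = i]] >> }.

Arguments dyadicSystem {R d T}.
Arguments idx {R d T mu}.
Arguments cell {R d T mu}.
Arguments ratio {R d T mu}.
Arguments idx0 {R d T mu}.
Arguments ratio_gt1 {R d T mu}.
Arguments cube_gen {R d T mu}.

Section Dyadic.
Context {R : realType} {d : measure_display} {T : measurableType d}
  {mu : {measure set T -> \bar R}} (D : dyadicSystem mu).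
Implicit Types (j l : int) (i : idx D) (F G : T -> \bar R) (f g : T -> R).

Definition vol j : R := ratio D ^ (- j).
Definition cube j i : set T := [set x | cell D j x = i].
Definition cubex j (x : T) : set T := cube j (cell D j x).
(** The conditional expectation on generation [j], with values in [\bar R] so that it makes sense
    for every nonnegative [F]. *)
Definition avg j F x : \bar R := ((vol j)^-1%:E * \int[mu]_(y in cubex j x) F y)%E.
(** Measurability with respect to generation [j], put pointwise; as there are countably many cubes,
    it implies measurability ([measurable_level]). *)
Definition level {A : Type} j (g : T -> A) :=
  forall x y, cell D j x = cell D j y -> g x = g y.

Definition lset j (E : set T) :=
  forall x y, cell D j x = cell D j y -> E x -> E y.

Lemma ratio_gt0 : 0 < ratio D.
Proof. exact: lt_trans (ratio_gt1 D). Qed.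

Lemma vol_gt0 j : 0 < vol j.
Proof. by rewrite exprz_gt0// ratio_gt0. Qed.

Lemma volD j l : vol (j + l) = vol j * vol l.
Proof. by rewrite /vol opprD expfzDr// gt_eqF// ratio_gt0. Qed.

Lemma vol1 : vol 1 = (ratio D)^-1.
Proof. by rewrite /vol exprN1. Qed.

Lemma mcube j i : measurable (cube j i).
Proof. exact: measurable_cube. Qed.

Lemma mcubex j x : measurable (cubex j x).
Proof. exact: measurable_cube. Qed.
Hint Resolve mcube mcubex : core.

Lemma mucube j i : mu (cube j i) = (vol j)%:E.
Proof. exact: mu_cube. Qed.

Lemma mucubex j x : mu (cubex j x) = (vol j)%:E.
Proof. exact: mu_cube. Qed.

Lemma cell_mono j (k : nat) x y :
  cell D (j + k%:Z) x = cell D (j + k%:Z) y -> cell D j x = cell D j y.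
Proof.
elim: k => [|k IH]; first by rewrite addr0.
by rewrite -addn1 PoszD addrA => /cell_nest/IH.
Qed.

Lemma cell_le j l x y : j <= l -> cell D l x = cell D l y -> cell D j x = cell D j y.
Proof.
move=> jl; have -> : l = j + `|l - j|%N%:Z.
  by rewrite gez0_abs ?subr_ge0// [RHS]addrC subrK.
exact: cell_mono.
Qed.

Lemma level_le {A : Type} j l (g : T -> A) : j <= l -> level j g -> level l g.
Proof. by move=> jl gj x y /(cell_le _ _ _ _ jl)/gj. Qed.

Lemma level_avg j F : level j (avg j F).
Proof. by move=> x y xy; rewrite /avg /cubex xy. Qed.

(** A number that codes no index yields the empty set, so that sums over cubes become series over
    [nat]. *)
Definition cube_enum j (k : nat) : set T :=
  if @pickle_inv (idx D) k is Some i then cube j i else set0.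

Lemma measurable_cube_enum j k : measurable (cube_enum j k).
Proof. by rewrite /cube_enum; case: pickle_inv. Qed.

Lemma trivIset_cube_enum j : trivIset setT (cube_enum j).
Proof.
apply/trivIsetP => k l _ _ kl; rewrite /cube_enum.
case ek : pickle_inv => [i|]; last by rewrite set0I.
case el : pickle_inv => [i'|]; last by rewrite setI0.
rewrite -subset0 => x [/= xi xi']; move/eqP : kl; apply.
have := @pickle_invK (idx D) k; rewrite ek/= => <-.
have := @pickle_invK (idx D) l; rewrite el/= => <-.
by rewrite -xi -xi'.
Qed.

Lemma cube_enum_cover j : \bigcup_k cube_enum j k = setT.
Proof.
rewrite -subTset => x _; exists (pickle (cell D j x)) => //.
by rewrite /cube_enum pickleK_inv.
Qed.

Lemma measurable_level d' (S : measurableType d') j (g : T -> S) (E : set T) :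
  measurable E -> level j g -> measurable_fun E g.
Proof.
move=> mE gj _ B mB; apply: measurableI => //.
have -> : g @^-1` B = \bigcup_(k in [set k | cube_enum j k `&` g @^-1` B !=set0]) cube_enum j k.
  apply/seteqP; split => [x Bx|x [k [y [ky By]] kx]].
    have : [set: T] x by [].
    rewrite -(cube_enum_cover j) => -[k _ kx]; exists k => //.
    by exists x.
  move: ky kx; rewrite /cube_enum; case: pickle_inv => [i|//] yi xi.
  by rewrite /preimage/= (gj x y)//; move: yi xi; rewrite /cube/= => -> ->.
by apply: bigcup_measurable => k _; exact: measurable_cube_enum.
Qed.

Lemma measurable_level_set j (E : set T) :
  lset j E -> measurable E.
Proof.
move=> Ej.
have lE : level j (fun x => x \in E).
  move=> x y xy; apply/idP/idP; rewrite !inE => H; first exact: Ej H.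
  by apply: Ej H; rewrite xy.
have := measurable_level _ _ j _ _ measurableT lE measurableT [set true] I.
rewrite setTI; congr measurable; apply/seteqP; split => x /=.
  by move/set_mem.
by move/mem_set.
Qed.

Lemma measurable_avg j F (E : set T) : measurable E -> measurable_fun E (avg j F).
Proof. by move=> mE; apply: (measurable_level _ _ j) => //; exact: level_avg. Qed.

Lemma lset_le j l (E : set T) : j <= l -> lset j E -> lset l E.
Proof. by move=> jl Ej x y /(cell_le _ _ _ _ jl)/Ej. Qed.

Lemma lsetI j (E F : set T) : lset j E -> lset j F -> lset j (E `&` F).
Proof. by move=> Ej Fj x y xy [/(Ej _ _ xy) ? /(Fj _ _ xy)]. Qed.

Lemma integral_cells j (E : set T) F : measurable E -> measurable_fun E F ->
  (forall x, E x -> (0 <= F x)%E) ->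
  (\int[mu]_(x in E) F x = \sum_(k <oo) \int[mu]_(x in E `&` cube_enum j k) F x)%E.
Proof.
move=> mE mF F0.
have EE : E = \bigcup_k (E `&` cube_enum j k) by rewrite -setI_bigcupr cube_enum_cover setIT.
rewrite [in LHS]EE ge0_integral_bigcup//.
- by move=> k; apply: measurableI => //; exact: measurable_cube_enum.
- by rewrite -EE.
- by move=> x [k _ [Ex _]]; exact: F0.
- by apply: trivIset_setIl; exact: trivIset_cube_enum.
Qed.

Lemma avg_ge0 j F x : (forall y, (0 <= F y)%E) -> (0 <= avg j F x)%E.
Proof.
move=> F0; rewrite /avg mule_ge0// ?lee_fin ?invr_ge0 ?(ltW (vol_gt0 _))//.
exact: integral_ge0.
Qed.

Lemma integral_cubex j F x :
  (\int[mu]_(y in cubex j x) F y = (vol j)%:E * avg j F x)%E.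
Proof. by rewrite /avg muleA -EFinM mulfV ?mul1e// gt_eqF// vol_gt0. Qed.

(** On each cube in [E] both [g] and [avg j F] are constant, and [avg j F] has the same integral
    there as [F]. This pull-out rule is what integrates moments of the oscillation against factors
    constant on cubes. *)
Lemma integral_level j (E : set T) (g F : T -> \bar R) :
  lset j E -> level j g ->
  (forall x, (0 <= g x)%E) -> (forall x, (0 <= F x)%E) -> measurable_fun setT F ->
  (\int[mu]_(x in E) (g x * avg j F x) = \int[mu]_(x in E) (g x * F x))%E.
Proof.
move=> Ej gj g0 F0 mF.
have mE : measurable E by exact: measurable_level_set Ej.
have mg : measurable_fun setT g by exact: (measurable_level _ _ j).
rewrite !(integral_cells j) //; last 4 first.
- by apply: emeasurable_funM; exact: measurable_funTS.
- by move=> x _; rewrite mule_ge0.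
- apply: emeasurable_funM; first exact: measurable_funTS.
  exact: measurable_avg.
- by move=> x _; rewrite mule_ge0// avg_ge0.
apply: eq_eseriesr => k _; rewrite /cube_enum; case: pickle_inv => [i|]; last first.
  by rewrite setI0 !integral_set0.
have [->|/set0P[x0 [Ex0 ix0]]] := eqVneq (E `&` cube j i) set0.
  by rewrite !integral_set0.
have -> : E `&` cube j i = cubex j x0.
  apply/seteqP; split => [x [_ xi]|x xi]; first by rewrite /cubex/cube/= xi.
  split; first by apply: Ej Ex0; rewrite -xi.
  by rewrite /cube/= xi.
transitivity (\int[mu]_(x in cubex j x0) (g x0 * avg j F x0))%E.
  apply: eq_integral => x; rewrite inE => xx0.
  by rewrite (gj x x0)// (level_avg j F x x0).
transitivity (\int[mu]_(x in cubex j x0) (g x0 * F x))%E; last first.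
  by apply: eq_integral => x; rewrite inE => xx0; rewrite (gj x x0).
rewrite [RHS]ge0_integralZl//; last exact: measurable_funTS.
by rewrite integral_cst// mucubex -muleA [(avg _ _ _ * _)%E]muleC integral_cubex.
Qed.

Lemma integral_avg j (E : set T) F :
  lset j E ->
  (forall x, (0 <= F x)%E) -> measurable_fun setT F ->
  (\int[mu]_(x in E) avg j F x = \int[mu]_(x in E) F x)%E.
Proof.
move=> Ej F0 mF; have := integral_level j E (cst 1%E) F Ej.
under eq_integral do rewrite /= mul1e.
by under [in RHS]eq_integral do rewrite /= mul1e; apply.
Qed.

Lemma lset_cubex j l x : j <= l -> lset l (cubex j x).
Proof. by move=> jl y z /(cell_le _ _ _ _ jl) yz; rewrite /cubex /cube/= yz. Qed.

Lemma avg_level j l (g F : T -> \bar R) x : j <= l -> level l g ->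
  (forall x, (0 <= g x)%E) -> (forall x, (0 <= F x)%E) -> measurable_fun setT F ->
  avg j (fun y => g y * avg l F y)%E x = avg j (fun y => g y * F y)%E x.
Proof.
move=> jl gl g0 F0 mF; rewrite /avg; congr (_ * _)%E.
by apply: integral_level => //; exact: lset_cubex.
Qed.

Lemma le_avg j F G x : measurable_fun setT F -> measurable_fun setT G ->
  (forall y, (0 <= F y)%E) -> (forall y, (F y <= G y)%E) -> (avg j F x <= avg j G x)%E.
Proof.
move=> mF mG F0 FG; rewrite lee_wpmul2l ?lee_fin ?invr_ge0 ?(ltW (vol_gt0 _))//.
apply: ge0_le_integral => //; try exact: measurable_funTS.
Qed.

Lemma ae_le_avg j F G x : measurable_fun setT F -> measurable_fun setT G ->
  (forall y, (0 <= F y)%E) -> (forall y, (0 <= G y)%E) ->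
  {ae mu, forall y, (F y <= G y)%E} -> (avg j F x <= avg j G x)%E.
Proof.
move=> mF mG F0 G0 FG; rewrite lee_wpmul2l ?lee_fin ?invr_ge0 ?(ltW (vol_gt0 _))//.
apply: ae_ge0_le_integral => //; try exact: measurable_funTS.
by apply: filterS FG => y + _.
Qed.

Lemma avgD j F G x : measurable_fun setT F -> measurable_fun setT G ->
  (forall y, (0 <= F y)%E) -> (forall y, (0 <= G y)%E) ->
  avg j (fun y => F y + G y)%E x = (avg j F x + avg j G x)%E.
Proof.
move=> mF mG F0 G0; rewrite /avg ge0_integralD//; try exact: measurable_funTS.
by rewrite ge0_muleDr//; apply: integral_ge0.
Qed.

Lemma avgZ j (k : R) F x : measurable_fun setT F -> (forall y, (0 <= F y)%E) ->
  0 <= k -> avg j (fun y => k%:E * F y)%E x = (k%:E * avg j F x)%E.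
Proof.
move=> mF F0 k0; rewrite /avg ge0_integralZl//; try exact: measurable_funTS.
by rewrite muleCA.
Qed.

Lemma avg_cst j (k : R) x : avg j (fun=> k%:E) x = k%:E.
Proof.
rewrite /avg -/(cst k%:E) integral_cst// mucubex muleC -muleA -EFinM divff ?mule1// ?mulr1//.
by rewrite gt_eqF// vol_gt0.
Qed.

Lemma avg_nneseries j (F : nat -> T -> \bar R) x :
  (forall k, measurable_fun setT (F k)) -> (forall k y, (0 <= F k y)%E) ->
  avg j (fun y => \sum_(k <oo) F k y)%E x = (\sum_(k <oo) avg j (F k) x)%E.
Proof.
move=> mF F0; rewrite /avg integral_nneseries//; last by move=> k; exact: measurable_funTS.
rewrite nneseriesZl// => k _; exact: integral_ge0.
Qed.

Lemma avg_sum j (I : Type) (s : seq I) (F : I -> T -> \bar R) x :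
  (forall k, measurable_fun setT (F k)) -> (forall k y, (0 <= F k y)%E) ->
  avg j (fun y => \sum_(k <- s) F k y)%E x = (\sum_(k <- s) avg j (F k) x)%E.
Proof.
move=> mF F0; rewrite /avg ge0_integral_sum//; last by move=> k; exact: measurable_funTS.
rewrite ge0_sume_distrr// => k _; exact: integral_ge0.
Qed.

(** The parent cube contains the child and has [ratio D] times its volume. This is the doubling
    property behind [bmo_jump] and [meandiff_le]. *)
Lemma avg_child j F x : measurable_fun setT F -> (forall y, (0 <= F y)%E) ->
  (avg (j + 1) F x <= (ratio D)%:E * avg j F x)%E.
Proof.
move=> mF F0; rewrite /avg volD vol1 invfM invrK EFinM -muleA muleCA.
rewrite lee_wpmul2l ?lee_fin ?(ltW ratio_gt0)//.
rewrite lee_wpmul2l ?lee_fin ?invr_ge0 ?(ltW (vol_gt0 _))//.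
apply: ge0_subset_integral => //; first exact: measurable_funTS.
by move=> y; rewrite /cubex /cube/= => /cell_nest.
Qed.

(* Every point of the cube sees the same bound, because [mu] of a cube is positive. *)
Lemma ae_level j (P : set T) : {ae mu, forall x, P x} ->
  (forall x y, cell D j x = cell D j y -> P x -> P y) -> forall x, P x.
Proof.
move=> [N [mN N0 PN]] Pj x; apply: contrapT => nPx.
have cN : cubex j x `<=` N.
  by move=> y yx; apply: PN => /(Pj y x yx).
have : (mu (cubex j x) <= mu N)%E by rewrite le_measure ?inE.
by rewrite N0 mucubex lee_fin leNgt vol_gt0.
Qed.

End Dyadic.

(** * Lebesgue differentiation *)

Section Differentiation.
Context {R : realType} {d : measure_display} {T : measurableType d}
  {mu : {measure set T -> \bar R}} (D : dyadicSystem mu).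
Implicit Types (j l : int) (i : idx D) (F G : T -> \bar R) (f g : T -> R).
Local Notation vol := (vol D).
Local Notation cube := (cube D).
Local Notation cubex := (cubex D).
Local Notation avg := (avg D).
Local Notation level := (level D).
Local Notation lset := (lset D).
Hint Resolve mcube mcubex : core.

Definition mean j f x : R := fine (avg j (EFin \o f) x).
Definition locint f := measurable_fun setT f /\
  forall j i, mu.-integrable (cube j i) (EFin \o f).

Lemma integrable_le (E : set T) f (F : T -> \bar R) : measurable E ->
  measurable_fun setT f -> measurable_fun setT F ->
  (forall x, (`|f x|%:E <= F x)%E) ->
  (\int[mu]_(x in E) F x < +oo)%E -> mu.-integrable E (EFin \o f).
Proof.
move=> mE mf mF fF Foo; apply/integrableP; split.
  by apply/measurable_EFinP; exact: measurable_funTS.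
apply: le_lt_trans Foo; apply: ge0_le_integral => //.
- by apply: measurableT_comp => //; apply/measurable_EFinP; exact: measurable_funTS.
- exact: measurable_funTS.
- by move=> x _; exact: fF.
Qed.

Lemma avg_mean j f x : locint f -> avg j (EFin \o f) x = (mean j f x)%:E.
Proof.
move=> [mf fi]; rewrite /mean fineK// /avg fin_numM//.
by have := integrable_fin_num (mcubex D j x) (fi j (cell D j x)).
Qed.

Lemma meanD j f g x : locint f -> locint g ->
  mean j (f \+ g) x = mean j f x + mean j g x.
Proof.
move=> lf lg; apply: EFin_inj; rewrite EFinD -!avg_mean//; last first.
  case: lf lg => mf fi [mg gi]; split; first exact: measurable_funD.
  move=> l i; have := integrableD (mcube D l i) (fi l i) (gi l i).
  by apply: eq_integrable.
rewrite /avg -muleDr//.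
- congr (_ * _)%E; rewrite -integralD//; [exact: lf.2|exact: lg.2].
- by rewrite fin_num_adde_defr//; apply: integrable_fin_num => //; exact: lf.2.
Qed.

Lemma locintD f g : locint f -> locint g -> locint (f \+ g).
Proof.
case=> mf fi [mg gi]; split; first exact: measurable_funD.
move=> l i; have := integrableD (mcube D l i) (fi l i) (gi l i).
exact: eq_integrable.
Qed.

Lemma locintZ (k : R) f : locint f -> locint (fun x => k * f x).
Proof.
case=> mf fi; split; first exact: measurable_funM.
move=> l i; have := integrableZl (mcube D l i) k (fi l i).
exact: eq_integrable.
Qed.

Lemma meanZ j (k : R) f x : locint f -> mean j (fun y => k * f y) x = k * mean j f x.
Proof.
move=> lf; apply: EFin_inj; rewrite EFinM -!avg_mean//; last exact: locintZ.
rewrite /avg muleCA; congr (_ * _)%E; rewrite -integralZl//; exact: lf.2.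
Qed.

Lemma locintN f : locint f -> locint (\- f).
Proof. by move=> /(locintZ (-1)); congr locint; apply/funext => x; rewrite mulN1r. Qed.

Lemma locintB f g : locint f -> locint g -> locint (f \- g).
Proof. by move=> lf lg; apply: locintD => //; exact: locintN. Qed.

Lemma meanN j f x : locint f -> mean j (\- f) x = - mean j f x.
Proof.
move=> /(meanZ j (-1) f x); rewrite mulN1r => <-; congr mean.
by apply/funext => y; rewrite mulN1r.
Qed.

Lemma meanB j f g x : locint f -> locint g ->
  mean j (f \- g) x = mean j f x - mean j g x.
Proof.
by move=> lf lg; rewrite -(meanN j g)// -meanD//; exact: locintN.
Qed.

Lemma locint_norm f : locint f -> locint (fun x => `|f x|).
Proof.
case=> mf fi; split; first exact: measurableT_comp.
by move=> l i; have := integrable_abse (fi l i).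
Qed.

Lemma locint_le f g : measurable_fun setT f -> locint g ->
  (forall x, `|f x| <= g x) -> locint f.
Proof.
move=> mf [mg gi] fg; split=> // j i.
apply: (integrable_le (cube j i) f (EFin \o g)) => //.
- by apply/measurable_EFinP.
- have /integrableP[_] := gi j i; apply: le_lt_trans.
  apply: ge0_le_integral => //=.
  - by move=> x _; rewrite lee_fin (le_trans _ (fg x)).
  - by apply/measurable_EFinP; exact: measurable_funTS.
  - by apply/measurable_EFinP; apply: measurableT_comp => //; exact: measurable_funTS.
  - by move=> x _; rewrite lee_fin ler_norm.
Qed.

Lemma level_mean j f : level j (mean j f).
Proof. by move=> x y xy; rewrite /mean (level_avg D j _ x y). Qed.

Lemma measurable_mean j f (E : set T) : measurable E -> measurable_fun E (mean j f).
Proof. by move=> mE; apply: (measurable_level D _ _ j) => //; exact: level_mean. Qed.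

(** Where the average of [f] is infinite, the left-hand side is 0 by the convention of [fine]. *)
Lemma normr_mean_le j f x : measurable_fun setT f ->
  (`|mean j f x|%:E <= avg j (fun y => `|f y|%:E) x)%E.
Proof.
move=> mf; rewrite /mean.
have H : (`|avg j (EFin \o f) x| <= avg j (fun y => `|f y|%:E) x)%E.
  rewrite /avg abseM gee0_abs ?lee_fin ?invr_ge0 ?(ltW (vol_gt0 _ _))//.
  rewrite lee_wpmul2l ?lee_fin ?invr_ge0 ?(ltW (vol_gt0 _ _))//.
  apply: le_abse_integral => //.
  by apply/measurable_EFinP; exact: measurable_funTS.
move: H; case: (avg j (EFin \o f) x) => [r//||]/= _; rewrite normr0.
  by rewrite avg_ge0// => y; rewrite lee_fin.
by rewrite avg_ge0// => y; rewrite lee_fin.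
Qed.

Lemma avg_eq j F G x : (forall y, cubex j x y -> F y = G y) -> avg j F x = avg j G x.
Proof.
move=> FG; rewrite /avg; congr (_ * _)%E; apply: eq_integral => y.
by rewrite inE => /FG.
Qed.

Lemma mean_level j l f x : j <= l -> level j f -> mean l f x = f x.
Proof.
move=> jl fj; rewrite /mean (avg_eq _ _ (fun=> (f x)%:E)) ?avg_cst//.
by move=> y yx /=; rewrite (fj y x)//; apply: cell_le yx.
Qed.

(* The union of the [S k] is the event that the averages of [F] ever exceed [c]. *)
Lemma stopping_bound j x0 F (c : R) (S : nat -> set T) : 0 <= c ->
  measurable_fun setT F -> (forall x, (0 <= F x)%E) ->
  (forall k : nat, lset (j + k%:Z) (S k)) -> trivIset setT S ->
  (forall (k : nat) x, S k x -> (c%:E <= avg (j + k%:Z) F x)%E) ->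
  (c%:E * mu (cubex j x0 `&` \bigcup_k S k) <= \int[mu]_(x in cubex j x0) F x)%E.
Proof.
move=> c0 mF F0 Sl tS Sc.
have mS k : measurable (S k) by exact: measurable_level_set (Sl k).
have lk k : lset (j + k%:Z) (cubex j x0 `&` S k).
  by apply: lsetI => //; apply: lset_cubex; rewrite lerDl.
have mQS k : measurable (cubex j x0 `&` S k) by exact: measurableI.
apply: (@le_trans _ _ (\int[mu]_(x in cubex j x0 `&` \bigcup_k S k) F x))%E; last first.
  apply: ge0_subset_integral => //; last exact: measurable_funTS.
  by apply: measurableI => //; exact: bigcup_measurable.
rewrite setI_bigcupr ge0_integral_bigcup//; last 2 first.
- exact: measurable_funTS.
- exact: trivIset_setIl.
rewrite measure_bigcup//; last exact: trivIset_setIl.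
rewrite -nneseriesZl//.
rewrite (_ : \sum_(i <oo | i \in setT) _ =
   \sum_(i <oo) (c%:E * mu (cubex j x0 `&` S i)))%E; last first.
  by apply: eq_eseriesl => k; rewrite in_setT.
apply: lee_nneseries => [k _ _|k _].
  by rewrite mule_ge0.
(* [S k] is a union of cubes of generation [j + k], so [F] may be replaced there by its average,
   which is at least [c]. *)
rewrite -(integral_avg D (j + k%:Z))// -integral_cst//.
apply: ge0_le_integral => //.
- exact: measurable_avg.
- by move=> x [_ Sx]; exact: Sc.
Qed.

(** Weak type (1,1) of the dyadic maximal function over generations from [j] on: [S k] is the event
    that the average first exceeds [c] at generation [j + k], and these events are disjoint. *)
Lemma avg_weak_type j x0 F (c : R) : 0 <= c ->
  measurable_fun setT F -> (forall x, (0 <= F x)%E) ->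
  (c%:E * mu (cubex j x0 `&` [set x | exists k : nat, (c%:E < avg (j + k%:Z) F x)%E]) <=
    \int[mu]_(x in cubex j x0) F x)%E.
Proof.
move=> c0 mF F0.
pose S (k : nat) := [set x | (c%:E < avg (j + k%:Z) F x)%E /\
   forall m, (m < k)%N -> (avg (j + m%:Z) F x <= c%:E)%E].
have -> : [set x | exists k : nat, (c%:E < avg (j + k%:Z) F x)%E] = \bigcup_k S k.
  apply/seteqP; split => x; last by move=> [k _ [? _]]; exists k.
  move=> H; have := @ex_minnP (fun k : nat => (c%:E < avg (j + k%:Z) F x)%E) H.
  case=> k kx kmin; exists k => //; split=> // m mk.
  by rewrite leNgt; apply/negP => /kmin; rewrite leqNgt mk.
apply: stopping_bound => //.
- move=> k x y xy [xk xm]; split.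
    by rewrite -(level_avg D _ _ x y).
  move=> m mk; rewrite -(level_avg D _ _ x y); first exact: xm.
  by apply: cell_le xy; rewrite lerD2l lez_nat ltnW.
- apply/trivIsetP => k m _ _ km; rewrite -subset0 => x [[kx kmin] [mx mmin]].
  have [H|H|H] := ltngtP k m; last by rewrite H eqxx in km.
    by have := mmin _ H; rewrite leNgt kx.
  by have := kmin _ H; rewrite leNgt mx.
- by move=> k x [/ltW].
Qed.

Definition differentiable_on (E : set T) f :=
  {ae mu, forall x, E x -> (fun k : nat => mean k%:Z f x) @ \oo --> f x}.

(** Banach's principle: by the weak type inequality, almost everywhere differentiability on a cube
    is stable under [L^1] approximation there. *)
Lemma differentiable_on_approx x0 f : locint f ->
  (forall e, 0 < e -> exists2 g, locint g /\ differentiable_on (cubex 0 x0) g &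
     (\int[mu]_(x in cubex 0 x0) `|f x - g x|%:E <= e%:E)%E) ->
  differentiable_on (cubex 0 x0) f.
Proof.
move=> lf H.
(* The 3 counts the terms of [f - mean f = (f - g) + (g - mean g) - mean (f - g)], each at most
   [1/(n+1)] off a small set. *)
pose bad (n : nat) x := ~ exists K : nat, forall k, (K <= k)%N ->
   `|f x - mean k%:Z f x| <= 3 * n.+1%:R^-1.
have Hbad n e : 0 < e -> exists2 U, measurable U /\
    (mu U <= (2 * n.+1%:R * e)%:E)%E & forall x, cubex 0 x0 x -> bad n x -> U x.
  move=> e0; have [g [lg [N [mN N0] gN]] fge] := H e e0.
  have lfg : locint (fun x => `|f x - g x|).
    by have := locint_norm _ (locintB _ _ lf lg).
  pose c : R := n.+1%:R^-1.
  have c0 : 0 < c by rewrite invr_gt0.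
  have mfg : measurable_fun setT (fun x => `|f x - g x|%:E).
    by apply/measurable_EFinP; exact: lfg.1.
  pose A := cubex 0 x0 `&`
    [set x | exists k : nat, (c%:E < avg (0 + k%:Z) (fun x => `|f x - g x|%:E) x)%E].
  pose B := cubex 0 x0 `&` [set x | (c%:E <= `|(`|f x - g x|%:E)|)%E].
  have mA : measurable A.
    rewrite /A (_ : [set _ | _] = \bigcup_(k in [set: nat])
       [set x | (c%:E < avg (0 + k%:Z) (fun x => `|f x - g x|%:E) x)%E]); last first.
      by apply/seteqP; split => x; [move=> [k ?]; exists k|move=> [k _ ?]; exists k].
    apply: measurableI => //; apply: bigcup_measurable => k _.
    rewrite -[X in measurable X]setTI; apply: emeasurable_fun_o_infty => //.
    exact: measurable_avg.
  have mB : measurable B.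
    apply: emeasurable_fun_c_infty; first exact: mcubex.
    by apply: measurableT_comp => //; exact: measurable_funTS.
  exists (N `|` (A `|` B)).
    split; first by do 2?apply: measurableU.
    have cn (z : \bar R) : (c%:E * z <= e%:E -> z <= (n.+1%:R * e)%:E)%E.
      by rewrite EFinM -(@lee_pdivrMl _ n.+1%:R).
    have hA : (mu A <= (n.+1%:R * e)%:E)%E.
      apply: cn; apply: le_trans fge.
      by apply: avg_weak_type => //; exact: ltW.
    have hB : (mu B <= (n.+1%:R * e)%:E)%E.
      apply: cn; apply: le_trans fge.
      have := @le_integral_abse _ _ _ mu (cubex 0 x0) (mcubex D 0 x0)
        (fun x => `|f x - g x|%:E) c (measurable_funTS mfg) c0.
      by move=> /le_trans; apply; under eq_integral do rewrite abse_EFin normr_id.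
    apply: (@le_trans _ _ (mu N + (mu A + mu B)))%E.
      apply: (le_trans (measureU2 _ _ _)) => //; first exact: measurableU.
      by rewrite leeD2l//; exact: measureU2.
    rewrite N0 add0e -mulrA mulr_natl mulr2n EFinD; exact: leeD.
  move=> x Qx; apply: contra_notP => /not_orP[nN /not_orP[nA nB]].
  have /cvgrPdist_le/(_ c c0)[K _ HK] : (fun k : nat => mean k%:Z g x) @ \oo --> g x.
    by apply: contrapT => ng; apply: nN; apply: gN => /(_ Qx).
  exists K => k Kk.
  have h1 := HK k Kk.
  have h2 : `|f x - g x| <= c.
    rewrite leNgt; apply/negP => h; apply: nB; split=> //=.
    by rewrite /= normr_id lee_fin ltW.
  have h3 : `|mean k%:Z (f \- g) x| <= c.
    rewrite -lee_fin; apply: (le_trans (normr_mean_le _ _ _ (locintB _ _ lf lg).1)).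
    rewrite leNgt; apply/negP => h; apply: nA; split=> //=.
    by exists k; rewrite add0r.
  rewrite meanB// in h3.
  have -> : f x - mean k%:Z f x = (f x - g x) + ((g x - mean k%:Z g x) -
     (mean k%:Z f x - mean k%:Z g x)) by ring.
  apply: (le_trans (ler_normD _ _)); apply: (@le_trans _ _ (c + (c + c))); last by rewrite -/c; lra.
  by apply: lerD => //; apply: (le_trans (ler_normB _ _)); exact: lerD.
have neg n : {ae mu, forall x, cubex 0 x0 x -> ~ bad n x}.
  pose u (m : nat) : R := m.+1%:R^-1.
  have /choice[U HU] : forall m, exists V : set T, [/\ measurable V,
      (mu V <= (2 * n.+1%:R * u m)%:E)%E & forall x, cubex 0 x0 x -> bad n x -> V x].
    move=> m; have [|V [mV hV] HV] := Hbad n (u m); first by rewrite invr_gt0.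
    by exists V.
  have mU : measurable (\bigcap_m U m).
    by apply: bigcap_measurable => // m _; case: (HU m).
  exists (\bigcap_m U m); split=> //; last first.
    move=> x /= /not_implyP[Qx /contrapT bx] m _.
    by have [_ _] := HU m; exact.
  apply/eqP; rewrite eq_le measure_ge0 andbT.
  apply/lee_addgt0Pr => e e0; rewrite add0e.
  pose m := Num.bound (2 * n.+1%:R / e).
  have Hm : 2 * n.+1%:R / e < m%:R by apply: archi_boundP; rewrite divr_ge0 ?ltW ?mulr_gt0.
  have [_ h _] := HU m.
  apply: (@le_trans _ _ (mu (U m))).
    by apply: le_measure; rewrite ?inE//; [case: (HU m)|exact: bigcap_inf].
  apply: (le_trans h); rewrite lee_fin /u ler_pdivrMr//.
  move: Hm; rewrite ltr_pdivrMr// => /ltW/le_trans; apply.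
  by rewrite mulrC ler_pM2l// ler_nat.
move/ae_foralln : neg; apply: filterS => x H' Qx.
apply/cvgrPdist_le => e e0.
pose n := Num.bound (3 / e).
have Hn : 3 / e < n%:R by apply: archi_boundP; rewrite divr_ge0 ?ltW.
have /contrapT[K HK] := H' n Qx.
exists K => // k /= /HK/le_trans; apply.
rewrite ler_pdivrMr//; move: Hn; rewrite ltr_pdivrMr// => /ltW/le_trans; apply.
by rewrite mulrC ler_pM2l// ler_nat.
Qed.

Lemma differentiable_onD (E : set T) f g : locint f -> locint g ->
  differentiable_on E f -> differentiable_on E g -> differentiable_on E (f \+ g).
Proof.
move=> lf lg; apply: filterS2 => x cf cg Ex.
under eq_fun do rewrite meanD//.
by apply: cvgD; [exact: cf|exact: cg].
Qed.

Lemma differentiable_onZ (E : set T) (k : R) f : locint f ->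
  differentiable_on E f -> differentiable_on E (fun x => k * f x).
Proof.
move=> lf; apply: filterS => x cf Ex.
under eq_fun do rewrite meanZ//.
by apply: cvgM; [exact: cvg_cst|exact: cf].
Qed.

Lemma differentiable_on_level (E : set T) j f : level j f -> differentiable_on E f.
Proof.
move=> fj; apply: aeW => x _.
apply: cvg_near_cst; exists `|j|%N => // k /= jk.
by apply: (mean_level j) => //; rewrite (le_trans (ler_norm j)).
Qed.

Lemma locint_cst (c : R) : locint (cst c).
Proof.
split=> // j i; apply/integrableP; split; first by apply/measurable_EFinP.
rewrite [X in (X < _)%E](_ : _ = \int[mu]_(x in cube j i) cst `|c|%:E x)%E//.
by rewrite integral_cst// mucube -EFinM ltry.
Qed.

Lemma locint_bounded f (c : R) : measurable_fun setT f ->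
  (forall x, `|f x| <= c) -> locint f.
Proof. by move=> mf fc; apply: (locint_le _ (cst c)) => //; exact: locint_cst. Qed.

(** Differentiation is clear for functions constant on the cubes of one generation. Indicators are
    reached from them by approximation in measure inside each cube of generation 0. *)
Let approximable (A : set T) := measurable A /\ forall x0 e, 0 < e ->
  exists (N : nat) (B : set T), lset N%:Z B /\
    (mu (cubex 0 x0 `&` ((A `\` B) `|` (B `\` A))) <= e%:E)%E.

Let approximable_setU A B : approximable A -> approximable B -> approximable (A `|` B).
Proof.
move=> [mA hA] [mB hB]; split; first exact: measurableU.
move=> x0 e e0; have e20 : 0 < e / 2 by rewrite divr_gt0.
have [N [A' [lA' hA']]] := hA x0 _ e20; have [M [B' [lB' hB']]] := hB x0 _ e20.
exists (maxn N M), (A' `|` B').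
have lA2 : lset (maxn N M) A' by apply: lset_le lA'; rewrite lez_nat leq_maxl.
have lB2 : lset (maxn N M) B' by apply: lset_le lB'; rewrite lez_nat leq_maxr.
split; first by move=> x y xy [/(lA2 _ _ xy)|/(lB2 _ _ xy)]; [left|right].
have mA' : measurable A' by exact: measurable_level_set lA'.
have mB' : measurable B' by exact: measurable_level_set lB'.
rewrite [e]splitr EFinD; apply: le_trans (leeD hA' hB').
have mA2 : measurable (cubex 0 x0 `&` (A `\` A' `|` A' `\` A)).
  by apply: measurableI => //; apply: measurableU; exact: measurableD.
have mB2 : measurable (cubex 0 x0 `&` (B `\` B' `|` B' `\` B)).
  by apply: measurableI => //; apply: measurableU; exact: measurableD.
set E1 := cubex 0 x0 `&` _ in mA2 *; set E2 := cubex 0 x0 `&` (_ `|` B' `\` B) in mB2 *.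
apply: (@le_trans _ _ (mu (E1 `|` E2))); last exact: measureU2.
apply: le_measure; rewrite ?inE.
- by apply: measurableI => //; apply: measurableU; apply: measurableD; exact: measurableU.
- exact: measurableU.
move=> x [Qx [[[Ax|Bx] /not_orP[nA nB]]|[[Ax|Bx] /not_orP[nA nB]]]].
- by left; split=> //; left.
- by right; split=> //; left.
- by left; split=> //; right.
- by right; split=> //; right.
Qed.

(** The approximable sets contain the cubes and form a sigma-algebra, and the cubes generate all
    measurable sets. *)
Let approximable_measurable A : measurable A -> approximable A.
Proof.
move=> mA; have := cube_gen D A mA; apply: smallest_sub.
- split.
  + split=> // x0 e e0; exists 0%N, set0; split=> //.
    by rewrite !setD0 setU0 setI0 measure0 lee_fin ltW.
  + move=> B [mB hB]; split; first by rewrite setTD; exact: measurableC.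
    move=> x0 e e0; have [N [B' [lB' hB']]] := hB x0 _ e0.
    exists N, (~` B'); split.
      by move=> x y xy Bx By; apply: Bx; apply: lB' By; rewrite xy.
    rewrite setTD [X in cubex 0 x0 `&` X](_ : _ = (B `\` B' `|` B' `\` B))//.
    rewrite setUC; congr (_ `|` _); apply/seteqP; split => x /=.
    * by move=> [/= ? /contrapT ?].
    * by move=> [/= ? ?]; split => // /(_ _).
    * by move=> [/= ? /contrapT ?].
    * by move=> [/= ? ?]; split => // /(_ _).
  + move=> F hF; have mF k : measurable (F k) by have [] := hF k.
    have mUF : measurable (\bigcup_k F k) by exact: bigcup_measurable.
    split=> // x0 e e0; have e20 : 0 < e / 2 by rewrite divr_gt0.
    have hS n : approximable (\big[setU/set0]_(k < n) F k).
      elim: n => [|n IH]; last by rewrite big_ord_recr/=; exact: approximable_setU.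
      rewrite big_ord0; split=> // x1 e1 e10; exists 0%N, set0; split=> //.
      by rewrite !setD0 setU0 setI0 measure0 lee_fin ltW.
    (* What the first [n] members leave uncovered decreases to the empty set inside a cube of finite
       measure, so a finite union suffices up to [e / 2]. *)
    pose G n := cubex 0 x0 `&` (\bigcup_k F k `\` \big[setU/set0]_(k < n) F k).
    have mG n : measurable (G n).
      by apply: measurableI => //; apply: measurableD => //; have [] := hS n.
    have G0 : \bigcap_n G n = set0.
      rewrite -subset0 => x H; have [_ [[k _ kx] _]] := H 0%N I.
      have [_ [_ +]] := H k.+1 I; apply.
      by rewrite -bigcup_mkord; exists k => /=.
    have : mu \o G @ \oo --> mu (\bigcap_n G n).
      apply: nonincreasing_cvg_mu => //.
      - apply: le_lt_trans (_ : mu (cubex 0 x0) < +oo)%E.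
          by apply: le_measure; [rewrite inE; exact: mG|rewrite inE; exact: mcubex|exact: subIsetl].
        by rewrite mucubex ltry.
      - by rewrite G0.
      - move=> m n mn; rewrite subsetEset; apply: setIS; apply: setDS.
        by rewrite -!bigcup_mkord; apply: bigcup_sub => k /= km; apply: bigcup_sup; exact: leq_trans mn.
    rewrite G0 measure0 => /fine_cvgP[_ /cvgrPdist_lt/(_ _ e20)[n _ Hn]].
    have hGn : (mu (G n) <= (e / 2)%:E)%E.
      have Gfin : mu (G n) \is a fin_num.
        rewrite ge0_fin_numE//; apply: le_lt_trans (_ : mu (cubex 0 x0) < +oo)%E.
          by apply: le_measure; [rewrite inE; exact: mG|rewrite inE; exact: mcubex|exact: subIsetl].
        by rewrite mucubex ltry.
      have := Hn n (leqnn _); rewrite /= sub0r normrN ger0_norm ?fine_ge0// => /ltW.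
      by rewrite -lee_fin fineK.
    have [mSn /(_ x0 _ e20)[N [B [lB hB]]]] := hS n.
    exists N, B; split=> //.
    have mB : measurable B by exact: measurable_level_set lB.
    set S := \big[setU/set0]_(k < n) F k in mSn hB hGn *.
    rewrite [e]splitr EFinD; apply: le_trans (leeD hGn hB).
    have mSB : measurable (cubex 0 x0 `&` (S `\` B `|` B `\` S)).
      by apply: measurableI => //; apply: measurableU; exact: measurableD.
    set E2 := cubex 0 x0 `&` _ in mSB *.
    apply: (@le_trans _ _ (mu (G n `|` E2))); last exact: measureU2.
    apply: le_measure; rewrite ?inE.
    * by apply: measurableI => //; apply: measurableU; exact: measurableD.
    * exact: measurableU.
    have SF : S `<=` \bigcup_k F k.
      by rewrite /S -bigcup_mkord; apply: bigcup_sub => k _; exact: bigcup_sup.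
    move=> x [Qx [[Ux nB]|[Bx nU]]].
      have [Sx|nS] := pselect (S x); [right|left]; split=> //.
      by left.
    by right; split=> //; right; split=> // /SF.
- move=> _ [j [i ->]]; split; first exact: measurable_cube.
  move=> x0 e e0; exists `|j|%N, (cube j i); split.
    move=> x y /(cell_le D j) xy; rewrite /cube/= => <-; apply/esym/xy.
    by rewrite (le_trans (ler_norm j))// abszE.
  by rewrite setDv setU0 setI0 measure0 lee_fin ltW.
Qed.

Lemma locint_indic (A : set T) : measurable A -> locint \1_A.
Proof.
move=> mA; apply: (locint_bounded _ 1) => [|x]; first exact: measurable_indic.
by rewrite indicE; case: (_ \in _); rewrite ?normr1 ?normr0.
Qed.

Let differentiable_on_indic x0 (A : set T) : measurable A ->
  differentiable_on (cubex 0 x0) \1_A.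
Proof.
move=> mA; have [_ hA] := approximable_measurable A mA.
apply: differentiable_on_approx; first exact: locint_indic.
move=> e e0; have [N [B [lB hB]]] := hA x0 e e0.
have mB : measurable B by exact: measurable_level_set lB.
exists (\1_B).
  split; first exact: locint_indic.
  apply: (differentiable_on_level _ N%:Z) => x y xy; rewrite !indicE.
  congr (_ %:R); apply: congr1; apply/idP/idP; rewrite !inE; first exact: lB.
  by apply: lB; rewrite xy.
apply: le_trans hB.
have mAB : measurable (A `\` B `|` B `\` A) by apply: measurableU; exact: measurableD.
rewrite setIC -integral_indic//; apply: ge0_le_integral => //.
- apply/measurable_EFinP; apply: measurableT_comp => //.
  by apply: measurable_funB; exact: measurable_indic.
- by apply/measurable_EFinP; exact: measurable_indic.
move=> x _; rewrite lee_fin !indicE.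
have [xA|xA] := boolP (x \in A); have [xB|xB] := boolP (x \in B).
- by rewrite subrr normr0.
- rewrite subr0 normr1 mem_set//; left; split; first exact: set_mem.
  by move/mem_set; exact/negP.
- rewrite sub0r normrN normr1 mem_set//; right; split; first exact: set_mem.
  by move/mem_set; exact/negP.
- by rewrite subrr normr0.
Qed.

Import HBSimple.

Let differentiable_on_sfun x0 (g : {sfun T >-> R}) :
  locint g /\ differentiable_on (cubex 0 x0) g.
Proof.
have : forall s : seq R, locint (fun x => \sum_(y <- s) y * \1_(g @^-1` [set y]) x) /\
  differentiable_on (cubex 0 x0) (fun x => \sum_(y <- s) y * \1_(g @^-1` [set y]) x).
  elim=> [|y s [IH1 IH2]].
    have -> : (fun x => \sum_(y <- [::]) y * \1_(g @^-1` [set y]) x) = cst 0.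
      by apply/funext => x; rewrite big_nil.
    by split; [exact: locint_cst|exact: (differentiable_on_level _ 0)].
  have -> : (fun x => \sum_(y0 <- y :: s) y0 * \1_(g @^-1` [set y0]) x) =
    (fun x => y * \1_(g @^-1` [set y]) x) \+
      (fun x => \sum_(y <- s) y * \1_(g @^-1` [set y]) x).
    by apply/funext => x; rewrite big_cons.
  have m1 : measurable (g @^-1` [set y]) by exact: measurable_sfunP.
  split; first by apply: locintD => //; apply: locintZ; exact: locint_indic.
  apply: differentiable_onD => //; first by apply: locintZ; exact: locint_indic.
  apply: differentiable_onZ; first exact: locint_indic.
  exact: differentiable_on_indic.
move=> /(_ (finmap.enum_fset (fset_set (range g)))).
congr (locint _ /\ differentiable_on _ _); apply/funext => x;
  by rewrite [RHS]fimfunE fsbig_finite.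
Qed.

(** Simple functions are dense in [L^1] of each cube of generation 0; quantifying over the countably
    many codes of these cubes merges the exceptional sets into one. *)
Theorem mean_cvg_ae f : locint f ->
  {ae mu, forall x, (fun k : nat => mean k%:Z f x) @ \oo --> f x}.
Proof.
move=> lf.
have Q x0 : differentiable_on (cubex 0 x0) f.
  apply: differentiable_on_approx => // e e0.
  have fi : mu.-integrable (cubex 0 x0) (EFin \o f) by exact: lf.2.
  have [g [gi _ /fine_cvgP[gfin /cvgrPdist_le/(_ e e0) gcvg]]] :=
    approximation_sfun_integrable (mcubex D 0 x0) fi.
  pose J n := (\int[mu]_(x in cubex 0 x0) `|(EFin \o f) x - (g n x)%:E|)%E.
  have [n [nfin ncvg]] : exists n, J n \is a fin_num /\ `|0 - fine (J n)| <= e.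
    have [n _ H] := filterI gfin gcvg.
    by exists n; have := H n (leqnn _); rewrite /=.
  have [lg dg] := differentiable_on_sfun x0 (g n).
  exists (g n) => //.
  move: ncvg; rewrite sub0r normrN => /(le_trans (ler_norm _)).
  by rewrite -lee_fin fineK.
have : {ae mu, forall x (k : nat), forall i, unpickle k = Some i -> cube 0 i x ->
   (fun k : nat => mean k%:Z f x) @ \oo --> f x}.
  apply/ae_foralln => k; case: (unpickle k) => [i|]; last exact: aeW.
  have [[x0 i0]|nx] := pselect (exists x0, cell D 0 x0 = i).
    apply: filterS (Q x0) => x H i' [<-] ix; apply: H.
    by rewrite /cubex i0.
  by apply: aeW => x i' [<-] xi; case: nx; exists x.
apply: filterS => x /(_ (pickle (cell D 0 x)) (cell D 0 x)).
by rewrite pickleK; apply.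
Qed.

End Differentiation.

(** * The John-Nirenberg inequality *)

Lemma powR_cvg {R : realType} (u : nat -> R) (l p : R) : 0 < l ->
  u @ \oo --> l -> (fun n => u n `^ p) @ \oo --> l `^ p.
Proof.
move=> l0 ul.
suff cf : {for l, continuous (fun x : R => x `^ p)} by exact: (cvg_comp _ _ ul cf).
apply: differentiable_continuous; apply/derivable1_diffP.
by apply: derivable_powR; rewrite in_itv/= l0.
Qed.

Section JohnNirenberg.
Context {R : realType} {d : measure_display} {T : measurableType d}
  {mu : {measure set T -> \bar R}} (D : dyadicSystem mu).
Implicit Types (j l : int) (i : idx D) (F G : T -> \bar R) (f g a : T -> R).
Local Notation vol := (vol D).
Local Notation cube := (cube D).
Local Notation cubex := (cubex D).
Local Notation avg := (avg D).
Local Notation level := (level D).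
Local Notation lset := (lset D).
Local Notation mean := (mean D).
Local Notation locint := (locint D).
Hint Resolve mcube mcubex : core.

(** The bound is asked at every [x]: averages are constant on cubes, which have positive measure, so
    an almost everywhere bound is a bound everywhere ([ae_level]). *)
Definition bmo a (K : R) := locint a /\
  forall j x, (avg j (fun y => `|a y - mean j a y|%:E) x <= K%:E)%E.

Lemma avg_indic j x (S : set T) : measurable S ->
  avg j (fun y => (\1_S y)%:E) x = ((vol j)^-1%:E * mu (cubex j x `&` S))%E.
Proof. by move=> mS; rewrite /avg integral_indic// setIC. Qed.

Lemma bmo_center a K j x : bmo a K ->
  (avg j (fun y => `|a y - mean j a x|%:E) x <= K%:E)%E.
Proof.
move=> [la /(_ j x)]; rewrite (avg_eq _ _ _ (fun y => `|a y - mean j a x|%:E))// => y yx.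
by rewrite (level_mean D j a y x).
Qed.

Lemma mean_sub_cst j a (c : R) x : locint a -> mean j (fun y => a y - c) x = mean j a x - c.
Proof.
move=> la; rewrite (meanB D j a (cst c))//; last exact: locint_cst.
by rewrite (mean_level D j j (cst c)).
Qed.

Lemma measurable_normB a (c : R) : measurable_fun setT a ->
  measurable_fun setT (fun y => `|a y - c|%:E).
Proof.
move=> ma; apply/measurable_EFinP; apply: measurableT_comp => //.
exact: measurable_funB.
Qed.

Lemma bmo_jump a K j x : bmo a K -> `|mean (j + 1) a x - mean j a x| <= ratio D * K.
Proof.
move=> aK; have la := aK.1.
rewrite -lee_fin -(mean_sub_cst (j + 1))//.
apply: (le_trans (normr_mean_le _ _ _ _ _)); first exact: measurable_funB la.1 _.
apply: (le_trans (avg_child _ _ _ _ _ _)) => //; first exact: measurable_normB la.1.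
rewrite EFinM lee_wpmul2l ?lee_fin ?(ltW (ratio_gt0 D))//.
exact: bmo_center.
Qed.

(* Stop when the mean first leaves the ball of radius [2K]: this happens on at most
   half of the cube, and the induction hypothesis applies from there on. *)
Lemma john_nirenberg_mean a K p : 0 < K -> 0 < p -> bmo a K ->
  exists2 B, 0 <= B & forall (k : nat) j x,
    (avg j (fun y => (`|mean (j + k%:Z) a y - mean j a y| `^ p)%:E) x <= B%:E)%E.
Proof.
move=> K0 p0 aK; have la := aK.1.
have bK : 0 <= ratio D * K by rewrite mulr_ge0// ltW// ratio_gt0.
have [|C C0 HC] := powR_add_bound (2 * K + ratio D * K) p _ p0.
  by rewrite addr_ge0// mulr_ge0// ltW.
(* The solution of [B = (2K)^p + (C + 3/2 B) / 2]: without exit the deviation is at most [2K], and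
   exits fill at most half of the cube, where the average cost is [C + 3/2 B] by [powR_add_bound]
   and induction. *)
pose B := 4 * (2 * K) `^ p + 2 * C.
have B0 : 0 <= B by rewrite addr_ge0// mulr_ge0// powR_ge0.
(* Strong induction on the number of generations, uniformly in [j], because it restarts from the
   generation of the exit. *)
exists B => // k; have [n] := ubnP k; elim: n k => // n IH k kn j x.
set c0 := mean j a x.
rewrite (avg_eq _ _ _ (fun y => (`|mean (j + k%:Z) a y - c0| `^ p)%:E)); last first.
  by move=> y yx; rewrite (level_mean D j a y x).
pose S (m : nat) := [set y | 2 * K < `|mean (j + m%:Z) a y - c0| /\
   forall m', (m' < m)%N -> `|mean (j + m'%:Z) a y - c0| <= 2 * K].
have lS m : lset (j + m%:Z) (S m).
  move=> y z yz [ym ym']; split; first by rewrite -(level_mean D _ a y z).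
  move=> m' mm'; rewrite -(level_mean D _ a y z); first exact: ym'.
  by apply: cell_le yz; rewrite lerD2l lez_nat ltnW.
have mS m : measurable (S m) by exact: measurable_level_set (lS m).
have tS : trivIset setT S.
  apply/trivIsetP => m m' _ _ mm'; rewrite -subset0 => y [[my mmin] [my' mmin']].
  have [H|H|H] := ltngtP m m'; last by rewrite H eqxx in mm'.
    by have := mmin' _ H; rewrite leNgt my.
  by have := mmin _ H; rewrite leNgt my'.
have measS : (mu (cubex j x `&` \bigcup_m S m) <= (vol j / 2)%:E)%E.
  have : ((2 * K)%:E * mu (cubex j x `&` \bigcup_m S m) <= (K * vol j)%:E)%E.
    apply: (@le_trans _ _ (\int[mu]_(y in cubex j x) `|a y - c0|%:E))%E.
      apply: stopping_bound => //.
      - by rewrite mulr_ge0// ltW.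
      - exact: measurable_normB la.1.
      - move=> m y [/ltW ym _]; apply: le_trans (normr_mean_le _ _ _ _ _).
          by rewrite lee_fin mean_sub_cst.
        exact: measurable_funB la.1 _.
    rewrite integral_cubex muleC EFinM lee_wpmul2r ?lee_fin ?(ltW (vol_gt0 _ _))//.
    exact: bmo_center.
  rewrite -lee_pdivlMl ?mulr_gt0// => /le_trans; apply.
  rewrite -EFinM lee_fin le_eqVlt; apply/orP; left; apply/eqP.
  by field; rewrite gt_eqF.
pose G (m : nat) (y : T) : R := `|mean (j + k%:Z) a y - mean (j + m%:Z) a y| `^ p.
have mG m : measurable_fun setT (EFin \o G m).
  apply/measurable_EFinP; apply: (measurableT_comp (measurable_powR p)).
  apply: measurableT_comp => //; apply: measurable_funB; exact: measurable_mean.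
have G0 m y : (0 <= (G m y)%:E)%E by rewrite lee_fin powR_ge0.
pose H (m : nat) (y : T) : \bar R := ((\1_(S m) y)%:E * (C%:E + (3 / 2)%:E * (G m y)%:E))%E.
have mCG m : measurable_fun setT (fun y => C%:E + (3 / 2)%:E * (G m y)%:E)%E.
  by apply: emeasurable_funD; [exact: measurable_cst|apply: measurable_funeM; exact: mG].
have CG0 m y : (0 <= C%:E + (3 / 2)%:E * (G m y)%:E)%E.
  by rewrite adde_ge0 ?mule_ge0 ?lee_fin ?powR_ge0.
have m1S m : measurable_fun setT (fun y => (\1_(S m) y)%:E : \bar R).
  by apply/measurable_EFinP; exact: measurable_indic.
have mH m : measurable_fun setT (H m) by apply: emeasurable_funM.
have H0 m y : (0 <= H m y)%E by apply: mule_ge0 => //; rewrite lee_fin.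
(* Only [m.+1] occurs: at generation [j] the deviation from [c0] is 0, so no exit happens there. *)
pose U (y : T) : \bar R := (((2 * K) `^ p)%:E + \sum_(m < k) H m.+1 y)%E.
have mU : measurable_fun setT U.
  by apply: emeasurable_funD => //; apply: emeasurable_sum.
have pathwise y : cubex j x y -> ((`|mean (j + k%:Z) a y - c0| `^ p)%:E <= U y)%E.
  move=> yx; have [[m mk ym]|nm] := pselect (exists2 m : nat, (m <= k)%N &
      2 * K < `|mean (j + m%:Z) a y - c0|); last first.
    apply: (@le_trans _ _ ((2 * K) `^ p)%:E).
      rewrite lee_fin le_powR ?(ltW p0)// leNgt; apply/negP => h.
      by apply: nm; exists k.
    by rewrite leeDl// sume_ge0.
  have [m0 m0y m0min] := @ex_minnP (fun m : nat => 2 * K < `|mean (j + m%:Z) a y - c0|)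
    (ex_intro _ m ym).
  have m0k : (m0 <= k)%N by apply: leq_trans mk; exact: m0min.
  have m0p : (0 < m0)%N.
    case: m0 m0y {m0min m0k} => // ; rewrite addr0 (level_mean D j a y x)// subrr normr0.
    by rewrite ltNge mulr_ge0// ltW.
  have Sm0 : S m0 y.
    split=> // m' m'm; rewrite leNgt; apply/negP => /m0min.
    by rewrite leqNgt m'm.
  have m0E : m0 = m0.-1.+1 by rewrite prednK.
  have m01k : (m0.-1 < k)%N by rewrite -m0E.
  apply: (@le_trans _ _ (H m0 y)); last first.
    rewrite /U (bigD1 (Ordinal m01k))//= -m0E addeCA leeDl//.
    by rewrite adde_ge0 ?lee_fin ?powR_ge0// sume_ge0.
  rewrite /H indicE mem_set// mul1e -EFinM -EFinD lee_fin.
  apply: le_trans (HC _ (normr_ge0 _)).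
  rewrite le_powR ?(ltW p0)//.
  (* Before the exit the deviation is at most [2K], the exit itself jumps by at most [ratio D * K],
     and the rest is left to the induction. *)
  have -> : mean (j + k%:Z) a y - c0 = (mean (j + m0.-1%:Z) a y - c0) +
    (mean (j + m0%:Z) a y - mean (j + m0.-1%:Z) a y) +
    (mean (j + k%:Z) a y - mean (j + m0%:Z) a y) by ring.
  apply: (le_trans (ler_normD _ _)); rewrite lerD2r.
  apply: (le_trans (ler_normD _ _)); apply: lerD.
    by apply: Sm0.2; rewrite prednK.
  have -> : j + m0%:Z = j + m0.-1%:Z + 1 by rewrite {1}m0E -addn1 PoszD addrA.
  exact: bmo_jump.
apply: (@le_trans _ _ (avg j U x)).
  rewrite /avg lee_wpmul2l ?lee_fin ?invr_ge0 ?(ltW (vol_gt0 _ _))//.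
  apply: ge0_le_integral => //.
  - apply: measurable_funTS; apply/measurable_EFinP.
    apply: (measurableT_comp (measurable_powR p)).
    by apply: measurableT_comp => //; apply: measurable_funB => //; exact: measurable_mean.
  - exact: measurable_funTS.
have avgH (m : nat) : (avg j (H m.+1) x <= (C + 3 / 2 * B)%:E *
    ((vol j)^-1%:E * mu (cubex j x `&` S m.+1)))%E \/ (k <= m)%N.
  have [km|mk] := leqP k m; [by right|left].
  have jl : j <= j + m.+1%:Z by rewrite lerDl.
  rewrite /H -(avg_level D j (j + m.+1%:Z)) //; last first.
    move=> y z yz; rewrite !indicE; congr (_ %:R)%:E; apply: congr1.
    by apply/idP/idP; rewrite !inE; apply: lS.
  rewrite -avg_indic// -avgZ//; last by rewrite addr_ge0// mulr_ge0.
  apply: le_avg.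
  - by apply: emeasurable_funM => //; exact: measurable_avg.
  - exact: measurable_funeM.
  - by move=> y; rewrite mule_ge0 ?lee_fin// avg_ge0.
  move=> y; rewrite muleC lee_wpmul2r ?lee_fin//.
  rewrite avgD//; last 2 first.
  - by apply: measurable_funeM; exact: mG.
  - by move=> z; rewrite mule_ge0 ?lee_fin ?powR_ge0.
  have /= -> := avgZ D (j + m.+1%:Z) (3 / 2) (EFin \o G m.+1) y (mG _) (G0 _).
    2: by [].
  rewrite avg_cst [leRHS]EFinD leeD2l// [leRHS]EFinM lee_wpmul2l ?lee_fin//.
  have kE : k%:Z = m.+1%:Z + (k - m.+1)%N%:Z by rewrite -PoszD subnKC.
  rewrite /G; under [X in avg _ X _]eq_fun do rewrite kE addrA.
  apply: IH; apply: leq_ltn_trans (_ : k.-1 < n)%N; last by rewrite -ltnS prednK// (leq_ltn_trans _ mk).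
  by rewrite -subn1 leq_sub2l.
rewrite avgD//; last 3 first.
- by apply: emeasurable_sum.
- by move=> y; rewrite lee_fin powR_ge0.
- by move=> y; rewrite sume_ge0.
rewrite avg_cst avg_sum//.
have BE : B = (2 * K) `^ p + (C + 3 / 2 * B) / 2 by rewrite /B; lra.
rewrite BE EFinD leeD2l//.
apply: (@le_trans _ _ (\sum_(m < k) (C + 3 / 2 * B)%:E *
    ((vol j)^-1%:E * mu (cubex j x `&` S m.+1))))%E.
  by apply: lee_sum => -[m mk] _ /=; case: (avgH m) => //; rewrite leqNgt mk.
rewrite -ge0_sume_distrr; last first.
  by move=> m _; rewrite mule_ge0 ?lee_fin ?invr_ge0 ?(ltW (vol_gt0 _ _)).
have CB0 : 0 <= C + 3 / 2 * B by rewrite addr_ge0// mulr_ge0.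
rewrite [leRHS]EFinM lee_wpmul2l ?lee_fin//.
rewrite -ge0_sume_distrr//.
rewrite -lee_pdivlMl ?invr_gt0 ?vol_gt0// invrK -EFinM; apply: le_trans measS.
have mcup : (mu (cubex j x `&` \bigcup_m S m) = \sum_(m <oo) mu (cubex j x `&` S m))%E.
  rewrite setI_bigcupr measure_bigcup//.
  - by apply: eq_eseriesl => m; rewrite in_setT.
  - by move=> m _; apply: measurableI; [exact: mcubex|exact: mS].
  - exact: trivIset_setIl.
apply: (@le_trans _ _ (\sum_(0 <= m < k.+1) mu (cubex j x `&` S m))%E); last first.
  by rewrite mcup; exact: nneseries_lim_ge.
by rewrite big_mkord big_ord_recl/= leeDr.
Qed.

(** The means converge to [a] almost everywhere, so the moment bound for means passes to [a] by
    Fatou's lemma. *)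
Lemma john_nirenberg a K p : 0 < K -> 0 < p -> bmo a K ->
  exists2 B, 0 < B & forall j x,
    (avg j (fun y => ((1 + `|a y - mean j a y|) `^ p)%:E) x <= B%:E)%E.
Proof.
move=> K0 p0 aK; have la := aK.1.
have [B B0 HB] := john_nirenberg_mean a K p K0 p0 aK.
have [C C0 HC] := powR_add_bound 1 p ler01 p0.
exists (C + 3 / 2 * B + 1) => [|j x].
  by rewrite ltr_wpDl// addr_ge0// mulr_ge0.
(* [mean_cvg_ae] runs over the generations [k >= 0]; the shift by [n0] keeps them at or beyond [j],
   where [HB] applies. *)
pose n0 := `|j|%N.
have jn0 (n : nat) : j + `|(n + n0)%:Z - j|%N%:Z = (n + n0)%:Z.
  rewrite gez0_abs ?subr_ge0; first by rewrite [LHS]addrC subrK.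
  apply: le_trans (ler_norm j) _; rewrite -abszE lez_nat /n0; exact: leq_addl.
pose f (n : nat) (y : T) : \bar R := (`|mean (n + n0)%:Z a y - mean j a y| `^ p)%:E.
have mp (g : T -> R) : measurable_fun setT g ->
    measurable_fun setT (fun y => (`|g y| `^ p)%:E : \bar R).
  move=> mg; apply/measurable_EFinP; apply: (measurableT_comp (measurable_powR p)).
  exact: measurableT_comp.
have mf n : measurable_fun setT (f n).
  by apply: mp; apply: measurable_funB; exact: measurable_mean.
have f0 n y : (0 <= f n y)%E by rewrite lee_fin powR_ge0.
have maj : measurable_fun setT (fun y => (`|a y - mean j a y| `^ p)%:E : \bar R).
  by apply: mp; apply: measurable_funB; [exact: la.1|exact: measurable_mean].
have HL : (avg j (fun y => (`|a y - mean j a y| `^ p)%:E) x <= B%:E)%E.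
  apply: (@le_trans _ _ (avg j (fun y => limn_einf (f ^~ y)) x)).
    apply: ae_le_avg => //.
    - have -> : (fun y => limn_einf (f ^~ y)) =
          (fun y => (- limn_esup (fun n => - f n y))%E).
        by apply/funext => y; rewrite -[LHS]oppeK -limn_esupN.
      apply: measurableT_comp => //; apply: measurable_fun_limn_esup => n.
      exact: measurableT_comp.
    - move=> y; rewrite limn_einf_lim; apply: lime_ge; first exact: is_cvg_einfs.
      by apply: nearW => n; apply: le_ereal_inf_tmp => _ [m _ <-].
    apply: filterS (mean_cvg_ae D a la) => y cy.
    (* [powR_cvg] is for positive limits; when the limit is 0, nonnegativity of the lower limit is
       enough. *)
    have [y0|yN0] := eqVneq `|a y - mean j a y| 0.
      rewrite y0 powR0 ?gt_eqF// limn_einf_lim; apply: lime_ge; first exact: is_cvg_einfs.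
      by apply: nearW => n; apply: le_ereal_inf_tmp => _ [m _ <-].
    have cf : f ^~ y @ \oo --> (`|a y - mean j a y| `^ p)%:E.
      apply: cvg_EFin; first by apply: nearW.
      apply: powR_cvg; first by rewrite lt_neqAle eq_sym yN0 normr_ge0.
      apply: cvg_norm; apply: cvgB; last exact: cvg_cst.
      by rewrite (cvg_shiftn n0 (fun k : nat => mean k%:Z a y)).
    by have [-> _] := cvg_limn_einf_sup cf.
  rewrite /avg -lee_pdivlMl ?invr_gt0 ?vol_gt0// invrK.
  apply: (le_trans (fatou _ _ _ _)) => //.
    by move=> n; exact: measurable_funTS.
  rewrite limn_einf_lim; apply: lime_le; first exact: is_cvg_einfs.
  apply: nearW => n; apply: ereal_inf_le; exists (\int[mu]_(y in cubex j x) f n y)%E.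
    by exists n => /=.
  rewrite integral_cubex lee_wpmul2l ?lee_fin ?(ltW (vol_gt0 _ _))//.
  by have := HB `|(n + n0)%:Z - j|%N j x; rewrite jn0.
apply: (@le_trans _ _ (avg j (fun y => C%:E + (3 / 2)%:E * (`|a y - mean j a y| `^ p)%:E)%E x)).
  apply: le_avg.
  - apply/measurable_EFinP; apply: (measurableT_comp (measurable_powR p)).
    apply: measurable_funD => //; apply: measurableT_comp => //.
    by apply: measurable_funB; [exact: la.1|exact: measurable_mean].
  - by apply: emeasurable_funD => //; exact: measurable_funeM.
  - by move=> y; rewrite lee_fin powR_ge0.
  - by move=> y; rewrite -EFinM -EFinD lee_fin HC.
rewrite avgD//; last first.
  exact: measurable_funeM.
rewrite avg_cst avgZ//.
apply: (@le_trans _ _ (C + 3 / 2 * B)%:E); last by rewrite lee_fin lerDl.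
by rewrite EFinD leeD2l// [leRHS]EFinM lee_wpmul2l ?lee_fin.
Qed.

End JohnNirenberg.

(** * Doob's maximal inequality *)

Section Doob.
Context {R : realType} {d : measure_display} {T : measurableType d}
  {mu : {measure set T -> \bar R}} (D : dyadicSystem mu).
Implicit Types (j l : int) (i : idx D) (F G : T -> \bar R) (f g a : T -> R).
Local Notation vol := (vol D).
Local Notation cube := (cube D).
Local Notation cubex := (cubex D).
Local Notation avg := (avg D).
Local Notation level := (level D).
Local Notation lset := (lset D).
Local Notation mean := (mean D).
Local Notation locint := (locint D).

Fixpoint maxmean j f (k : nat) (x : T) : R :=
  if k is k'.+1 then Num.max (maxmean j f k' x) (mean (j + k%:Z) f x)
  else mean j f x.

Lemma mean_ge0 j f x : (forall y, 0 <= f y) -> 0 <= mean j f x.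
Proof. by move=> f0; apply: fine_ge0; apply: avg_ge0 => y; rewrite lee_fin. Qed.

Lemma maxmean_ge0 j f k x : (forall y, 0 <= f y) -> 0 <= maxmean j f k x.
Proof.
by move=> f0; elim: k => [|k IH] /=; [exact: mean_ge0|rewrite le_max IH].
Qed.

Lemma maxmeanS j f k x : maxmean j f k x <= maxmean j f k.+1 x.
Proof. by rewrite /= le_max lexx. Qed.

Lemma mean_le_maxmean j f (k : nat) x : mean (j + k%:Z) f x <= maxmean j f k x.
Proof. by case: k => [|k] /=; [rewrite addr0|rewrite le_max lexx orbT]. Qed.

Lemma level_maxmean j f k : level (j + k%:Z) (maxmean j f k).
Proof.
elim: k => [|k IH] x y xy /=.
  by apply: level_mean; rewrite -[j]addr0.
rewrite (level_mean D _ f x y xy) (IH x y)//.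
by apply: cell_le xy; rewrite lerD2l lez_nat.
Qed.

(** The average over a small cube is at most the integral over the large one divided by the small
    volume. This makes the integral of the maximal function finite, so that it can be absorbed in
    [doob_maximal]. *)
Lemma maxmean_bounded j f k x0 : locint f -> (forall y, 0 <= f y) ->
  exists2 c, 0 <= c & forall x, cubex j x0 x -> maxmean j f k x <= c.
Proof.
move=> lf f0.
have meanb (m : nat) : exists2 c, 0 <= c &
    forall x, cubex j x0 x -> mean (j + m%:Z) f x <= c.
  exists ((vol (j + m%:Z))^-1 * (vol j * mean j f x0)) => [|x xx0].
    by rewrite !mulr_ge0 ?invr_ge0 ?(ltW (vol_gt0 _ _))// mean_ge0.
  rewrite -lee_fin EFinM -avg_mean// [X in (_ <= _ * X)%E]EFinM -avg_mean//.
  rewrite -integral_cubex /avg.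
  rewrite lee_wpmul2l ?lee_fin ?invr_ge0 ?(ltW (vol_gt0 _ _))//.
  apply: ge0_subset_integral; [exact: mcubex|exact: mcubex| | |].
  - by apply: measurable_funTS; apply/measurable_EFinP; exact: lf.1.
  - by move=> y _; rewrite lee_fin.
  - move=> y yx; have jm : j <= j + m%:Z by rewrite lerDl.
    exact: etrans (cell_le D _ _ _ _ jm yx) xx0.
elim: k => [|k [c c0 IH]].
  by have := meanb 0%N; rewrite addr0.
have [c' c'0 H] := meanb k.+1.
exists (Num.max c c') => [|x xx0]; first by rewrite le_max c0.
by rewrite /= ge_max !le_max IH// H// orbT.
Qed.

(** If the maximum increases at a step, its new value is the current mean and [powR_increment]
    bounds the gain; otherwise neither side changes. *)
Lemma maxmean_pathwise j f (r : R) k x : 1 < r -> (forall y, 0 <= f y) ->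
  maxmean j f k x `^ r <= r / (r - 1) * (maxmean j f 0 x `^ (r - 1) * mean j f x +
    \sum_(m < k) (maxmean j f m.+1 x `^ (r - 1) - maxmean j f m x `^ (r - 1)) *
       mean (j + m.+1%:Z) f x).
Proof.
move=> r1 f0; have r10 : 0 < r - 1 by lra.
have rr : 1 <= r / (r - 1) by rewrite ler_pdivlMr// mul1r; lra.
elim: k => [|k IH].
  rewrite big_ord0 addr0 /=.
  have [->|mN0] := eqVneq (mean j f x) 0; first by rewrite !mulr0 powR0// gt_eqF//; lra.
  have mp : 0 < mean j f x by rewrite lt_neqAle eq_sym mN0 mean_ge0.
  rewrite -[X in _ * (_ * X)]powRr1 ?(ltW mp)// -powRDp// subrK ler_peMl//.
  exact: powR_ge0.
rewrite big_ord_recr/= addrA mulrDr.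
set M := maxmean j f k x in IH *; set m := mean (j + k.+1%:Z) f x.
have M0 : 0 <= M by exact: maxmean_ge0.
have [mM|Mm] := leP m M.
  by rewrite subrr mul0r mulr0 addr0; exact: IH.
rewrite -lerBlDr; apply: le_trans IH.
have m0 : 0 <= m by rewrite mean_ge0.
have := powR_increment M m r r1 M0 m0; lra.
Qed.

Lemma integral_level_mean l (E : set T) (g f : T -> R) : lset l E -> level l g ->
  (forall x, 0 <= g x) -> (forall x, 0 <= f x) -> locint f ->
  (\int[mu]_(x in E) (g x * mean l f x)%:E = \int[mu]_(x in E) (g x * f x)%:E)%E.
Proof.
move=> El gl g0 f0 lf.
transitivity (\int[mu]_(x in E) ((EFin \o g) x * avg l (EFin \o f) x))%E.
  by apply: eq_integral => x _; rewrite EFinM avg_mean.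
rewrite integral_level//.
- by move=> x y xy /=; rewrite (gl x y).
- by apply/measurable_EFinP; exact: lf.1.
Qed.

(* Doob's maximal inequality: the running maximum only increases at times when it equals
   the current average, whence [M^r <= r' sum (M_k^(r-1) - M_(k-1)^(r-1)) E_k f]. *)
Lemma doob_maximal (r : R) : 1 < r -> exists2 C, 0 < C &
  forall j f k x0, locint f -> (forall y, 0 <= f y) ->
  (\int[mu]_(x in cubex j x0) (maxmean j f k x `^ r)%:E <=
    C%:E * \int[mu]_(x in cubex j x0) (f x `^ r)%:E)%E.
Proof.
move=> r1; have r10 : 0 < r - 1 by lra.
have r0 : 0 < r by lra.
pose r' := r / (r - 1).
have r'0 : 0 < r' by rewrite divr_gt0.
have r'1 : r'^-1 + r^-1 = 1 by rewrite /r'; field; rewrite !gt_eqF.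
(* Chosen such that [r' kap^r' = 1/2]: the term with [M^r] can then be absorbed on the left. *)
pose kap := (1 / (2 * r')) `^ r'^-1.
have kap0 : 0 < kap by rewrite powR_gt0// divr_gt0// mulr_gt0.
pose C1 := r' * kap `^ (- r).
have C10 : 0 < C1 by rewrite mulr_gt0// powR_gt0.
exists (2 * C1) => [|j f k x0 lf f0]; first by rewrite mulr_gt0.
set Q := cubex j x0.
have mQ : measurable Q by exact: mcubex.
have mM m : measurable_fun setT (maxmean j f m).
  by apply: (measurable_level D _ _ (j + m%:Z)) => //; exact: level_maxmean.
have mMp p m : measurable_fun setT (fun x => maxmean j f m x `^ p).
  exact: (measurableT_comp (measurable_powR p)).
have mf := lf.1.
pose M := maxmean j f.
have M0 m x : 0 <= M m x by exact: maxmean_ge0.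
pose g (m : nat) x := M m.+1 x `^ (r - 1) - M m x `^ (r - 1).
have g0 m x : 0 <= g m x.
  by rewrite subr_ge0 le_powR// ?(ltW r10)//; exact: maxmeanS.
have mg m : measurable_fun setT (g m) by apply: measurable_funB; exact: mMp.
have lg m : level (j + m.+1%:Z) (g m).
  move=> x y xy; rewrite /g /M (level_maxmean j f m.+1 x y xy) (level_maxmean j f m x y)//.
  by apply: cell_le xy; rewrite lerD2l lez_nat.
have finM : (\int[mu]_(x in Q) (M k x `^ r)%:E < +oo)%E.
  have [c c0 Hc] := maxmean_bounded j f k x0 lf f0.
  apply: (@le_lt_trans _ _ (\int[mu]_(x in Q) cst (c `^ r)%:E x)%E).
    apply: ge0_le_integral => //.
    - by move=> x _; rewrite lee_fin powR_ge0.
    - by apply/measurable_EFinP; apply: measurable_funTS; exact: mMp.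
    - by move=> x /Hc Mc; rewrite lee_fin le_powR// ?(ltW r0)//; exact: M0.
  by rewrite integral_cst// mucubex -EFinM ltry.
have step1 : (\int[mu]_(x in Q) (M k x `^ r)%:E <=
    r'%:E * \int[mu]_(x in Q) (M k x `^ (r - 1) * f x)%:E)%E.
  pose U x := M 0%N x `^ (r - 1) * mean j f x +
    \sum_(m < k) g m x * mean (j + m.+1%:Z) f x.
  pose V x := M 0%N x `^ (r - 1) * f x + \sum_(m < k) g m x * f x.
  (* The increment [g m] is constant on cubes of generation [j + m + 1], so the mean of [f]
     integrates against it like [f] itself; after that the increments telescope. *)
  have UV : (\int[mu]_(x in Q) (U x)%:E = \int[mu]_(x in Q) (V x)%:E)%E.
    have sp (h : nat -> T -> R) (h0 : T -> R) :
      (forall m, measurable_fun setT (h m)) -> (forall m x, 0 <= h m x) ->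
      measurable_fun setT h0 -> (forall x, 0 <= h0 x) ->
      (\int[mu]_(x in Q) (M 0%N x `^ (r - 1) * h0 x + \sum_(m < k) g m x * h m x)%:E =
      \int[mu]_(x in Q) (M 0%N x `^ (r - 1) * h0 x)%:E +
        \sum_(m < k) \int[mu]_(x in Q) (g m x * h m x)%:E)%E.
      move=> mh hp mh0 h0p.
      have mgh m : measurable_fun Q (fun x => (g m x * h m x)%:E).
        apply/measurable_EFinP; apply: measurable_funTS.
        by apply: measurable_funM.
      under eq_integral do rewrite EFinD -sumEFin.
      rewrite ge0_integralD//.
      - by rewrite ge0_integral_sum// => m x _; rewrite lee_fin mulr_ge0.
      - by move=> x _; rewrite lee_fin mulr_ge0 ?powR_ge0.
      - apply/measurable_EFinP; apply: measurable_funTS.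
        by apply: measurable_funM => //; exact: mMp.
      - by move=> x _; apply: sume_ge0 => m _; rewrite lee_fin mulr_ge0.
      - exact: emeasurable_sum.
    rewrite /U /V (sp (fun m => mean (j + m.+1%:Z) f) (mean j f)); last 4 first.
    - by move=> m; exact: measurable_mean.
    - by move=> m x; exact: mean_ge0.
    - exact: measurable_mean.
    - by move=> x; exact: mean_ge0.
    rewrite (sp (fun=> f) f)//; congr (_ + _)%E.
      have lM0 : level j (fun x => M 0%N x `^ (r - 1)).
        by move=> x y xy; rewrite /M /= (level_mean D j f x y).
      exact: (integral_level_mean j Q _ f (lset_cubex D j j x0 (lexx _)) lM0
        (fun x => powR_ge0 _ _) f0 lf).
    apply: eq_bigr => m _.
    have lQ : lset (j + m.+1%:Z) Q by apply: lset_cubex; rewrite lerDl.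
    exact: (integral_level_mean (j + m.+1%:Z) Q (g m) f lQ (lg m) (g0 m) f0 lf).
  have VE x : V x = M k x `^ (r - 1) * f x.
    rewrite /V -mulr_suml -mulrDl; congr (_ * _).
    rewrite /g -(big_mkord xpredT (fun m => M m.+1 x `^ (r - 1) - M m x `^ (r - 1))).
    by rewrite telescope_sumr// addrC subrK.
  apply: (@le_trans _ _ (\int[mu]_(x in Q) (r'%:E * (U x)%:E))%E).
    have U0 x : 0 <= U x.
      rewrite addr_ge0 ?mulr_ge0 ?powR_ge0 ?mean_ge0//.
      by apply: sumr_ge0 => m _; rewrite mulr_ge0// mean_ge0.
    apply: ge0_le_integral => //.
    - by move=> x _; rewrite lee_fin powR_ge0.
    - by apply/measurable_EFinP; apply: measurable_funTS; exact: mMp.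
    - apply/measurable_EFinP; apply: measurable_funTS; apply: measurable_funM => //.
      apply: measurable_funD.
        by apply: measurable_funM; [exact: mMp|exact: measurable_mean].
      apply: measurable_sum => m.
      by apply: measurable_funM => //; exact: measurable_mean.
    - by move=> x _; rewrite -EFinM lee_fin; exact: maxmean_pathwise.
  rewrite ge0_integralZl//.
  - by rewrite UV; under eq_integral do rewrite VE.
  - apply/measurable_EFinP; apply: measurable_funTS.
    apply: measurable_funD.
      by apply: measurable_funM; [exact: mMp|exact: measurable_mean].
    apply: measurable_sum => m.
    by apply: measurable_funM => //; exact: measurable_mean.
  - move=> x _; rewrite lee_fin addr_ge0 ?mulr_ge0 ?powR_ge0 ?mean_ge0//.
    by apply: sumr_ge0 => m _; rewrite mulr_ge0// mean_ge0.
  - by rewrite lee_fin ltW.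
have step2 : (r'%:E * \int[mu]_(x in Q) (M k x `^ (r - 1) * f x)%:E <=
    (1 / 2)%:E * \int[mu]_(x in Q) (M k x `^ r)%:E + C1%:E * \int[mu]_(x in Q) (f x `^ r)%:E)%E.
  have mfr : measurable_fun Q (fun x => (f x `^ r)%:E).
    by apply/measurable_EFinP; apply: measurable_funTS; exact: (measurableT_comp (measurable_powR r)).
  have mMr : measurable_fun Q (fun x => (M k x `^ r)%:E).
    by apply/measurable_EFinP; apply: measurable_funTS; exact: mMp.
  rewrite -!ge0_integralZl//; first last.
  all: try by move=> x _; rewrite lee_fin ?mulr_ge0 ?powR_ge0.
  all: try by rewrite lee_fin ltW.
  - apply/measurable_EFinP; apply: measurable_funTS; apply: measurable_funM => //; exact: mMp.
  rewrite -ge0_integralD//; first last.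
  all: try by move=> x _; rewrite -EFinM lee_fin mulr_ge0 ?powR_ge0// ltW.
  all: try exact: measurable_funeM.
  apply: ge0_le_integral => //.
  - by move=> x _; rewrite -EFinM lee_fin mulr_ge0 ?(ltW r'0)// mulr_ge0 ?powR_ge0.
  - apply: measurable_funeM.
    by apply/measurable_EFinP; apply: measurable_funTS; apply: measurable_funM => //; exact: mMp.
  - by apply: emeasurable_funD; exact: measurable_funeM.
  move=> x _; rewrite -!EFinM -EFinD lee_fin.
  have := @young_powR_scaled R kap (M k x `^ r) (f x `^ r) r' r kap0
    (powR_ge0 _ _) (powR_ge0 _ _) r'0 r0 r'1.
  rewrite powRK ?gt_eqF// -powRrM.
  have -> : r * r'^-1 = r - 1 by rewrite /r'; field; rewrite !gt_eqF.
  rewrite {1}/kap powRK_inv ?gt_eqF//; last by rewrite divr_ge0// mulr_ge0// ltW.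
  move=> /(ler_wpM2l (ltW r'0)) /le_trans; apply.
  rewrite le_eqVlt; apply/orP; left; apply/eqP; rewrite /C1.
  by field; rewrite gt_eqF.
have := le_trans step1 step2.
set I1 := (\int[mu]_(x in Q) (M k x `^ r)%:E)%E in finM *.
set I2 := (\int[mu]_(x in Q) (f x `^ r)%:E)%E.
have I10 : (0 <= I1)%E by apply: integral_ge0 => x _; rewrite lee_fin powR_ge0.
have I20 : (0 <= I2)%E by apply: integral_ge0 => x _; rewrite lee_fin powR_ge0.
move: I10 finM I20; case: I1 => [u| |]//; case: I2 => [w| |]//.
  by rewrite -!EFinM -EFinD !lee_fin => _ _ _ h; lra.
by move=> _ _ _ _; rewrite gt0_muley ?leey// lte_fin mulr_gt0.
Qed.

End Doob.

(** * Domination by weights *)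

Lemma nneseries_single {R : realType} (a : nat -> \bar R) (k0 : nat) :
  (forall k, (0 <= a k)%E) -> (forall k, k != k0 -> a k = 0%E) ->
  (\sum_(k <oo) a k = a k0)%E.
Proof.
move=> a0 ak; rewrite (nneseries_split 0 k0.+1)// add0n [X in (_ + X)%E]eseries0.
  rewrite adde0 big_nat_recr//= big1_seq ?add0e// => k /andP[_].
  by rewrite mem_index_iota => /andP[_ kk0]; apply: ak; rewrite ltn_eqF.
by move=> k kk0 _; apply: ak; rewrite gtn_eqF.
Qed.

(** One enumeration of the pairs serves every family: in [admissible_sum] the coefficients and the
    weights at all points must be rearranged alike. *)
Lemma nneseries_pair (R : realType) : exists e : nat -> nat * nat,
  forall a : nat -> nat -> \bar R, (forall i j, (0 <= a i j)%E) ->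
  (\sum_(i <oo) \sum_(j <oo) a i j = \sum_(k <oo) a (e k).1 (e k).2)%E.
Proof.
have := card_nat2; rewrite card_eq_sym => /card_set_bijP[e eb]; exists e => a a0.
rewrite (@nneseries_esumT _ (fun i => \sum_(j <oo) a i j)%E); last first.
  by move=> i; apply: nneseries_ge0 => j _ _.
rewrite nneseries_esumT//.
rewrite (eq_esum (b := fun i => \esum_(j in [set: nat]) a i j)); last first.
  by move=> i _; rewrite nneseries_esumT.
rewrite (@esum_esum _ _ _ [set: nat] (fun=> [set: nat]) a)//.
rewrite (reindex_esum [set: nat] ([set: nat] `*`` (fun=> [set: nat])) e)//.
by have -> : [set: nat] `*`` (fun=> [set: nat]) = [set: nat * nat] by apply/seteqP; split.
Qed.

Section Domination.
Context {R : realType} {d : measure_display} {T : measurableType d}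
  {mu : {measure set T -> \bar R}} (D : dyadicSystem mu).
Implicit Types (j l : int) (i : idx D) (F G w h : T -> \bar R) (f g a : T -> R).
Local Notation vol := (vol D).
Local Notation cube := (cube D).
Local Notation cubex := (cubex D).
Local Notation avg := (avg D).
Local Notation level := (level D).
Local Notation mean := (mean D).
Local Notation locint := (locint D).

(* The functions [vol(Q)^-delta 1_Q] are the extremal weights with
   [\int_Q' w <= vol(Q')^(1 - delta)] for all cubes [Q'], see [integral_admissible]. *)
Definition admissible (delta : R) (C : \bar R) w :=
  exists (m : nat -> R) (l : nat -> int) (c : nat -> idx D),
  [/\ forall k, 0 <= m k, (\sum_(k <oo) (m k)%:E <= C)%E &
    forall x, w x = (\sum_(k <oo)
      (m k * vol (l k) `^ (- delta) * \1_(cube (l k) (c k)) x)%:E)%E].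

Let adm_term0 delta (m : nat -> R) (l : nat -> int) (c : nat -> idx D) k x :
  (forall k, 0 <= m k) ->
  (0 <= (m k * vol (l k) `^ (- delta) * \1_(cube (l k) (c k)) x)%:E)%E.
Proof. by move=> m0; rewrite lee_fin !mulr_ge0 ?powR_ge0. Qed.

Lemma admissible_ge0 delta C w x : admissible delta C w -> (0 <= w x)%E.
Proof.
move=> [m [l [c [m0 _ ->]]]]; apply: nneseries_ge0 => k _ _; exact: adm_term0.
Qed.

Lemma measurable_admissible delta C w : admissible delta C w -> measurable_fun setT w.
Proof.
move=> [m [l [c [m0 _ wE]]]].
have -> : w = fun x => (\sum_(k <oo)
  (m k * vol (l k) `^ (- delta) * \1_(cube (l k) (c k)) x)%:E)%E by apply/funext.
apply: ge0_emeasurable_sum => [k x _ _|k _]; first exact: adm_term0.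
apply/measurable_EFinP; apply: measurable_funM => //.
by apply: measurable_indic; exact: mcube.
Qed.

Lemma admissible0 delta : admissible delta 0 (cst 0%E).
Proof.
exists (fun=> 0), (fun=> 0), (fun=> idx0 D); split => //.
  by rewrite eseries0.
by move=> x; rewrite eseries0// => k _ _; rewrite !mul0r.
Qed.

Lemma admissibleZ delta C w (k : R) : 0 <= k -> admissible delta C w ->
  admissible delta (k%:E * C)%E (fun x => k%:E * w x)%E.
Proof.
move=> k0 [m [l [c [m0 mC wE]]]].
exists (fun n => k * m n), l, c; split.
- by move=> n; rewrite mulr_ge0.
- under eq_eseriesr do rewrite EFinM.
  rewrite nneseriesZl//; last by move=> n _; rewrite lee_fin.
  by rewrite lee_wpmul2l ?lee_fin.
- move=> x; rewrite wE -nneseriesZl//; last by move=> n _; exact: adm_term0.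
  by apply: eq_eseriesr => n _; rewrite -EFinM !mulrA.
Qed.

Lemma admissible_sum delta (C : nat -> \bar R) (w : nat -> T -> \bar R) :
  (forall k, admissible delta (C k) (w k)) ->
  admissible delta (\sum_(k <oo) C k)%E (fun x => \sum_(k <oo) w k x)%E.
Proof.
move=> H; have [e eE] := nneseries_pair R.
have /choice[m Hm] := H; have /choice[l Hl] := Hm; have /choice[c Hc] := Hl.
have m0 k n : 0 <= m k n by have [] := Hc k.
exists (fun n => m (e n).1 (e n).2), (fun n => l (e n).1 (e n).2),
  (fun n => c (e n).1 (e n).2); split => //.
- rewrite -(eE (fun i0 j0 : nat => (m i0 j0)%:E))//.
  apply: lee_nneseries => k _; last by have [] := Hc k.
  by move=> _; apply: nneseries_ge0 => n _ _; rewrite lee_fin.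
- move=> x; rewrite -(eE (fun i0 j0 : nat =>
   (m i0 j0 * vol (l i0 j0) `^ (- delta) * \1_(cube (l i0 j0) (c i0 j0)) x)%:E)).
    by apply: eq_eseriesr => k _; have [_ _ ->] := Hc k.
  by move=> i0 j0; exact: (adm_term0 _ (m i0)).
Qed.

(** A cube of volume [v] on which [g] has the value [c] carries the mass [m = v c], and
    [m v^-delta = v^(1-delta) c]. *)
Lemma admissible_level delta j g : level j g -> (forall x, 0 <= g x) ->
  admissible delta (\int[mu]_x (g x)%:E)%E (fun x => (vol j `^ (1 - delta) * g x)%:E)%E.
Proof.
move=> gj g0.
have mg : measurable_fun setT (EFin \o g).
  by apply/measurable_EFinP; exact: (measurable_level D _ _ j).
have intE x : (\int[mu]_(y in cubex j x) (g y)%:E = (vol j * g x)%:E)%E.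
  rewrite [LHS]integral_cubex EFinM; congr (_ * _)%E.
  by rewrite -(avg_cst D j (g x) x); apply: avg_eq => y yx; rewrite (gj y x).
have int0 k : (0 <= \int[mu]_(x in cube_enum D j k) (g x)%:E)%E.
  by apply: integral_ge0 => x _; rewrite lee_fin.
have intfin k : (\int[mu]_(x in cube_enum D j k) (g x)%:E \is a fin_num)%E.
  rewrite /cube_enum; case: pickle_inv => [i|]; last by rewrite integral_set0.
  have [->|/set0P[x xi]] := eqVneq (cube j i) set0; first by rewrite integral_set0.
  by rewrite -xi -/(cubex j x) intE.
(* A code without index gets the default cube [idx0 D] with coefficient 0, its cell being empty. *)
exists (fun k => fine (\int[mu]_(x in cube_enum D j k) (g x)%:E)%E), (fun=> j),
  (fun k => odflt (idx0 D) (@pickle_inv (idx D) k)); split.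
- by move=> k; exact: fine_ge0.
- rewrite (integral_cells D j setT)//; last by move=> x _; rewrite lee_fin.
  apply: lee_nneseries => [k _ _|k _]; first by rewrite lee_fin fine_ge0.
  by rewrite setTI fineK.
- move=> x; rewrite (nneseries_single _ (pickle (cell D j x))).
  + rewrite /cube_enum pickleK_inv/= indicE mem_set// mulr1 intE/=.
    rewrite [in RHS]mulrAC; congr (_ * _)%:E.
    by rewrite powRDp ?vol_gt0// powRr1// ltW// vol_gt0.
  + by move=> k; rewrite lee_fin !mulr_ge0 ?powR_ge0// fine_ge0.
  + move=> k kx; rewrite /cube_enum; case e : pickle_inv => [i|]/=; last first.
      by rewrite integral_set0/= !mul0r.
    rewrite indicE memNset ?mulr0// => xi.
    have := @pickle_invK (idx D) k; rewrite e/= => ki.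
    by rewrite -ki -xi eqxx in kx.
Qed.

(** The intersection measures at most the smaller volume, hence at most the geometric mean of both
    with weights [1 - delta] and [delta]. *)
Lemma mu_cubeI_le j x l (c : idx D) (delta : R) : 0 <= delta -> delta <= 1 ->
  (mu (cubex j x `&` cube l c) <= (vol j `^ (1 - delta) * vol l `^ delta)%:E)%E.
Proof.
move=> d0 d1; have vj := vol_gt0 D j; have vl := vol_gt0 D l.
have vv k : vol k = vol k `^ (1 - delta) * vol k `^ delta.
  by rewrite -powRDp ?vol_gt0// subrK powRr1// ltW// vol_gt0.
have h1 : (mu (cubex j x `&` cube l c) <= (vol j)%:E)%E.
  by rewrite -(mucubex D j x); apply: le_measure; rewrite ?inE;
    [apply: measurableI; [exact: mcubex|exact: mcube]|exact: mcubex|exact: subIsetl].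
have h2 : (mu (cubex j x `&` cube l c) <= (vol l)%:E)%E.
  by rewrite -(mucube D l c); apply: le_measure; rewrite ?inE;
    [apply: measurableI; [exact: mcubex|exact: mcube]|exact: mcube|exact: subIsetr].
have [jl|lj] := leP (vol j) (vol l).
  apply: (le_trans h1); rewrite lee_fin {1}(vv j) ler_wpM2l ?powR_ge0//.
  by rewrite le_powR// ltW.
apply: (le_trans h2); rewrite lee_fin {1}(vv l) ler_wpM2r ?powR_ge0//.
by rewrite le_powR ?subr_ge0// ltW.
Qed.

Lemma integral_admissible delta C w j x : 0 <= delta -> delta <= 1 ->
  admissible delta C w ->
  (\int[mu]_(y in cubex j x) w y <= C * (vol j `^ (1 - delta))%:E)%E.
Proof.
move=> d0 d1 [m [l [c [m0 mC wE]]]].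
under eq_integral do rewrite wE.
rewrite integral_nneseries//.
- apply: (@le_trans _ _ (\sum_(k <oo) (vol j `^ (1 - delta))%:E * (m k)%:E)%E).
    apply: lee_nneseries => [k _ _|k _].
      by apply: integral_ge0 => y _; exact: adm_term0.
    under eq_integral do rewrite EFinM.
    rewrite ge0_integralZl//.
    + rewrite integral_indic//; [|exact: mcubex|exact: mcube].
      rewrite setIC.
      apply: (@le_trans _ _ ((m k * vol (l k) `^ (- delta))%:E *
         (vol j `^ (1 - delta) * vol (l k) `^ delta)%:E)%E).
        rewrite lee_wpmul2l ?lee_fin ?mulr_ge0 ?powR_ge0//.
        exact: mu_cubeI_le.
      rewrite -!EFinM lee_fin le_eqVlt; apply/orP; left; apply/eqP.
      by rewrite powRN; field; rewrite gt_eqF// powR_gt0// vol_gt0.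
    + exact: mcubex.
    + by apply/measurable_EFinP; apply: measurable_indic; exact: mcube.
    + by rewrite lee_fin mulr_ge0 ?powR_ge0.
  rewrite nneseriesZl; last by move=> k _; rewrite lee_fin.
  by rewrite muleC lee_wpmul2r ?lee_fin ?powR_ge0.
- exact: mcubex.
- move=> k; apply/measurable_EFinP; apply: measurable_funTS; apply: measurable_funM => //.
  by apply: measurable_indic; exact: mcube.
- by move=> k y _; exact: adm_term0.
Qed.

(* [h <= kappa^p w + kappa^-P G] for all [kappa] means [h <= w^(1/p) G^(1/P)] up to a
   constant; unlike the latter, it is visibly stable under countable sums. *)
Definition dominated (delta p P : R) (C : \bar R) h := exists w G,
  [/\ admissible delta C w, measurable_fun setT G, forall x, (0 <= G x)%E,
    (\int[mu]_x G x <= C)%E &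
    forall kappa x, 0 < kappa ->
      (h x <= (kappa `^ p)%:E * w x + (kappa `^ (- P))%:E * G x)%E].

Section dominated.
Variables (delta p P : R).
Local Notation dom := (dominated delta p P).

Lemma admissible_le C C' w : (C <= C')%E -> admissible delta C w -> admissible delta C' w.
Proof.
by move=> CC [m [l [c [m0 mC wE]]]]; exists m, l, c; split=> //; exact: le_trans CC.
Qed.

Lemma dominated_leC C C' h : (C <= C')%E -> dom C h -> dom C' h.
Proof.
move=> CC [w [G [aw mG G0 GC H]]]; exists w, G; split=> //.
- exact: admissible_le aw.
- exact: le_trans CC.
Qed.

Lemma dominatedZ C h (k : R) : 0 <= k -> dom C h -> dom (k%:E * C)%E (fun x => k%:E * h x)%E.
Proof.
move=> k0 [w [G [aw mG G0 GC H]]].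
exists (fun x => k%:E * w x)%E, (fun x => k%:E * G x)%E; split.
- exact: admissibleZ.
- exact: measurable_funeM.
- by move=> x; rewrite mule_ge0 ?lee_fin.
- by rewrite ge0_integralZl ?lee_fin// lee_wpmul2l ?lee_fin.
move=> kappa x kp; rewrite muleCA [X in (_ + X)%E]muleCA -ge0_muleDr.
- by rewrite lee_wpmul2l ?lee_fin//; exact: H.
- by rewrite mule_ge0 ?lee_fin ?powR_ge0//; exact: admissible_ge0 aw.
- by rewrite mule_ge0 ?lee_fin ?powR_ge0.
Qed.

Lemma dominated_sum (C : nat -> \bar R) (h : nat -> T -> \bar R) :
  (forall k x, (0 <= h k x)%E) -> (forall k, dom (C k) (h k)) ->
  dom (\sum_(k <oo) C k)%E (fun x => \sum_(k <oo) h k x)%E.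
Proof.
move=> h0 /choice[w /choice[G H]].
have w0 k x : (0 <= w k x)%E by have [aw _ _ _ _] := H k; exact: admissible_ge0 aw.
have G0 k x : (0 <= G k x)%E by have [_ _ + _ _] := H k; apply.
exists (fun x => \sum_(k <oo) w k x)%E, (fun x => \sum_(k <oo) G k x)%E; split.
- by apply: admissible_sum => k; have [] := H k.
- by apply: ge0_emeasurable_sum => [k x _ _|k _]; [exact: G0|have [] := H k].
- by move=> x; apply: nneseries_ge0 => k _ _.
- rewrite integral_nneseries//; last by move=> k; have [] := H k.
  apply: lee_nneseries => [k _ _|k _]; first exact: integral_ge0.
  by have [] := H k.
move=> kappa x k0.
rewrite -nneseriesZl// -nneseriesZl// -nneseriesD; last 2 first.
- by move=> k _ _; rewrite mule_ge0 ?lee_fin ?powR_ge0.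
- by move=> k _ _; rewrite mule_ge0 ?lee_fin ?powR_ge0.
by apply: lee_nneseries => // k _; have [_ _ _ _] := H k; exact.
Qed.

Lemma dominatedD C1 C2 h1 h2 : (0 <= C1)%E -> (0 <= C2)%E ->
  (forall x, (0 <= h1 x)%E) -> (forall x, (0 <= h2 x)%E) ->
  dom C1 h1 -> dom C2 h2 -> dom (C1 + C2)%E (fun x => h1 x + h2 x)%E.
Proof.
move=> C10 C20 h10 h20 d1 d2.
pose C (k : nat) : \bar R := if k is k'.+1 then (if k' is k''.+1 then 0%E else C2) else C1.
pose h (k : nat) : T -> \bar R :=
  if k is k'.+1 then (if k' is k''.+1 then cst 0%E else h2) else h1.
have sum2 (u : nat -> \bar R) : (forall k, (0 <= u k)%E) ->
    (forall k, u k.+2 = 0)%E -> (\sum_(k <oo) u k = u 0%N + u 1%N)%E.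
  move=> u0 u2; rewrite (nneseries_split 0 2)// add0n [X in (_ + X)%E]eseries0.
    by rewrite adde0 !big_nat_recr//= big_geq// add0e.
  by move=> [|[|k]].
have : dom (\sum_(k <oo) C k)%E (fun x => \sum_(k <oo) h k x)%E.
  apply: dominated_sum => [[|[|k]]//|[|[|k]]//].
  exists (cst 0%E), (cst 0%E); split => //.
  - exact: admissible0.
  - by rewrite integral0.
  - by move=> kappa x k0; rewrite /= !mule0 adde0.
rewrite sum2//; last by move=> [|[|k]].
by congr dominated; apply/funext => x; rewrite sum2// => -[|[|k]]/=.
Qed.

End dominated.
End Domination.

(** * Estimates for a single block *)

Lemma nneseries_le_partial {R : realType} (u : nat -> \bar R) (C : \bar R) :
  (forall k, (0 <= u k)%E) -> (forall N, (\sum_(k < N.+1) u k <= C)%E) ->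
  (\sum_(k <oo) u k <= C)%E.
Proof.
move=> u0 uC; apply: lime_le; first by apply: is_cvg_nneseries => n _ _.
apply: nearW => N; apply: le_trans (uC N).
by rewrite big_mkord big_ord_recr/= leeDl.
Qed.

Lemma nneseries_geometric_le {R : realType} (z : R) : 0 <= z -> z < 1 ->
  (\sum_(k <oo) (z ^+ k.+1)%:E <= (z / (1 - z))%:E)%E.
Proof.
move=> z0 z1; apply: nneseries_le_partial => [k|N]; first by rewrite lee_fin exprn_ge0.
rewrite sumEFin lee_fin ler_pdivlMr ?subr_gt0//.
suff -> : (\sum_(k < N.+1) z ^+ k.+1) * (1 - z) = z - z ^+ N.+2.
  by rewrite gerBl exprn_ge0.
elim: N => [|N IH]; first by rewrite big_ord_recl big_ord0 addr0 expr1 expr2; ring.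
by rewrite big_ord_recr/= mulrDl IH [in RHS]exprS (exprS z N.+1); ring.
Qed.

Section BlockEstimate.
Context {R : realType} {d : measure_display} {T : measurableType d}
  {mu : {measure set T -> \bar R}} (D : dyadicSystem mu) (a : T -> R)
  (p P q r s delta gamma : R).
Context (p1 : 1 < p) (P1 : 1 < P) (pP : p^-1 + P^-1 = 1)
  (q1 : 1 < q) (r1 : 1 < r) (qr : q^-1 + r^-1 = 1)
  (d0 : 0 <= delta) (d1 : delta < 1) (g0 : 0 < gamma) (pr : p^-1 = gamma + r^-1)
  (s1 : 1 < s) (sq : s < q) (eta0 : q^-1 + delta / r < s^-1).
Implicit Types (j l : int) (F G : T -> \bar R) (f g : T -> R).
Local Notation vol := (vol D).
Local Notation cube := (cube D).
Local Notation cubex := (cubex D).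
Local Notation avg := (avg D).
Local Notation level := (level D).
Local Notation lset := (lset D).
Local Notation mean := (mean D).
Local Notation locint := (locint D).
Local Notation dom := (dominated D delta p P).
Let theta := gamma * (1 - delta).
Let s' := s / (s - 1).

Definition osc j (y : T) : R := 1 + `|a y - mean j a y|.
(* Controls the [j]-th term of the fractional integral and of its commutator with [a]. *)
Definition oscterm (th : R) j f (x : T) : \bar R :=
  ((vol j `^ th * osc j x)%:E * avg j (fun y => (osc j y * f y)%:E) x)%E.

(** The moment [s'] is for Hoelder's inequality inside an average, [P] for the scales above the
    block, and [2 P] for those below, where [mul_powR_le_split] asks for an exponent beyond [P]. *)
Context (B : R) (la : locint a) (B0 : 0 <= B)
  (HBs : forall j x, (avg j (fun y => (osc j y `^ s')%:E) x <= B%:E)%E)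
  (HBP : forall j x, (avg j (fun y => (osc j y `^ P)%:E) x <= B%:E)%E)
  (HBL : forall j x, (avg j (fun y => (osc j y `^ (2 * P))%:E) x <= B%:E)%E).

Lemma osc_ge1 j x : 1 <= osc j x.
Proof. by rewrite lerDl. Qed.

Lemma osc_ge0 j x : 0 <= osc j x.
Proof. exact: le_trans ler01 (osc_ge1 j x). Qed.

Lemma measurable_osc j : measurable_fun setT (osc j).
Proof.
apply: measurable_funD => //; apply: measurableT_comp => //.
by apply: measurable_funB; [exact: la.1|exact: measurable_mean].
Qed.

Lemma measurable_oscM j f : measurable_fun setT f ->
  measurable_fun setT (fun y => (osc j y * f y)%:E).
Proof.
by move=> mf; apply/measurable_EFinP; apply: measurable_funM => //; exact: measurable_osc.
Qed.

Lemma measurable_EFin_powR f (e : R) (E : set T) : measurable_fun setT f ->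
  measurable_fun E (fun y => (f y `^ e)%:E).
Proof.
move=> mf; apply/measurable_EFinP; apply: measurable_funTS.
exact: (measurableT_comp (measurable_powR e)).
Qed.

Lemma oscterm_ge0 th j f x : (forall y, 0 <= f y) -> (0 <= oscterm th j f x)%E.
Proof.
move=> f0; rewrite mule_ge0 ?lee_fin ?mulr_ge0 ?powR_ge0 ?osc_ge0//.
by apply: avg_ge0 => y; rewrite lee_fin mulr_ge0// osc_ge0.
Qed.

(** Hoelder's inequality with exponents [s'] and [s], obtained from Young's inequality for [osc] and
    [f / kappa], where [kappa] bounds the [L^s] mean of [f]. *)
Lemma avg_oscM_bound j f x kappa : 0 < kappa -> measurable_fun setT f ->
  (forall y, 0 <= f y) -> (avg j (fun y => (f y `^ s)%:E) x <= (kappa `^ s)%:E)%E ->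
  (avg j (fun y => (osc j y * f y)%:E) x <= ((B + 1) * kappa)%:E)%E.
Proof.
move=> k0 mf f0 H; move: (s1) => ?.
have s10 : 0 < s - 1 by lra.
have s0 : 0 < s by lra.
have s'0 : 0 < s' by rewrite divr_gt0.
have ss : s'^-1 + s^-1 = 1 by rewrite /s'; field; rewrite !gt_eqF.
have kk : 0 <= kappa * kappa `^ (- s) by rewrite mulr_ge0 ?powR_ge0// ltW.
apply: (@le_trans _ _ (avg j (fun y => kappa%:E * (osc j y `^ s')%:E +
    (kappa * kappa `^ (- s))%:E * (f y `^ s)%:E)%E x)).
  apply: le_avg.
  - exact: measurable_oscM.
  - apply: emeasurable_funD; apply: measurable_funeM; apply: measurable_EFin_powR => //.
    exact: measurable_osc.
  - by move=> y; rewrite lee_fin mulr_ge0// osc_ge0.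
  move=> y; rewrite -!EFinM -EFinD lee_fin.
  have := @young_powR R (osc j y `^ s') ((f y / kappa) `^ s) s' s
    (powR_ge0 _ _) (powR_ge0 _ _) s'0 s0 ss.
  rewrite !powRK ?osc_ge0 ?gt_eqF//; last by rewrite divr_ge0// ltW.
  move=> /(ler_wpM2l (ltW k0)); rewrite powRM ?invr_ge0 ?(ltW k0)//.
  rewrite powRV ?(ltW k0)// => H'; apply: le_trans (le_trans H' _).
    by rewrite le_eqVlt; apply/orP; left; apply/eqP; field; rewrite gt_eqF.
  by rewrite le_eqVlt; apply/orP; left; apply/eqP; ring.
have mo : measurable_fun setT (fun y => (osc j y `^ s')%:E).
  by apply: measurable_EFin_powR; exact: measurable_osc.
have mfs : measurable_fun setT (fun y => (f y `^ s)%:E).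
  exact: measurable_EFin_powR.
rewrite avgD; last 4 first.
- exact: measurable_funeM.
- exact: measurable_funeM.
- by move=> y; rewrite mule_ge0 ?lee_fin ?powR_ge0// ltW.
- by move=> y; rewrite mule_ge0 ?lee_fin ?powR_ge0.
rewrite avgZ ?(ltW k0)//; last by move=> y; rewrite lee_fin powR_ge0.
rewrite avgZ//; last by move=> y; rewrite lee_fin powR_ge0.
apply: (@le_trans _ _ (kappa%:E * B%:E + (kappa * kappa `^ (- s))%:E * (kappa `^ s)%:E)%E).
  by apply: leeD; rewrite lee_wpmul2l ?lee_fin ?(ltW k0).
rewrite -!EFinM -EFinD lee_fin le_eqVlt; apply/orP; left; apply/eqP.
by rewrite powRN; field; rewrite gt_eqF// powR_gt0.
Qed.

Lemma oscterm_eq0 th j l x0 f x : l <= j -> (forall y, ~ cubex l x0 y -> f y = 0) ->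
  ~ cubex l x0 x -> oscterm th j f x = 0%E.
Proof.
move=> lj f0 nx; rewrite /oscterm (avg_eq D _ _ (fun=> 0%E)).
  by rewrite (avg_cst D j 0) mule0.
move=> y yx; rewrite f0 ?mulr0// => yl; apply: nx.
exact: etrans (esym (cell_le D _ _ _ _ lj yx)) yl.
Qed.

(* Scales below the block: a Hedberg type argument, in which [t] is the running maximum
   of the averages of [f^s]. *)
Lemma local_dominated : exists2 C, 0 < C & forall j x0 f,
  measurable_fun setT f -> (forall y, 0 <= f y) ->
  (forall y, ~ cubex j x0 y -> f y = 0) ->
  (\int[mu]_y (f y `^ q)%:E <= (vol j `^ (- ((q - 1) * delta)))%:E)%E ->
  dom C%:E (fun x => \sum_(k <oo) oscterm theta (j + k%:Z) f x)%E.
Proof.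
move: (p1) (P1) (pP) (q1) (r1) (qr) (d1) (pr) (s1) (sq) (B0) => ? ? ? ? ? ? ? ? ? ? ?.
have q0 : 0 < q by lra.
have s0 : 0 < s by lra.
have r0 : 0 < r by lra.
(* Averages are taken of [f^s]; as [rho > 1], Doob's inequality applies to them and returns the
   [L^q] norm of [f]. *)
pose rho := q / s.
have rho1 : 1 < rho by rewrite /rho ltr_pdivlMr// mul1r.
have rho0 : 0 < rho by lra.
have [Cd Cd0 HCd] := doob_maximal D rho rho1.
pose z := (ratio D)^-1 `^ (1 - delta).
have rat0 := ratio_gt0 D.
have z0 : 0 < z by rewrite powR_gt0// invr_gt0.
have z1 : z < 1.
  by rewrite powR_lt1 ?subr_gt0// ?invf_lt1 ?ratio_gt1// invr_ge0 ltW.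
have [Cw Cw0 HCw] := weighted_sum_bound z gamma p P r z0 z1 g0 (lt_trans ltr01 p1) P1 pP pr.
have [Cc Cc0 HCc] := carleson_sum z 1 gamma z0 z1 ltr01 g0.
pose c3 := (B + 1) * Cw.
have c30 : 0 < c3 by rewrite mulr_gt0//; lra.
pose C4 := (1 + Cd) + B * (Cc * (1 + Cd)).
have C40 : 0 < C4.
  by rewrite ltr_wpDr ?mulr_ge0 ?(ltW Cc0)//; lra.
exists (c3 * C4) => [|j x0 f mf f0 fQ fq]; first by rewrite mulr_gt0.
set v := vol j; have v0 : 0 < v by exact: vol_gt0.
(* Normalised so that [phi^rho] has integral at most 1, since [q / r = q - 1]. *)
pose phi y := (v `^ (delta / r) * f y) `^ s.
have phi0 y : 0 <= phi y by rewrite powR_ge0.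
have mphi : measurable_fun setT phi.
  by apply: (measurableT_comp (measurable_powR s)); exact: measurable_funM.
have phiq y : phi y `^ rho = v `^ ((q - 1) * delta) * f y `^ q.
  have srho : s * rho = q by rewrite /rho; field; rewrite gt_eqF.
  rewrite /phi -powRrM srho powRM ?powR_ge0// -powRrM.
  congr (_ `^ _ * _).
  have qrE : q * r^-1 = q - 1.
    have -> : r^-1 = 1 - q^-1 by lra.
    by field; rewrite gt_eqF.
  by rewrite -qrE; ring.
have intphi : (\int[mu]_y (phi y `^ rho)%:E <= 1)%E.
  under eq_integral do rewrite phiq EFinM.
  rewrite ge0_integralZl//.
  - apply: (@le_trans _ _ ((v `^ ((q - 1) * delta))%:E * (v `^ (- ((q - 1) * delta)))%:E)%E).
      by rewrite lee_wpmul2l ?lee_fin ?powR_ge0.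
    by rewrite -EFinM -powRDp// subrr powRr0.
  - exact: measurable_EFin_powR.
  - by move=> y _; rewrite lee_fin powR_ge0.
  - by rewrite lee_fin powR_ge0.
have lphi : locint phi.
  split=> // l i; apply: (integrable_le _ _ (fun y => 1 + (phi y `^ rho)%:E)%E) => //.
  - exact: mcube.
  - by apply: emeasurable_funD => //; exact: measurable_EFin_powR.
  - move=> y; rewrite ger0_norm// -EFinD lee_fin.
    have [h|h] := leP (phi y) 1; first by rewrite (le_trans h)// lerDl powR_ge0.
    rewrite (@le_trans _ _ (phi y `^ rho))//; last by rewrite lerDr.
    by rewrite -[leLHS]powRr1// ler_powR// ltW.
  - rewrite ge0_integralD//.
    + rewrite lte_add_pinfty//.
        by rewrite (_ : \int[mu]_(x in _) 1 = \int[mu]_(x in cube l i) cst 1 x)%E//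
          integral_cst ?mul1e ?mucube ?ltry//; exact: mcube.
      apply: (@le_lt_trans _ _ 1%E); last by rewrite ltry.
      apply: le_trans intphi; apply: ge0_subset_integral => //; first exact: mcube.
      * exact: measurable_EFin_powR.
      * by move=> y _; rewrite lee_fin powR_ge0.
    + exact: mcube.
    + by move=> y _; rewrite lee_fin powR_ge0.
    + exact: measurable_EFin_powR.
pose M k x := maxmean D j phi k x.
have M0 k x : 0 <= M k x by exact: maxmean_ge0.
(* The summand [1/v] costs mass 1 on the block and keeps [t] positive. It also gives [W >= v^-delta]
   ([WV]), which supplies the factor [W^(1/r)] of [W^(1/p) = W^(1/r) W^gamma]. *)
pose t k x := v^-1 + M k x `^ rho.
have t0 k x : 0 < t k x by rewrite ltr_wpDr ?powR_ge0// invr_gt0.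
have tS k x : t k x <= t k.+1 x.
  by rewrite lerD2l le_powR// ?(ltW rho0)//; exact: maxmeanS.
have lM k : level (j + k%:Z) (M k) by exact: level_maxmean.
have lt k : level (j + k%:Z) (t k) by move=> x y xy; rewrite /t (lM k x y).
pose dt k x := if k is k'.+1 then t k x - t k' x else t 0%N x.
have dt0 k x : 0 <= dt k x by case: k => [|k] /=; [exact: ltW|rewrite subr_ge0].
have ldt k : level (j + k%:Z) (dt k).
  case: k => [|k] x y xy /=; first by rewrite (lt 0%N x y).
  rewrite (lt k.+1 x y)// (lt k x y)//; apply: cell_le xy.
  by rewrite lerD2l lez_nat.
have sumdt N x : \sum_(k < N.+1) dt k x = t N x.
  elim: N => [|N IH]; first by rewrite big_ord_recl big_ord0 addr0.
  by rewrite big_ord_recr/= IH addrC subrK.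
pose V (k : nat) := vol (j + k%:Z) `^ (1 - delta).
have V0 k : 0 < V k by rewrite powR_gt0// vol_gt0.
have VS k : V k.+1 = z * V k.
  rewrite /V -addn1 PoszD addrA (volD D (j + k%:Z) 1) vol1 powRM ?(ltW (vol_gt0 _ _))//.
    by rewrite mulrC.
  by rewrite invr_ge0 ltW.
(* Each increment of [t] is weighted at the generation where it occurs, so the admissible mass on
   the block telescopes to [\int t_k]. Abel summation gives [V k * t k <= W k], because [V]
   decreases. *)
pose W k x := \sum_(i < k.+1) V i * dt i x.
have WS k x : W k x <= W k.+1 x.
  by rewrite /W [leRHS]big_ord_recr lerDl; apply: mulr_ge0; [exact: ltW|exact: (dt0 k.+1)].
have VSle k : V k.+1 <= V k by rewrite VS ger_pMl// ltW.
have VtW k x : V k * t k x <= W k x.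
  elim: k => [|k IH]; first by rewrite /W big_ord_recl big_ord0 addr0.
  rewrite /W big_ord_recr/=.
  have -> : V k.+1 * t k.+1 x = V k.+1 * t k x + V k.+1 * (t k.+1 x - t k x) by ring.
  rewrite lerD2r; apply: le_trans IH; rewrite ler_wpM2r// ltW//.
have W0 k x : 0 < W k x by apply: lt_le_trans (VtW k x); rewrite mulr_gt0.
have WV k x : v `^ (- delta) <= W k x.
  elim: k => [|k IH]; last exact: le_trans IH (WS k x).
  apply: le_trans (VtW 0%N x); rewrite /V addr0 -/v.
  have -> : v `^ (- delta) = v `^ (1 - delta) * v^-1.
    by rewrite -[v^-1]powR_inv1 ?(ltW v0)// -powRDp//; congr (_ `^ _); ring.
  by rewrite ler_wpM2l ?powR_ge0// lerDl powR_ge0.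
have lW k : level (j + k%:Z) (W k).
  move=> x y xy; apply: eq_bigr => -[i ik] _ /=; rewrite (ldt i x y)//.
  by apply: cell_le xy; rewrite lerD2l lez_nat.
pose y k x := V k * t k x / W k x.
have y0 k x : 0 <= y k x.
  by rewrite divr_ge0 ?mulr_ge0 ?(ltW (V0 _)) ?(ltW (t0 _ _)) ?(ltW (W0 _ _)).
have y1 k x : y k x <= 1 by rewrite ler_pdivrMr// mul1r.
have yS k x : y k.+1 x <= y k x * (t k.+1 x / t k x) * z.
  have -> : y k x * (t k.+1 x / t k x) * z = V k.+1 * t k.+1 x / W k x.
    by rewrite /y VS; field; rewrite !gt_eqF.
  by rewrite ler_wpM2l ?mulr_ge0 ?(ltW (V0 _)) ?(ltW (t0 _ _))// lef_pV2 ?posrE.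
pose Q := cubex j x0.
have mQ : measurable Q by exact: mcubex.
pose yt k x := y k x `^ gamma * t k x.
have yt0 k x : 0 <= yt k x by rewrite mulr_ge0 ?powR_ge0// ltW.
have lyt k : level (j + k%:Z) (yt k).
  by move=> x x' xx; have e1 := lt k x x' xx; have e2 := lW k x x' xx; rewrite /yt /y e1 e2.
pose w x := (\sum_(k <oo) (V k * (dt k x * \1_Q x))%:E)%E.
pose G x := (\sum_(k <oo) ((dt k x + yt k x * osc (j + k%:Z) x `^ (2 * P)) * \1_Q x)%:E)%E.
have mlev k (g : T -> R) (E : set T) : level (j + k%:Z) g -> measurable E ->
    measurable_fun E (EFin \o g).
  by move=> lg mE; apply/measurable_EFinP; exact: (measurable_level D _ _ (j + k%:Z)).
have int_t N : (\int[mu]_(x in Q) (t N x)%:E <= (1 + Cd)%:E)%E.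
  under eq_integral do rewrite /t EFinD.
  rewrite ge0_integralD//.
  - rewrite EFinD; apply: leeD.
      rewrite (_ : \int[mu]_(x in Q) _ = \int[mu]_(x in Q) cst (v^-1)%:E x)%E//.
      by rewrite integral_cst// mucubex -EFinM mulVf// gt_eqF.
    apply: (le_trans (HCd j phi N x0 lphi phi0)).
    rewrite -[leRHS]mule1 lee_wpmul2l ?lee_fin ?(ltW Cd0)//.
    apply: le_trans intphi; apply: ge0_subset_integral => //.
    * exact: measurable_EFin_powR.
    * by move=> x _; rewrite lee_fin powR_ge0.
  - by move=> x _; rewrite lee_fin invr_ge0 ltW.
  - by move=> x _; rewrite lee_fin powR_ge0.
  - by apply: measurable_EFin_powR; apply: (measurable_level D _ _ (j + N%:Z)).
have intind (g : T -> R) : (\int[mu]_x (g x * \1_Q x)%:E = \int[mu]_(x in Q) (g x)%:E)%E.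
  rewrite [RHS]integral_mkcond; apply: eq_integral => x _.
  by rewrite patchE indicE; case: ifPn; rewrite ?mulr1 ?mulr0.
have sum_dt : (\sum_(k <oo) \int[mu]_x (dt k x * \1_Q x)%:E <= (1 + Cd)%:E)%E.
  apply: nneseries_le_partial => [k|N].
    by apply: integral_ge0 => x _; rewrite lee_fin mulr_ge0.
  under eq_bigr do rewrite intind.
  rewrite -ge0_integral_sum//.
  - apply: le_trans (int_t N); rewrite le_eqVlt; apply/orP; left; apply/eqP.
    by apply: eq_integral => x _; rewrite sumEFin sumdt.
  - by move=> k; exact: (mlev k).
  - by move=> k x _; rewrite lee_fin.
have osc2P k : measurable_fun setT (fun x => (osc (j + k%:Z) x `^ (2 * P))%:E).
  by apply: measurable_EFin_powR; exact: measurable_osc.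
have mytX k E : measurable E -> measurable_fun E (fun x => (yt k x * osc (j + k%:Z) x `^ (2 * P))%:E).
  move=> mE; under eq_fun do rewrite EFinM; apply: emeasurable_funM.
    exact: (mlev k).
  exact: measurable_funTS.
(* [yt k] is constant on cubes of generation [j + k], so the moment of [osc] integrates out to [B];
   the sum of [y^gamma t] that remains is at most [Cc * t N] pointwise by [carleson_sum]. *)
have sum_yt : (\sum_(k <oo) \int[mu]_x ((yt k x * osc (j + k%:Z) x `^ (2 * P)) * \1_Q x)%:E <=
    (B * (Cc * (1 + Cd)))%:E)%E.
  apply: nneseries_le_partial => [k|N].
    by apply: integral_ge0 => x _; rewrite lee_fin mulr_ge0// mulr_ge0// powR_ge0.
  under eq_bigr do rewrite intind.
  apply: (@le_trans _ _ (\sum_(k < N.+1) B%:E * \int[mu]_(x in Q) (yt k x)%:E)%E).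
    apply: lee_sum => k _.
    have lQ : lset (j + k%:Z) Q by apply: lset_cubex; rewrite lerDl.
    have := integral_level D (j + k%:Z) Q (EFin \o yt k)
      (fun x => (osc (j + k%:Z) x `^ (2 * P))%:E) lQ.
    have H1 : level (j + k%:Z) (EFin \o yt k) by move=> x x' xx /=; rewrite (lyt k x x').
    have H2 x : (0 <= (EFin \o yt k) x)%E by rewrite lee_fin.
    have H3 x : (0 <= (osc (j + k%:Z) x `^ (2 * P))%:E)%E by rewrite lee_fin powR_ge0.
    move=> /(_ H1 H2 H3 (osc2P k)).
    rewrite (_ : \int[mu]_(x in Q) ((EFin \o yt k) x * (osc (j + k%:Z) x `^ (2 * P))%:E) =
      \int[mu]_(x in Q) (yt k x * osc (j + k%:Z) x `^ (2 * P))%:E)%E//.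
    move=> <-; rewrite -ge0_integralZl//.
    - apply: ge0_le_integral => //.
      + by move=> x _; rewrite mule_ge0// avg_ge0.
      + by apply: emeasurable_funM; [exact: (mlev k)|exact: measurable_avg].
      + by apply: measurable_funeM; exact: (mlev k).
      + by move=> x _; rewrite muleC lee_wpmul2r.
    - exact: (mlev k).
    - by move=> x _; rewrite lee_fin.
  rewrite -ge0_sume_distrr; last first.
    by move=> k _; apply: integral_ge0 => x _; rewrite lee_fin.
  rewrite EFinM lee_wpmul2l ?lee_fin//.
  rewrite -ge0_integral_sum//; last 2 first.
  - by move=> k; exact: (mlev k).
  - by move=> k x _; rewrite lee_fin.
  apply: (@le_trans _ _ (\int[mu]_(x in Q) (Cc%:E * (t N x)%:E))%E).
    apply: ge0_le_integral => //.
    - by move=> x _; apply: sume_ge0 => k _; rewrite lee_fin.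
    - by apply: emeasurable_sum => k; exact: (mlev k).
    - by apply: measurable_funeM; exact: (mlev N).
    move=> x _; rewrite sumEFin -EFinM lee_fin.
    have := HCc (t^~ x) (y^~ x) (t0^~ x) (tS^~ x) (y0^~ x) (y1^~ x) (yS^~ x) N.
    rewrite powRr1 ?(ltW (t0 _ _))//; apply: le_trans.
    by apply: ler_sum => k _; rewrite /yt powRr1 ?(ltW (t0 _ _))// mulrC.
  rewrite ge0_integralZl//.
  - by rewrite EFinM lee_wpmul2l ?lee_fin// ltW.
  - exact: (mlev N).
  - by move=> x _; rewrite lee_fin ltW.
  - by rewrite lee_fin ltW.
have wadm : admissible D delta (1 + Cd)%:E w.
  apply: (admissible_le D _ _ _ _ sum_dt).
  apply: admissible_sum => k; apply: admissible_level.
    move=> x x' xx; rewrite (ldt k x x')// !indicE; congr (_ * _ %:R).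
    apply: congr1; have lQ : lset (j + k%:Z) Q by apply: lset_cubex; rewrite lerDl.
    by apply/idP/idP; rewrite !inE; apply: lQ.
  by move=> x; rewrite mulr_ge0.
have Gt0 k x : (0 <= ((dt k x + yt k x * osc (j + k%:Z) x `^ (2 * P)) * \1_Q x)%:E)%E.
  by rewrite lee_fin mulr_ge0// addr_ge0// mulr_ge0// powR_ge0.
have wt0 k x : (0 <= (V k * (dt k x * \1_Q x))%:E)%E.
  by rewrite lee_fin !mulr_ge0// ltW.
have m1Q : measurable_fun setT (fun x => (\1_Q x)%:E : \bar R).
  by apply/measurable_EFinP; exact: measurable_indic.
have mdt1 k : measurable_fun setT (fun x => (dt k x * \1_Q x)%:E).
  by under eq_fun do rewrite EFinM; apply: emeasurable_funM => //; exact: (mlev k).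
have mytX1 k : measurable_fun setT
    (fun x => (yt k x * osc (j + k%:Z) x `^ (2 * P) * \1_Q x)%:E).
  by under eq_fun do rewrite EFinM; apply: emeasurable_funM => //; exact: mytX.
have GE k x : ((dt k x + yt k x * osc (j + k%:Z) x `^ (2 * P)) * \1_Q x)%:E =
   ((dt k x * \1_Q x)%:E + (yt k x * osc (j + k%:Z) x `^ (2 * P) * \1_Q x)%:E)%E.
  by rewrite -EFinD mulrDl.
have mG : measurable_fun setT G.
  apply: ge0_emeasurable_sum => [k x _ _|k _]; first exact: Gt0.
  by under eq_fun do rewrite GE; exact: emeasurable_funD.
have G0 x : (0 <= G x)%E by apply: nneseries_ge0 => k _ _; exact: Gt0.
have intG : (\int[mu]_x G x <= C4%:E)%E.
  rewrite integral_nneseries//; last first.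
    by move=> k; under eq_fun do rewrite GE; exact: emeasurable_funD.
  rewrite (eq_eseriesr (g := fun k => \int[mu]_x (dt k x * \1_Q x)%:E +
     \int[mu]_x (yt k x * osc (j + k%:Z) x `^ (2 * P) * \1_Q x)%:E)%E); last first.
    move=> k _; under eq_integral do rewrite GE; rewrite ge0_integralD//.
    - by move=> x _; rewrite lee_fin mulr_ge0.
    - by move=> x _; rewrite lee_fin mulr_ge0// mulr_ge0// powR_ge0.
  rewrite nneseriesD.
  - by rewrite /C4 EFinD; exact: leeD.
  - by move=> k _ _; apply: integral_ge0 => x _; rewrite lee_fin mulr_ge0.
  - by move=> k _ _; apply: integral_ge0 => x _; rewrite lee_fin mulr_ge0// mulr_ge0// powR_ge0.
exists (fun x => c3%:E * w x)%E, (fun x => c3%:E * G x)%E; split.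
- rewrite EFinM; apply: admissibleZ; first exact: ltW.
  apply: admissible_le wadm; rewrite lee_fin /C4 lerDl mulr_ge0// mulr_ge0 ?(ltW Cc0)//.
  by rewrite addr_ge0// ltW.
- exact: measurable_funeM.
- by move=> x; rewrite mule_ge0// lee_fin ltW.
- by rewrite ge0_integralZl ?lee_fin ?(ltW c30)// [leRHS]EFinM lee_wpmul2l ?lee_fin ?(ltW c30).
move=> kappa x k0.
have w0 x' : (0 <= w x')%E by apply: nneseries_ge0 => k _ _; exact: wt0.
have [Qx|nQx] := pselect (Q x); last first.
  rewrite eseries0; last by move=> k _ _; apply: (oscterm_eq0 _ _ j x0) => //; rewrite lerDl.
  by rewrite adde_ge0// !mule_ge0 ?lee_fin ?powR_ge0// ltW.
apply: nneseries_le_partial => [k|N]; first exact: oscterm_ge0.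
have kb k : (avg (j + k%:Z) (fun y => (osc (j + k%:Z) y * f y)%:E) x <=
    ((B + 1) * (v `^ (- (delta / r)) * t k x `^ q^-1))%:E)%E.
  apply: avg_oscM_bound => //; first by rewrite mulr_gt0// powR_gt0.
  rewrite powRM ?powR_ge0// -!powRrM.
  apply: (@le_trans _ _ ((v `^ (- (delta / r) * s))%:E * avg (j + k%:Z) (EFin \o phi) x)%E).
    rewrite -avgZ; last 3 first.
    - by apply/measurable_EFinP.
    - by move=> y'; rewrite lee_fin.
    - exact: powR_ge0.
    rewrite le_eqVlt; apply/orP; left; apply/eqP; apply: avg_eq => y' _.
    rewrite -EFinM /phi powRM ?powR_ge0// -powRrM mulrA -powRDp//.
    have -> : - (delta / r) * s + delta / r * s = 0 by ring.
    by rewrite powRr0 mul1r.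
  rewrite avg_mean// -EFinM lee_fin ler_wpM2l ?powR_ge0//.
  apply: (le_trans (mean_le_maxmean D j phi k x)).
  have -> : maxmean D j phi k x = (M k x `^ rho) `^ (q^-1 * s).
    rewrite -powRrM /rho (_ : q / s * (q^-1 * s) = 1) ?powRr1//.
    by field; rewrite !gt_eqF.
  rewrite le_powR ?powR_ge0//; last by rewrite mulr_ge0 ?invr_ge0 ?ltW.
  by rewrite /t lerDr invr_ge0 ltW.
(* As [1/q = gamma + 1/P] and [vol^theta = V^gamma], the product [vol^theta t^(1/q)] is
   [(V t)^gamma t^(1/P)]. *)
have tb k : (oscterm theta (j + k%:Z) f x <= ((B + 1) * (v `^ (- (delta / r)) *
    ((V k * t k x) `^ gamma * t k x `^ P^-1) * osc (j + k%:Z) x))%:E)%E.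
  apply: (@le_trans _ _ ((vol (j + k%:Z) `^ theta * osc (j + k%:Z) x)%:E *
     ((B + 1) * (v `^ (- (delta / r)) * t k x `^ q^-1))%:E)%E).
    by rewrite lee_wpmul2l ?lee_fin ?mulr_ge0 ?powR_ge0 ?osc_ge0.
  rewrite -EFinM lee_fin le_eqVlt; apply/orP; left; apply/eqP.
  rewrite powRM ?(ltW (V0 _)) ?(ltW (t0 _ _))//.
  have -> : t k x `^ q^-1 = t k x `^ gamma * t k x `^ P^-1.
    rewrite -powRDp//; congr (_ `^ _); lra.
  have -> : vol (j + k%:Z) `^ theta = V k `^ gamma.
    by rewrite /V -powRrM /theta mulrC.
  by ring.
apply: (@le_trans _ _ (\sum_(k < N.+1) ((B + 1) * (v `^ (- (delta / r)) *
    ((V k * t k x) `^ gamma * t k x `^ P^-1) * osc (j + k%:Z) x))%:E)%E).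
  by apply: lee_sum => k _.
rewrite sumEFin -mulr_sumr.
have := HCw (t^~ x) V (W^~ x) (fun k => osc (j + k%:Z) x) (v `^ (- (delta / r)))
  (t0^~ x) (tS^~ x) V0 VS (WS^~ x) (VtW^~ x) (fun k => osc_ge0 _ _) (powR_ge0 _ _) _ N kappa k0.
have cW k : v `^ (- (delta / r)) <= W k x `^ r^-1.
  rewrite -mulNr powRrM le_powR ?powR_ge0// invr_ge0 ltW//.
move=> /(_ cW) h.
apply: (@le_trans _ _ (c3 * (kappa `^ p * W N x + kappa `^ (- P) * (t N x +
    \sum_(k < N.+1) yt k x * osc (j + k%:Z) x `^ (2 * P))))%:E).
  by rewrite lee_fin /c3 -mulrA ler_wpM2l//; lra.
have -> : ((kappa `^ p)%:E * (c3%:E * w x) + (kappa `^ (- P))%:E * (c3%:E * G x) =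
   c3%:E * ((kappa `^ p)%:E * w x + (kappa `^ (- P))%:E * G x))%E.
  rewrite ge0_muleDr; first by rewrite muleCA [X in (_ + X)%E]muleCA.
  - by rewrite mule_ge0 ?lee_fin ?powR_ge0.
  - by rewrite mule_ge0 ?lee_fin ?powR_ge0.
rewrite EFinM lee_wpmul2l ?lee_fin ?(ltW c30)//.
rewrite EFinD; apply: leeD; rewrite EFinM lee_wpmul2l ?lee_fin ?powR_ge0//.
  apply: (@le_trans _ _ (\sum_(0 <= k < N.+1) (V k * (dt k x * \1_Q x))%:E)%E).
    rewrite big_mkord sumEFin lee_fin /W; apply: ler_sum => k _.
    by rewrite indicE mem_set// mulr1.
  by apply: nneseries_lim_ge.
apply: (@le_trans _ _ (\sum_(0 <= k < N.+1)
    ((dt k x + yt k x * osc (j + k%:Z) x `^ (2 * P)) * \1_Q x)%:E)%E).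
  rewrite big_mkord sumEFin lee_fin -sumdt -big_split/=; apply: ler_sum => k _.
  by rewrite indicE mem_set// mulr1.
by apply: nneseries_lim_ge => k _ _; exact: Gt0.
Qed.

(* Scales above the block: as [s < q], Hoelder's inequality on the large cube gives
   geometric decay in the scale. *)
Lemma far_dominated : exists2 C, 0 < C & forall j x0 f,
  measurable_fun setT f -> (forall y, 0 <= f y) ->
  (forall y, ~ cubex j x0 y -> f y = 0) ->
  (\int[mu]_y (f y `^ q)%:E <= (vol j `^ (- ((q - 1) * delta)))%:E)%E ->
  dom C%:E (fun x => \sum_(k <oo) oscterm theta (j - k.+1%:Z) f x)%E.
Proof.
move: (p1) (P1) (pP) (q1) (r1) (qr) (d1) (pr) (s1) (sq) (B0) => ? ? ? ? ? ? ? ? ? ? ?.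
have q0 : 0 < q by lra.
have s0 : 0 < s by lra.
have r0 : 0 < r by lra.
have p0 : 0 < p by lra.
have P0 : 0 < P by lra.
(* In the application [iu] is [1 / r0'], so [v^-iu] is the natural height of a block on a cube of
   volume [v]; the gap [eta] to [1/s] becomes the rate of decay. *)
pose iu := q^-1 + delta / r.
pose eta := s^-1 - iu.
have eta1 : 0 < eta by rewrite subr_gt0.
have rat0 := ratio_gt0 D.
pose z := (ratio D)^-1 `^ eta.
have z0 : 0 < z by rewrite powR_gt0// invr_gt0.
have z1 : z < 1 by rewrite powR_lt1// ?invf_lt1 ?ratio_gt1// invr_ge0 ltW.
pose c0 := (B + 1) * 2 `^ s^-1.
have c00 : 0 < c0 by rewrite mulr_gt0 ?powR_gt0//; lra.
exists (c0 * (1 + B) * (z / (1 - z))) => [|j x0 f mf f0 fQ fq].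
  by rewrite !mulr_gt0 ?invr_gt0 ?subr_gt0//; lra.
have geo := nneseries_geometric_le z (ltW z0) z1.
have sumC : (\sum_(k <oo) (c0 * (1 + B) * z ^+ k.+1)%:E <=
    (c0 * (1 + B) * (z / (1 - z)))%:E)%E.
  under eq_eseriesr do rewrite EFinM.
  have cB0 : 0 <= c0 * (1 + B) by rewrite mulr_ge0 ?(ltW c00)//; lra.
  rewrite nneseriesZl//; last by move=> k _; rewrite lee_fin exprn_ge0// ltW.
  by rewrite [leRHS]EFinM lee_wpmul2l ?lee_fin.
apply: (dominated_leC D _ _ _ _ _ _ sumC).
apply: dominated_sum => [k x|k]; first exact: oscterm_ge0.
set l := j - k.+1%:Z.
have lj : l <= j by rewrite /l gerBl.
set v := vol j; have v0 : 0 < v by exact: vol_gt0.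
set vl := vol l; have vl0 : 0 < vl by exact: vol_gt0.
have vvl : v / vl = (ratio D)^-1 ^+ k.+1.
  have -> : v = vl * vol k.+1%:Z by rewrite /v /vl -volD /l subrK.
  rewrite mulrAC divff ?gt_eqF// mul1r /vol.
  by rewrite exprVn.
have zk : z ^+ k.+1 = (v / vl) `^ eta.
  rewrite vvl /z -(powR_mulrn _ (powR_ge0 _ _)) -powRrM mulrC powRrM.
  by rewrite powR_mulrn// invr_ge0 ltW.
pose ck := c0 * z ^+ k.+1.
have ck0 : 0 <= ck by rewrite mulr_ge0 ?exprn_ge0// ltW.
have ckC : ck <= c0 * (1 + B) * z ^+ k.+1.
  by rewrite -mulrA /ck ler_wpM2l ?(ltW c00)// ler_peMl ?exprn_ge0 ?(ltW z0)// lerDl.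
have BckC : B * ck <= c0 * (1 + B) * z ^+ k.+1.
  have -> : c0 * (1 + B) * z ^+ k.+1 = (1 + B) * ck by rewrite /ck; ring.
  by rewrite ler_wpM2r// lerDr.
pose g x : R := ck * vl^-1 * \1_(cubex l x0) x.
have lg : level l g.
  move=> x y xy; rewrite /g !indicE; congr (_ * _ %:R); apply: congr1.
  by apply/idP/idP; rewrite !inE; apply: (lset_cubex D l l x0).
have ckvl0 : 0 <= ck / vl by apply: mulr_ge0 => //; rewrite invr_ge0 ltW.
have gge0 x : 0 <= g x by apply: mulr_ge0.
pose G x := ((g x)%:E * (osc l x `^ P)%:E)%E.
have mQ : measurable (cubex l x0) by exact: mcubex.
have mosc : measurable_fun setT (fun x => (osc l x `^ P)%:E).
  by apply: measurable_EFin_powR; exact: measurable_osc.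
have mg : measurable_fun setT (EFin \o g).
  by apply/measurable_EFinP; exact: (measurable_level D _ _ l).
have intg : (\int[mu]_x (g x)%:E <= ck%:E)%E.
  rewrite /g; under eq_integral do rewrite EFinM.
  rewrite ge0_integralZl//.
  - rewrite integral_indic// setIT mucubex -EFinM lee_fin.
    by rewrite -mulrA mulVf ?mulr1// gt_eqF.
  - by apply/measurable_EFinP; exact: measurable_indic.
exists (fun x => (vol l `^ (1 - delta) * g x)%:E), G; split.
- apply: admissible_le (admissible_level D delta l g lg gge0).
  by apply: (le_trans intg); rewrite lee_fin.
- exact: emeasurable_funM.
- by move=> x; rewrite mule_ge0 ?lee_fin ?powR_ge0.
- rewrite /G; have H1 : level l (EFin \o g) by move=> x y xy /=; rewrite (lg x y).
  have := integral_level D l setT (EFin \o g) (fun x => (osc l x `^ P)%:E).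
  have H2 x : (0 <= (EFin \o g) x)%E by rewrite lee_fin.
  have H3 x : (0 <= (osc l x `^ P)%:E)%E by rewrite lee_fin powR_ge0.
  move=> /(_ (fun _ _ _ _ => I) H1 H2 H3 mosc) => <-.
  apply: (@le_trans _ _ (\int[mu]_x (B%:E * (g x)%:E))%E).
    apply: ge0_le_integral => //.
    + by move=> x _; rewrite mule_ge0// avg_ge0.
    + by apply: emeasurable_funM => //; exact: measurable_avg.
    + exact: measurable_funeM.
    + by move=> x _; rewrite muleC lee_wpmul2r// lee_fin.
  rewrite ge0_integralZl//.
  - apply: (@le_trans _ _ (B%:E * ck%:E)%E); first by rewrite lee_wpmul2l ?lee_fin.
    by rewrite -EFinM lee_fin.
  - by move=> x _; rewrite lee_fin.
move=> kappa x k0.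
have [Qx|nQx] := pselect (cubex l x0 x); last first.
  rewrite /oscterm (avg_eq D _ _ (fun=> 0%E)).
    rewrite (avg_cst D l 0) mule0; apply: adde_ge0.
      by rewrite -EFinM lee_fin mulr_ge0 ?powR_ge0// mulr_ge0 ?powR_ge0.
    by rewrite /G -!EFinM lee_fin mulr_ge0 ?powR_ge0// mulr_ge0 ?powR_ge0.
  move=> y yx; rewrite fQ ?mulr0// => yl; apply: nQx.
  have yl' := cell_le D _ _ _ _ lj yl.
  exact: etrans (esym yx) yl'.
(* Below the height [kp] use [f^s <= kp^s], above it [f^s <= kp^(s-q) f^q]. At this height both
   bounds contribute [kp^s v], which is the origin of the 2 in [c0]. *)
pose kp := v `^ (- iu).
have kp0 : 0 < kp by rewrite powR_gt0.
have ints : (\int[mu]_(y in cubex j x0) (f y `^ s)%:E <= (2 * kp `^ s * v)%:E)%E.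
  have mQj : measurable (cubex j x0) by exact: mcubex.
  apply: (@le_trans _ _ (\int[mu]_(y in cubex j x0)
     ((kp `^ s)%:E + (kp `^ (s - q))%:E * (f y `^ q)%:E))%E).
    apply: ge0_le_integral => //.
    - by move=> y _; rewrite lee_fin powR_ge0.
    - exact: measurable_EFin_powR.
    - by apply: emeasurable_funD => //; apply: measurable_funeM; exact: measurable_EFin_powR.
    move=> y _; rewrite -EFinM -EFinD lee_fin.
    have [fk|kf] := leP (f y) kp.
      rewrite (@le_trans _ _ (kp `^ s))// ?le_powR ?(ltW s0)//.
      by rewrite lerDl mulr_ge0 ?powR_ge0.
    have fy0 : 0 < f y by exact: lt_trans kf.
    rewrite (@le_trans _ _ (kp `^ (s - q) * f y `^ q))//; last by rewrite lerDr powR_ge0.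
    have -> : f y `^ s = f y `^ (s - q) * f y `^ q by rewrite -powRDp// subrK.
    rewrite ler_wpM2r ?powR_ge0//.
    rewrite -(opprB q s) !powRN lef_pV2 ?posrE ?powR_gt0//.
    by rewrite le_powR ?(ltW kf) ?(ltW kp0)// subr_ge0 ltW.
  rewrite ge0_integralD//; last 3 first.
  - by move=> y _; rewrite lee_fin powR_ge0.
  - by move=> y _; rewrite -EFinM lee_fin mulr_ge0 ?powR_ge0.
  - by apply: measurable_funeM; exact: measurable_EFin_powR.
  rewrite (_ : \int[mu]_(y in _) (kp `^ s)%:E = \int[mu]_(y in cubex j x0) cst (kp `^ s)%:E y)%E//.
  rewrite integral_cst// mucubex ge0_integralZl//; last 3 first.
  - exact: measurable_EFin_powR.
  - by move=> y _; rewrite lee_fin powR_ge0.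
  - by rewrite lee_fin powR_ge0.
  apply: (@le_trans _ _ ((kp `^ s)%:E * v%:E +
      (kp `^ (s - q))%:E * (v `^ (- ((q - 1) * delta)))%:E)%E).
    rewrite leeD2l// lee_wpmul2l ?lee_fin ?powR_ge0//; apply: le_trans fq.
    apply: ge0_subset_integral => //; first exact: measurable_EFin_powR.
    by move=> y _; rewrite lee_fin powR_ge0.
  rewrite -!EFinM -EFinD lee_fin le_eqVlt; apply/orP; left; apply/eqP.
  have -> : kp `^ (s - q) * v `^ (- ((q - 1) * delta)) = kp `^ s * v.
    rewrite powRDp// -mulrA; congr (_ * _).
    rewrite /kp -powRrM -powRDp// -[RHS]powRr1 ?(ltW v0)//; congr (_ `^ _).
    have qrE : q * r^-1 = q - 1.
      have -> : r^-1 = 1 - q^-1 by lra.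
      by field; rewrite gt_eqF.
    rewrite /iu mulrNN mulrDl mulVf ?gt_eqF//.
    have -> : delta / r * q = delta * (q * r^-1) by ring.
    by rewrite qrE; ring.
  by ring.
pose kl := (2 * kp `^ s * v / vl) `^ s^-1.
have kl0 : 0 < kl by rewrite powR_gt0// !mulr_gt0 ?powR_gt0// invr_gt0.
have avgb : (avg l (fun y => (osc l y * f y)%:E) x <= ((B + 1) * kl)%:E)%E.
  apply: avg_oscM_bound => //.
  rewrite /kl powRK_inv ?gt_eqF//; last by rewrite !mulr_ge0 ?powR_ge0 ?invr_ge0 ?ltW.
  rewrite /avg mulrC EFinM lee_wpmul2l ?lee_fin ?invr_ge0 ?(ltW vl0)//.
  apply: le_trans ints; rewrite le_eqVlt; apply/orP; left; apply/eqP.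
  rewrite [LHS]integral_mkcond [RHS]integral_mkcond; apply: eq_integral => y _.
  rewrite !patchE; case: ifPn => [yl|nyl]; case: ifPn => [yj|nyj]//.
    have fy0 : f y = 0 by apply: fQ => H; move/negP: nyj; apply; apply/mem_set.
    by rewrite fy0 powR0// gt_eqF.
  exfalso; move/negP: nyl; apply; apply/mem_set; move/set_mem: yj => yj.
  exact: etrans (cell_le D _ _ _ _ lj yj) (esym Qx).
apply: (@le_trans _ _ (ck * (vl `^ (- (P^-1 + delta / p)) * osc l x))%:E).
  apply: (@le_trans _ _ ((vl `^ theta * osc l x)%:E * ((B + 1) * kl)%:E)%E).
    by rewrite lee_wpmul2l// lee_fin mulr_ge0 ?powR_ge0 ?osc_ge0.
  rewrite -EFinM lee_fin le_eqVlt; apply/orP; left; apply/eqP.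
  have -> : kl = 2 `^ s^-1 * (vl `^ (- iu) * z ^+ k.+1).
    have u0 : 0 < v / vl by rewrite divr_gt0.
    have kps0 : 0 <= kp `^ s by exact: powR_ge0.
    have -> : kl = 2 `^ s^-1 * kp * (v / vl) `^ s^-1.
      rewrite /kl -mulrA powRM ?(ltW u0)//; last by apply: mulr_ge0.
      by rewrite powRM// -(powRrM kp) mulfV ?gt_eqF// powRr1 ?(ltW kp0).
    rewrite zk /eta powRDp//.
    have -> : (v / vl) `^ (- iu) = v `^ (- iu) * vl `^ iu.
      by rewrite powRM ?invr_ge0 ?(ltW v0) ?(ltW vl0)// powRV ?(ltW vl0)// opprK.
    rewrite (powRN vl) /kp; field; rewrite gt_eqF// powR_gt0//.
  (* From [1/q = gamma + 1/P] one gets [theta - iu = -1/P - delta/p], the exponent of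
     [(vl^-delta)^(1/p) (vl^-1)^(1/P)]. *)
  have -> : vl `^ (- (P^-1 + delta / p)) = vl `^ theta * vl `^ (- iu).
    rewrite -powRDp//; congr (_ `^ _); rewrite /theta /iu.
    have -> : delta / p = delta * gamma + delta / r by rewrite pr; ring.
    have -> : P^-1 = q^-1 - gamma by lra.
    by ring.
  by rewrite /ck /c0; ring.
rewrite /G -!EFinM -EFinD lee_fin /g !indicE mem_set// !mulr1.
have -> : vl `^ (- (P^-1 + delta / p)) * osc l x =
    (vl `^ (- delta)) `^ p^-1 * (vl^-1 * osc l x `^ P) `^ P^-1.
  rewrite -powRrM powRM ?invr_ge0 ?(ltW vl0) ?powR_ge0// powRK ?osc_ge0 ?gt_eqF//.
  rewrite powRV ?(ltW vl0)// mulrA -powRDp//; congr (_ `^ _ * _).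
  by ring.
have := young_powR_scaled kappa (vl `^ (- delta)) (vl^-1 * osc l x `^ P) p P k0
  (powR_ge0 _ _) _ p0 P0 pP.
rewrite mulr_ge0 ?powR_ge0 ?invr_ge0 ?(ltW vl0)// => /(_ isT) /(ler_wpM2l ck0)/le_trans; apply.
rewrite le_eqVlt; apply/orP; left; apply/eqP.
have -> : vol l `^ (1 - delta) = vl * vl `^ (- delta).
  by rewrite powRDp// powRr1// ltW.
by field; rewrite gt_eqF.
Qed.

End BlockEstimate.

(** * Sums over blocks *)

(** The partial sums are centred at scale 0, the block estimates at the scale [j] of the block; as
    the terms are nonnegative, the window [[-M, M]] may be enlarged to [[j - N, j + N)]. *)
Lemma sum_int_le {R : realType} (F : int -> \bar R) (j : int) (M : nat) :
  (forall i, (0 <= F i)%E) ->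
  (\sum_(k < (M.*2).+1) F (k%:Z - M%:Z)%R <=
   \sum_(k <oo) F (j + k%:Z)%R + \sum_(k <oo) F (j - k.+1%:Z)%R)%E.
Proof.
move=> F0.
pose N := (M + `|j|).+1%N.
have [b bE] : exists b : nat, b%:Z = N%:Z - j - M%:Z.
  by exists (absz (N%:Z - j - M%:Z)%R); rewrite gez0_abs// /N; lia.
apply: (@le_trans _ _ (\sum_(0 <= k < N) F (j + k%:Z)%R + \sum_(0 <= k < N) F (j - k.+1%:Z)%R)%E);
  last by apply: leeD; apply: nneseries_lim_ge => k _ _.
have -> : (\sum_(0 <= k < N) F (j + k%:Z)%R + \sum_(0 <= k < N) F (j - k.+1%:Z)%R =
    \sum_(0 <= k < N + N) F (j - N%:Z + k%:Z)%R)%E.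
  rewrite (big_cat_nat (leq0n N) (leq_addr N N))/= addeC; congr (_ + _)%E.
    rewrite big_nat_rev/= add0n; apply: eq_big_nat => k /andP[_ kN].
    by congr F; lia.
  rewrite -{2}(add0n N) big_addn addnK; apply: eq_big_nat => k _; congr F; lia.
have bN : (b + M.*2.+1 <= N + N)%N by rewrite /N in bE *; lia.
rewrite (big_cat_nat (leq0n b) (leq_trans (leq_addr _ _) bN))/=.
rewrite (big_cat_nat (leq_addr _ b) bN)/=.
have -> : (\sum_(k < (M.*2).+1) F (k%:Z - M%:Z)%R =
    \sum_(b <= k < b + M.*2.+1) F (j - N%:Z + k%:Z)%R)%E.
  rewrite -{1}(add0n b) big_addn addKn big_mkord; apply: eq_bigr => k _.
  by congr F; lia.
apply: le_trans (leeDr _ (sume_ge0 _ _)) => //.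
by apply: leeDl; apply: sume_ge0.
Qed.

Section DecompositionEstimate.
Context {R : realType} {d : measure_display} {T : measurableType d}
  {mu : {measure set T -> \bar R}} (D : dyadicSystem mu) (a : T -> R)
  (p P delta theta C : R).
Implicit Types (j l : int) (f g : T -> R) (H : T -> \bar R).

Definition oscsum M f x : \bar R :=
  (\sum_(k < (M.*2).+1) oscterm D a theta (k%:Z - M%:Z) f x)%E.

(** [f] enters only through integrals, so an almost everywhere bound by the blocks gives a bound at
    every [x]. *)
Lemma oscsum_decomp f (lam : nat -> R) (A : nat -> T -> R) (H : nat -> T -> \bar R) :
  locint D a -> measurable_fun setT f -> (forall y, 0 <= f y) ->
  (forall k, 0 <= lam k) -> (forall k, measurable_fun setT (A k)) ->
  (forall k y, 0 <= A k y) -> (forall k y, (0 <= H k y)%E) ->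
  (forall k M x, (oscsum M (A k) x <= H k x)%E) ->
  {ae mu, forall x, ((f x)%:E <= \sum_(k <oo) (lam k * A k x)%:E)%E} ->
  forall M x, (oscsum M f x <= \sum_(k <oo) (lam k)%:E * H k x)%E.
Proof.
move=> la mf f0 lam0 mA A0 H0 AH fA M x.
have termle j : (oscterm D a theta j f x <=
    \sum_(k <oo) (lam k)%:E * oscterm D a theta j (A k) x)%E.
  have o0 g y : (forall y, 0 <= g y) -> (0 <= (osc D a j y * g y)%:E)%E.
    by move=> g0; rewrite lee_fin mulr_ge0// osc_ge0.
  have mo g : measurable_fun setT g -> measurable_fun setT (fun y => (osc D a j y * g y)%:E).
    exact: measurable_oscM.
  have c0 : 0 <= vol D j `^ theta * osc D a j x by rewrite mulr_ge0 ?powR_ge0// osc_ge0.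
  rewrite /oscterm.
  apply: (@le_trans _ _ ((vol D j `^ theta * osc D a j x)%:E *
     avg D j (fun y => \sum_(k <oo) (lam k)%:E * (osc D a j y * A k y)%:E)%E x)%E).
    rewrite lee_wpmul2l ?lee_fin//; apply: ae_le_avg.
    - exact: mo.
    - apply: ge0_emeasurable_sum => [k y _ _|k _].
        by rewrite mule_ge0 ?lee_fin ?lam0// -lee_fin o0.
      by apply: measurable_funeM; exact: mo.
    - by move=> y; exact: o0.
    - by move=> y; apply: nneseries_ge0 => k _ _; rewrite mule_ge0 ?lee_fin ?lam0// -lee_fin o0.
    apply: filterS fA => y fy.
    apply: (@le_trans _ _ ((osc D a j y)%:E * \sum_(k <oo) (lam k * A k y)%:E)%E).
      by rewrite EFinM lee_wpmul2l ?lee_fin ?osc_ge0.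
    rewrite -nneseriesZl; last by move=> k _; rewrite lee_fin mulr_ge0.
    apply: lee_nneseries => [k _ _|k _].
      by rewrite -EFinM lee_fin mulr_ge0 ?osc_ge0// mulr_ge0.
    by rewrite -!EFinM lee_fin mulrCA.
  rewrite avg_nneseries; last 2 first.
  - by move=> k; apply: measurable_funeM; exact: mo.
  - by move=> k y; rewrite mule_ge0 ?lee_fin ?lam0// -lee_fin o0.
  rewrite -nneseriesZl; last first.
    by move=> k _; apply: avg_ge0 => y; rewrite mule_ge0 ?lee_fin ?lam0// -lee_fin o0.
  apply: lee_nneseries => [k _ _|k _].
    rewrite mule_ge0 ?lee_fin//; apply: avg_ge0 => y.
    by rewrite mule_ge0 ?lee_fin ?lam0// -lee_fin o0.
  rewrite avgZ ?lam0//; last 2 first.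
  - exact: mo.
  - by move=> y; exact: o0.
  by rewrite muleCA.
have t0 k j : (0 <= (lam k)%:E * oscterm D a theta j (A k) x)%E.
  by rewrite mule_ge0 ?lee_fin// oscterm_ge0.
apply: (@le_trans _ _ (\sum_(k < M.*2.+1) \sum_(i <oo)
    (lam i)%:E * oscterm D a theta (k%:Z - M%:Z) (A i) x)%E).
  by apply: lee_sum => k _; exact: termle.
rewrite -nneseries_sum//.
apply: lee_nneseries => [k _ _|k _]; first by apply: sume_ge0.
rewrite -ge0_sume_distrr; last by move=> i _; rewrite oscterm_ge0.
by rewrite lee_wpmul2l ?lee_fin//; exact: AH.
Qed.

(** The absolute value of a block. The integral condition is the [q]-th power of the norm bound with
    exponent [1/q - 1/r0'], because [1/q - 1/r0' = - delta / r] and [q / r = q - 1]. *)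
Definition block q delta j x0 (f : T -> R) :=
  [/\ measurable_fun setT f, (forall y, 0 <= f y),
    (forall y, ~ cubex D j x0 y -> f y = 0) &
    (\int[mu]_y (f y `^ q)%:E <= (vol D j `^ (- ((q - 1) * delta)))%:E)%E].

Lemma decomp_dominated q f (lam : nat -> R) (A : nat -> T -> R) :
  (forall j x0 g, block q delta j x0 g -> exists H, [/\ forall x, (0 <= H x)%E,
     dominated D delta p P C%:E H & forall M x, (oscsum M g x <= H x)%E]) ->
  0 <= C -> locint D a -> measurable_fun setT f -> (forall y, 0 <= f y) ->
  (forall k, 0 <= lam k) -> (forall k, exists j x0, block q delta j x0 (A k)) ->
  {ae mu, forall x, ((f x)%:E <= \sum_(k <oo) (lam k * A k x)%:E)%E} ->
  exists H, [/\ forall x, (0 <= H x)%E,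
     dominated D delta p P (C%:E * \sum_(k <oo) (lam k)%:E)%E H &
     forall M x, (oscsum M f x <= H x)%E].
Proof.
move=> HB C0 la mf f0 lam0 bA fA.
have /choice[H HH] : forall k, exists H, [/\ forall x, (0 <= H x)%E,
     dominated D delta p P C%:E H & forall M x, (oscsum M (A k) x <= H x)%E].
  by move=> k; have [j [x0 bk]] := bA k; exact: HB bk.
have H0 k x : (0 <= H k x)%E by have [] := HH k.
exists (fun x => \sum_(k <oo) (lam k)%:E * H k x)%E; split.
- by move=> x; apply: nneseries_ge0 => k _ _; rewrite mule_ge0 ?lee_fin.
- rewrite -nneseriesZl; last by move=> k _; rewrite lee_fin.
  under eq_eseriesr do rewrite muleC.
  apply: dominated_sum => [k x|k]; first by rewrite mule_ge0 ?lee_fin.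
  by apply: dominatedZ => //; have [] := HH k.
- apply: (oscsum_decomp _ _ A) => //.
  + by move=> k; have [j [x0 []]] := bA k.
  + by move=> k; have [j [x0 []]] := bA k.
  + by move=> k; have [] := HH k.
Qed.

End DecompositionEstimate.

Section BlockDominated.
Context {R : realType} {d : measure_display} {T : measurableType d}
  {mu : {measure set T -> \bar R}} (D : dyadicSystem mu) (a : T -> R)
  (p P q r s delta gamma : R).

Lemma block_dominated (K : R) : 1 < p -> 1 < P -> p^-1 + P^-1 = 1 ->
  1 < q -> 1 < r -> q^-1 + r^-1 = 1 -> 0 <= delta -> delta < 1 -> 0 < gamma ->
  p^-1 = gamma + r^-1 -> 1 < s -> s < q -> q^-1 + delta / r < s^-1 ->
  0 < K -> bmo D a K ->
  exists2 C : R, 0 < C & forall j x0 f, block D q delta j x0 f ->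
    exists H, [/\ forall x, (0 <= H x)%E, dominated D delta p P C%:E H &
      forall M x, (oscsum D a (gamma * (1 - delta)) M f x <= H x)%E].
Proof.
move=> p1 P1 pP q1 r1 qr d0 d1 g0 pr s1 sq eta0 K0 aK.
have la : locint D a by case: aK.
have s'0 : 0 < s / (s - 1) by rewrite divr_gt0; lra.
have P0 : 0 < P by lra.
have [B1 B10 HB1] := john_nirenberg D a K (s / (s - 1)) K0 s'0 aK.
have [B2 B20 HB2] := john_nirenberg D a K P K0 P0 aK.
have P20 : 0 < 2 * P by lra.
have [B3 B30 HB3] := john_nirenberg D a K (2 * P) K0 P20 aK.
pose B := B1 + B2 + B3.
have B0 : 0 <= B by rewrite /B; lra.
have le1 : B1 <= B by rewrite /B; lra.
have le2 : B2 <= B by rewrite /B; lra.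
have le3 : B3 <= B by rewrite /B; lra.
have HBs j x : (avg D j (fun y => (osc D a j y `^ (s / (s - 1)))%:E) x <= B%:E)%E.
  by apply: (le_trans (HB1 j x)); rewrite lee_fin.
have HBP j x : (avg D j (fun y => (osc D a j y `^ P)%:E) x <= B%:E)%E.
  by apply: (le_trans (HB2 j x)); rewrite lee_fin.
have HBL j x : (avg D j (fun y => (osc D a j y `^ (2 * P))%:E) x <= B%:E)%E.
  by apply: (le_trans (HB3 j x)); rewrite lee_fin.
have [C1 C10 H1] := local_dominated D a p P q r s delta gamma p1 P1 pP q1 r1 qr d1 g0 pr s1 sq B la B0 HBs HBL.
have [C2 C20 H2] := far_dominated D a p P q r s delta gamma p1 P1 pP q1 r1 qr d1 pr s1 sq eta0 B la B0 HBs HBP.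
exists (C1 + C2); first by rewrite addr_gt0.
move=> j x0 f [mf f0 fQ fq].
pose F j x := oscterm D a (gamma * (1 - delta)) j f x.
have F0 i x : (0 <= F i x)%E by exact: oscterm_ge0.
exists (fun x => \sum_(k <oo) F (j + k%:Z)%R x + \sum_(k <oo) F (j - k.+1%:Z)%R x)%E; split.
- by move=> x; rewrite adde_ge0// nneseries_ge0.
- rewrite EFinD; apply: dominatedD; rewrite ?lee_fin ?(ltW C10) ?(ltW C20)//.
  + by move=> x; rewrite nneseries_ge0.
  + by move=> x; rewrite nneseries_ge0.
  + exact: H1 mf f0 fQ fq.
  + exact: H2 mf f0 fQ fq.
- by move=> M x; apply: (sum_int_le (F^~ x)) => i; exact: F0.
Qed.

End BlockDominated.

(** * Block decomposition of dominated functions *)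

(** Here [t = m v^-delta 1_Q / w] is one share of the partition of unity, [b = m v^-delta], and [u]
    is the reciprocal of the coefficient. As [P / p = P - 1], the power [(t w^(1/p) G^(1/P))^P]
    equals [(t w)^(P-1) t G], and [t w <= b]. *)
Lemma rescaled_powR_le {R : realType} (p P u t f w G b : R) :
  0 < p -> 1 < P -> p^-1 + P^-1 = 1 -> 0 <= u -> 0 <= t -> 0 <= f -> 0 <= w -> 0 <= G ->
  (w = 0 -> t = 0) -> t * w <= b -> f <= 2 * (w `^ p^-1 * G `^ P^-1) ->
  (u * (t * f)) `^ P <= u `^ P * (2 `^ P * b `^ (P - 1)) * (t * G).
Proof.
move=> p0 P1 pP u0 t0 f0 w0 G0 wt twb fwG.
have P0 : 0 < P by lra.
have b0 : 0 <= b by apply: le_trans twb; rewrite mulr_ge0.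
rewrite powRM ?mulr_ge0// -mulrA ler_wpM2l ?powR_ge0//.
have [t00|tn0] := eqVneq t 0.
  by rewrite t00 mul0r powR0 ?gt_eqF// mul0r mulr0.
have tp : 0 < t by rewrite lt_neqAle eq_sym tn0.
have wp : 0 < w.
  by rewrite lt_neqAle w0 andbT; apply: contraNneq tn0 => /esym/wt ->.
apply: (@le_trans _ _ ((t * (2 * (w `^ p^-1 * G `^ P^-1))) `^ P)).
  by rewrite le_powR ?mulr_ge0 ?ler_wpM2l// ltW.
have -> : (t * (2 * (w `^ p^-1 * G `^ P^-1))) `^ P = 2 `^ P * (t * w) `^ (P - 1) * (t * G).
  rewrite powRM ?mulr_ge0 ?powR_ge0// powRM ?mulr_ge0 ?powR_ge0// powRM ?powR_ge0//.
  rewrite powRK_inv ?gt_eqF// -powRrM powRM//.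
  have -> : p^-1 * P = P - 1.
    have -> : p^-1 = 1 - P^-1 by lra.
    by field; rewrite gt_eqF.
  have -> : t `^ P = t `^ (P - 1) * t by rewrite -{3}(powRr1 t0) -powRDp// subrK.
  by ring.
rewrite ler_wpM2r ?mulr_ge0// ler_wpM2l ?powR_ge0// le_powR ?mulr_ge0//.
by rewrite subr_ge0 ltW.
Qed.

(** [nu] stands for [\int t G]. Since [m^(1/p) nu^(1/P) <= m + nu] by Young's inequality, the
    coefficient [2 (m + nu)] normalises the piece; its 2 offsets that of [le_powR_young]. *)
Lemma block_normalization {R : realType} (p P delta m nu v : R) :
  0 < p -> 1 < P -> p^-1 + P^-1 = 1 -> 0 <= m -> 0 <= nu -> 0 < m + nu ->
  (2 * (m + nu))^-1 `^ P * (2 `^ P * (m * v `^ (- delta)) `^ (P - 1)) * nu <=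
  v `^ (- (delta / p) * P).
Proof.
move=> p0 P1 pP m0 nu0 mnu.
have P0 : 0 < P by lra.
have pE : p^-1 * P = P - 1.
  have -> : p^-1 = 1 - P^-1 by lra.
  by field; rewrite gt_eqF.
have mn0 : 0 <= 2 * (m + nu) by rewrite mulr_ge0// ltW.
rewrite (@powRM _ m) ?powR_ge0//.
have -> : (v `^ (- delta)) `^ (P - 1) = v `^ (- (delta / p) * P).
  by rewrite -powRrM -pE; congr (_ `^ _); ring.
have -> : (2 * (m + nu))^-1 `^ P * (2 `^ P * (m `^ (P - 1) * v `^ (- (delta / p) * P))) * nu =
    ((2 * (m + nu))^-1 * (2 * (m `^ p^-1 * nu `^ P^-1))) `^ P * v `^ (- (delta / p) * P).
  have h1 : 0 <= (2 * (m + nu))^-1 by rewrite invr_ge0.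
  rewrite powRM ?mulr_ge0 ?powR_ge0//.
  rewrite (@powRM _ 2) ?mulr_ge0 ?powR_ge0// (@powRM _ (m `^ p^-1)) ?powR_ge0//.
  rewrite (powRK_inv nu) ?gt_eqF// -(powRrM m) pE.
  by ring.
rewrite ler_piMl ?powR_ge0//; apply: powR_le1; last exact: ltW.
  by apply: mulr_ge0; rewrite ?invr_ge0// !mulr_ge0 ?powR_ge0.
rewrite mulrC ler_pdivrMr ?mulr_gt0// mul1r ler_wpM2l//.
exact: young_powR.
Qed.

Section DominatedFunctions.
Context {R : realType} {d : measure_display} {T : measurableType d}
  {mu : {measure set T -> \bar R}} (D : dyadicSystem mu).
Implicit Types (j l : int) (F G w h : T -> \bar R) (f g : T -> R).
Local Notation vol := (vol D).
Local Notation cube := (cube D).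
Local Notation cubex := (cubex D).
Local Notation avg := (avg D).
Local Notation mean := (mean D).
Local Notation locint := (locint D).
Variables (delta p P C : R).
Local Notation dom := (dominated D delta p P).
Hypotheses (d0 : 0 <= delta) (d1 : delta <= 1).

Lemma ae_fin_num F : measurable_fun setT F -> (forall x, (0 <= F x)%E) ->
  (forall i, (\int[mu]_(x in cube 0 i) F x < +oo)%E) ->
  {ae mu, forall x, F x \is a fin_num}.
Proof.
move=> mF F0 Foo.
have H k : {ae mu, forall x, cube_enum D 0 k x -> F x \is a fin_num}.
  rewrite /cube_enum; case: pickle_inv => [i|]; last by apply: aeW.
  apply: integrable_ae; first exact: mcube.
  apply/integrableP; split; first exact: measurable_funTS.
  by under eq_integral do rewrite gee0_abs//.
move/ae_foralln : H; apply: filterS => x Hx.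
have : [set: T] x by [].
by rewrite -(cube_enum_cover D 0) => -[k _]; exact: Hx.
Qed.

Lemma dominated_cubex_le (h : T -> \bar R) f kappa j x : 0 < kappa ->
  dom C%:E h -> measurable_fun setT f -> (forall y, (`|f y|%:E <= h y)%E) ->
  (avg j (fun y => `|f y|%:E) x <= ((vol j)^-1 *
    (kappa `^ p * (C * vol j `^ (1 - delta)) + kappa `^ (- P) * C))%:E)%E.
Proof.
move=> k0 [w [G [aw mG G0 GC H]]] mf fh.
have w0 y : (0 <= w y)%E by exact: admissible_ge0 aw.
have mw := measurable_admissible D _ _ _ aw.
have mQ : measurable (cubex j x) by exact: mcubex.
rewrite /avg EFinM lee_wpmul2l ?lee_fin ?invr_ge0 ?(ltW (vol_gt0 _ _))//.
apply: (@le_trans _ _ (\int[mu]_(y in cubex j x)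
   ((kappa `^ p)%:E * w y + (kappa `^ (- P))%:E * G y))%E).
  apply: ge0_le_integral => //.
  - by apply: measurable_funTS; apply/measurable_EFinP; exact: measurableT_comp.
  - by apply: measurable_funTS; apply: emeasurable_funD; exact: measurable_funeM.
  - by move=> y _; apply: (le_trans (fh y)); exact: H.
rewrite ge0_integralD//; last 4 first.
- by move=> y _; rewrite mule_ge0 ?lee_fin ?powR_ge0.
- by apply: measurable_funTS; exact: measurable_funeM.
- by move=> y _; rewrite mule_ge0 ?lee_fin ?powR_ge0.
- by apply: measurable_funTS; exact: measurable_funeM.
rewrite !ge0_integralZl ?lee_fin ?powR_ge0//; try exact: measurable_funTS.
rewrite [leRHS]EFinD ![in leRHS]EFinM; apply: leeD; rewrite lee_wpmul2l ?lee_fin ?powR_ge0//.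
  by have := integral_admissible D delta _ w j x d0 d1 aw.
by apply: le_trans GC; apply: ge0_subset_integral.
Qed.

Lemma dominated_locint h f : dom C%:E h -> measurable_fun setT f ->
  (forall y, (`|f y|%:E <= h y)%E) -> locint f.
Proof.
move=> dh mf fh; split=> // j i.
have [->|/set0P[x xi]] := eqVneq (cube j i) set0.
  apply/integrableP; split; first exact: measurable_fun_set0.
  by rewrite integral_set0.
have <- : cubex j x = cube j i by rewrite /cubex xi.
apply: (integrable_le _ f (fun y => `|f y|%:E)) => //; first exact: mcubex.
  by apply/measurable_EFinP; exact: measurableT_comp.
rewrite integral_cubex; have := dominated_cubex_le h f 1 j x ltr01 dh mf fh.
move=> /le_lt_trans H; rewrite lte_mul_pinfty// ?lee_fin ?(ltW (vol_gt0 _ _))//.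
by apply: H; exact: ltry.
Qed.

(** For [delta = 0] the weight part of the bound does not decay as the cube grows. It is first made
    small through [kappa], uniformly in [M]; then the [G] part decays like the reciprocal of the
    volume. *)
Lemma dominated_mean_cvg0 h f x : 0 < p -> 0 < C -> dom C%:E h -> measurable_fun setT f ->
  (forall y, (`|f y|%:E <= h y)%E) -> (fun M : nat => mean (- M%:Z) f x) @ \oo --> 0.
Proof.
move=> p0 C0 dh mf fh; apply/cvgrPdist_le => e e0.
pose kappa := (e / (2 * C)) `^ p^-1.
have eC : 0 < e / (2 * C) by rewrite divr_gt0// mulr_gt0.
have k0 : 0 < kappa by rewrite powR_gt0.
have kp : kappa `^ p = e / (2 * C) by rewrite powRK_inv ?gt_eqF// ltW.
have rat1 := ratio_gt1 D.
have volM M : vol (- M%:Z) = ratio D ^+ M by rewrite /vol opprK.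
have volM1 M : 1 <= vol (- M%:Z) by rewrite volM exprn_ege1// ltW.
have volcvg : (fun M : nat => (vol (- M%:Z))^-1 * (kappa `^ (- P) * C)) @ \oo --> 0.
  rewrite -(mul0r (kappa `^ (- P) * C)); apply: cvgM; last exact: cvg_cst.
  under eq_fun do rewrite volM -exprVn.
  apply: cvg_expr; rewrite ger0_norm ?invr_ge0 ?(ltW (lt_trans ltr01 rat1))//.
  by rewrite invf_lt1// (lt_trans ltr01 rat1).
have /cvgrPdist_le/(_ (e / 2)) := volcvg; rewrite divr_gt0// => /(_ isT).
apply: filterS => M; rewrite !sub0r !normrN => HM.
have lf := dominated_locint h f dh mf fh.
rewrite -lee_fin; apply: (le_trans (normr_mean_le D (- M%:Z) f x mf)).
apply: (le_trans (dominated_cubex_le h f kappa (- M%:Z) x k0 dh mf fh)).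
have v0 := vol_gt0 D (- M%:Z).
rewrite lee_fin mulrDr (splitr e); apply: lerD; last first.
  by apply: le_trans HM; exact: ler_norm.
rewrite kp; set v := vol _ in v0 *.
have vd : v^-1 * v `^ (1 - delta) <= 1.
  rewrite mulrC ler_pdivrMr// mul1r -[leRHS]powRr1 ?(ltW v0)//.
  by apply: ler_powR; [exact: volM1|rewrite gerBl].
have -> : v^-1 * (e / (2 * C) * (C * v `^ (1 - delta))) = e / 2 * (v^-1 * v `^ (1 - delta)).
  by field; rewrite !gt_eqF.
by rewrite ler_piMr// divr_ge0// ltW.
Qed.

Lemma dominated_blocks h g : 1 < p -> 1 < P -> p^-1 + P^-1 = 1 ->
  dom C%:E h -> measurable_fun setT g -> (forall y, (`|g y|%:E <= h y)%E) ->
  exists (lam : nat -> R) (A : nat -> T -> R),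
  [/\ forall k, 0 <= lam k,
    forall k, measurable_fun setT (A k) /\ exists j i,
      (forall x, ~ cube j i x -> A k x = 0) /\
      (\int[mu]_x ((`|A k x|) `^ P)%:E <= (vol j `^ (- (delta / p) * P))%:E)%E,
    (\sum_(k <oo) (lam k)%:E <= (4 * C)%:E)%E &
    {ae mu, forall x, (fun N => \sum_(k < N) lam k * A k x) @ \oo --> g x}].
Proof.
move=> p1 P1 pP [w [G [aw mG G0 GC H]]] mg gh.
have p0 : 0 < p by lra.
have P0 : 0 < P by lra.
have w0 y : (0 <= w y)%E by exact: admissible_ge0 aw.
have mw := measurable_admissible D _ _ _ aw.
have wG : {ae mu, forall x, w x \is a fin_num /\ G x \is a fin_num}.
  have H1 : {ae mu, forall x, w x \is a fin_num}.
    apply: ae_fin_num => // i.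
    have [->|/set0P[x xi]] := eqVneq (cube 0 i) set0; first by rewrite integral_set0.
    have <- : cubex 0 x = cube 0 i by rewrite /cubex xi.
    by apply: le_lt_trans (integral_admissible D delta _ w 0 x d0 d1 aw) _; rewrite -EFinM ltry.
  have H2 : {ae mu, forall x, G x \is a fin_num}.
    apply: ae_fin_num => // i; apply: (@le_lt_trans _ _ C%:E); last exact: ltry.
    by apply: le_trans GC; apply: ge0_subset_integral => //; exact: mcube.
  by apply: filterS2 H1 H2.
case: (aw) => m [l [c [m0 mC wE]]].
pose phi k x : R := m k * vol (l k) `^ (- delta) * \1_(cube (l k) (c k)) x.
have phi0 k x : 0 <= phi k x by rewrite /phi !mulr_ge0 ?powR_ge0.
have mphi k : measurable_fun setT (phi k).
  by apply: measurable_funM => //; apply: measurable_indic; exact: mcube.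
pose wr x := fine (w x).
have wr0 x : 0 <= wr x by exact: fine_ge0.
have mwr : measurable_fun setT wr by exact: measurableT_comp.
pose th k x := phi k x / wr x.
have th0 k x : 0 <= th k x by exact: divr_ge0.
have mth k : measurable_fun setT (th k).
  rewrite /th; under eq_fun do rewrite -(powR_inv1 (wr0 _)).
  by apply: measurable_funM => //; exact: measurableT_comp (measurable_powR _) mwr.
(* The sum is 1 where [w] is positive and finite; where [w] is 0 or infinite, [wr x = 0] and
   division by zero makes every [th k x] vanish. *)
have sumth x : (\sum_(k <oo) (th k x)%:E <= 1)%E.
  rewrite /th; under eq_eseriesr do rewrite mulrC EFinM.
  rewrite nneseriesZl; last by move=> k _; rewrite lee_fin.
  rewrite -wE /wr; have := w0 x; case: (w x) => [z|//|//]/=; last first.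
    by rewrite invr0 mul0e.
  rewrite -EFinM lee_fin => _; have [->|z0] := eqVneq z 0; first by rewrite mulr0.
  by rewrite mulVf.
pose nuE k := (\int[mu]_x ((th k x)%:E * G x))%E.
have mthG k : measurable_fun setT (fun x => (th k x)%:E * G x)%E.
  by apply: emeasurable_funM => //; exact/measurable_EFinP.
have thG0 k x : (0 <= (th k x)%:E * G x)%E by rewrite mule_ge0 ?lee_fin.
have sumnu : (\sum_(k <oo) nuE k <= C%:E)%E.
  rewrite /nuE -integral_nneseries//; apply: le_trans GC.
  apply: ge0_le_integral => //.
  - by move=> x _; apply: nneseries_ge0 => k _ _.
  - by apply: ge0_emeasurable_sum.
  - move=> x _; have := G0 x; case EG : (G x) => [z|//|//] z0; last exact: leey.
    under eq_eseriesr do rewrite muleC.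
    rewrite nneseriesZl; last by move=> k _; rewrite lee_fin.
    by rewrite -[leRHS]mule1 lee_wpmul2l.
have nuE0 k : (0 <= nuE k)%E by apply: integral_ge0.
have nuEC k : (nuE k <= C%:E)%E.
  apply: le_trans sumnu; apply: (@le_trans _ _ (\sum_(0 <= i < k.+1) nuE i)%E).
    by rewrite big_nat_recr//= leeDr// sume_ge0.
  exact: nneseries_lim_ge.
pose nu k := fine (nuE k).
have nuEE k : nuE k = (nu k)%:E.
  rewrite /nu fineK// fin_numElt (lt_le_trans _ (nuE0 k)) ?ltNyr//.
  by apply: le_lt_trans (nuEC k) _; exact: ltry.
have nu0 k : 0 <= nu k by exact: fine_ge0.
(* The [m k] and the [nu k] each sum to at most [C], hence the total [4 C]. *)
pose lam k := 2 * (m k + nu k).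
have lam0 k : 0 <= lam k by rewrite /lam mulr_ge0// addr_ge0.
pose A k x := th k x * g x / lam k.
exists lam, A; split => //.
- move=> k; split.
    by apply: measurable_funM => //; exact: measurable_funM.
  exists (l k), (c k); split.
    move=> x nx; rewrite /A /th /phi indicE memNset// mulr0 !mul0r//.
  have [lk0|lk] := eqVneq (lam k) 0.
    rewrite (eq_integral (cst 0%E)) ?integral0 ?lee_fin ?powR_ge0// => x _.
    by rewrite /A lk0 invr0 mulr0 normr0 powR0// gt_eqF.
  have lkp : 0 < lam k by rewrite lt_neqAle eq_sym lk lam0.
  pose ak := m k * vol (l k) `^ (- delta).
  have ak0 : 0 <= ak by rewrite /ak mulr_ge0 ?powR_ge0.
  pose Kk := (lam k)^-1 `^ P * (2 `^ P * ak `^ (P - 1)).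
  have Kk0 : 0 <= Kk by rewrite /Kk !mulr_ge0 ?powR_ge0.
  apply: (@le_trans _ _ (\int[mu]_x (Kk%:E * ((th k x)%:E * G x)))%E).
    apply: ae_ge0_le_integral => //.
    + apply/measurable_EFinP; apply: (measurableT_comp (measurable_powR P)).
      by apply: measurableT_comp => //; apply: measurable_funM => //; exact: measurable_funM.
    + by move=> x _; rewrite mule_ge0 ?lee_fin.
    + exact: measurable_funeM.
    apply: filterS wG => x [wf Gf] _.
    rewrite -(fineK Gf) -!EFinM lee_fin.
    have Gr0 : 0 <= fine (G x) by exact: fine_ge0.
    have gx : `|g x| <= 2 * (wr x `^ p^-1 * fine (G x) `^ P^-1).
      apply: le_powR_young => // kappa k0; rewrite -lee_fin.
      apply: (le_trans (gh x)); apply: (le_trans (H kappa x k0)).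
      by rewrite EFinD !EFinM /wr !fineK.
    have -> : `|A k x| = (lam k)^-1 * (th k x * `|g x|).
      have li : 0 <= (lam k)^-1 by rewrite invr_ge0.
      by rewrite /A mulrC normrM (ger0_norm li) normrM (ger0_norm (th0 k x)).
    apply: (rescaled_powR_le p P _ _ _ (wr x)) => //.
    + by rewrite invr_ge0.
    + by move=> w00; rewrite /th w00 invr0 mulr0.
    have [->|wn0] := eqVneq (wr x) 0; first by rewrite mulr0.
    rewrite /th divfK// /phi ler_piMr//.
  rewrite ge0_integralZl// ?lee_fin// -/(nuE k) nuEE -EFinM lee_fin.
  apply: block_normalization => //.
  by move: lkp; rewrite /lam pmulr_rgt0.
- rewrite /lam; under eq_eseriesr do rewrite EFinM.
  rewrite nneseriesZl; last by move=> k _; rewrite lee_fin addr_ge0.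
  under eq_eseriesr do rewrite EFinD.
  rewrite nneseriesD; last 2 first.
  - by move=> k _ _; rewrite lee_fin.
  - by move=> k _ _; rewrite lee_fin.
  have -> : 4 * C = 2 * (C + C) by ring.
  rewrite EFinM lee_wpmul2l ?lee_fin// EFinD leeD//.
  by apply: le_trans sumnu; under eq_eseriesr do rewrite -nuEE.
- apply: filterS wG => x [wf Gf].
  (* When [lam k = 0], [A k] is 0 by division by zero; nothing is lost, since then [m k = 0] and
     [th k] vanishes too. *)
  have lamA k : lam k * A k x = th k x * g x.
    rewrite /A; have [lk0|lk] := eqVneq (lam k) 0; last by field.
    rewrite lk0 mul0r; suff -> : th k x = 0 by rewrite mul0r.
    have mk : m k = 0.
      by have := lk0; rewrite /lam; have := m0 k; have := nu0 k; lra.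
    by rewrite /th /phi mk !mul0r.
  under eq_fun do under eq_bigr do rewrite lamA.
  have Gr0 : 0 <= fine (G x) by exact: fine_ge0.
  have gx : `|g x| <= 2 * (wr x `^ p^-1 * fine (G x) `^ P^-1).
    apply: le_powR_young => // kappa k0; rewrite -lee_fin.
    apply: (le_trans (gh x)); apply: (le_trans (H kappa x k0)).
    by rewrite EFinD !EFinM /wr !fineK.
  have [w00|wn0] := eqVneq (wr x) 0.
    have -> : g x = 0.
      apply/eqP; rewrite -normr_le0; apply: (le_trans gx).
      by rewrite w00 powR0 ?mul0r ?mulr0// gt_eqF// invr_gt0.
    under eq_fun do under eq_bigr do rewrite mulr0.
    under eq_fun do rewrite big1//.
    exact: cvg_cst.
  pose u := (wr x)^-1 * g x.
  have gE : g x = wr x * u by rewrite /u; field.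
  under eq_fun do under eq_bigr do rewrite /th -mulrA.
  under eq_fun do rewrite -mulr_suml.
  have : (\sum_(0 <= k < N) (phi k x)%:E)%E @[N --> \oo] --> (wr x)%:E.
    rewrite /wr fineK// wE; apply: is_cvg_nneseries => k _ _.
    by rewrite lee_fin.
  move/fine_cvg; rewrite /comp/=.
  under eq_fun do rewrite sumEFin big_mkord.
  move=> cw; suff H' : (\sum_(i < N) phi i x) * u @[N --> \oo] --> wr x * u.
    by rewrite -gE in H'; exact: H'.
  by apply: cvgM cw _; exact: cvg_cst.
Qed.

End DominatedFunctions.

(** * Martingale transforms and commutators *)

(* Outside the set of convergence [limn] is the junk constant [point]. *)
Lemma measurable_limn {R : realType} {d} {T : measurableType d} (u : nat -> T -> R) :
  (forall k, measurable_fun setT (u k)) -> measurable_fun setT (fun x => limn (u^~ x)).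
Proof.
move=> mu_.
pose e k x := (u k x)%:E.
have me k : measurable_fun setT (e k) by apply/measurable_EFinP.
pose S x := limn_esup (e^~ x); pose I x := limn_einf (e^~ x).
have mS : measurable_fun setT S by exact: measurable_fun_limn_esup.
have mI : measurable_fun setT I.
  rewrite /I; under eq_fun do rewrite -[limn_einf _]oppeK -limn_esupN.
  apply: measurableT_comp => //; apply: measurable_fun_limn_esup => k.
  by apply: measurableT_comp => //; exact: me.
have -> : (fun x => limn (u^~ x)) = (fun x => if I x == S x then
    (if S x == (fine (S x))%:E then fine (S x) else point) else point).
  apply/funext => x; have [cu|ncu] := pselect (cvgn (u^~ x)).
    have eu : e^~ x @ \oo --> (limn (u^~ x))%:E by apply: cvg_EFin; [exact: nearW|exact: cu].
    by rewrite /I /S; have [-> ->] := cvg_limn_einf_sup eu; rewrite /= !eqxx.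
  rewrite (dvgP ncu); case: eqP => // IS; case: eqP => // Sf.
  exfalso; apply: ncu.
  have : e^~ x @ \oo --> (fine (S x))%:E.
    rewrite -Sf; apply: (@squeeze_cvge _ _ _ _ (einfs (e^~ x)) _ (esups (e^~ x))).
    - apply: nearW => k; apply/andP; split.
        by apply: ereal_inf_lbound; exists k => /=.
      by apply: ereal_sup_ubound; exists k => /=.
    - rewrite -IS /I limn_einf_lim; exact: is_cvg_einfs.
    - rewrite /S limn_esup_lim; exact: is_cvg_esups.
  by move/fine_cvg => /= H; apply/cvg_ex; exists (fine (S x)).
apply: measurable_fun_ifT => //; first exact: measurable_fun_eqe.
apply: measurable_fun_ifT => //.
  by apply: measurable_fun_eqe => //; apply/measurable_EFinP; exact: measurableT_comp.
exact: measurableT_comp.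
Qed.

Lemma sym_sum_cvg {R : realType} (u : int -> R) (B : R) :
  (forall M : nat, \sum_(k < M.*2.+1) `|u (k%:Z - M%:Z)| <= B) ->
  let s := fun M : nat => \sum_(k < M.*2.+1) u (k%:Z - M%:Z) in
  cvgn s /\ `|limn s| <= B.
Proof.
move=> uB s.
(* Pairing [i] with [-i] turns the symmetric partial sums into those of an ordinary series. *)
pose v (i : nat) : R := if i is i'.+1 then u i%:Z + u (- i%:Z) else u 0.
have sumE (w : int -> R) M : \sum_(k < M.*2.+1) w (k%:Z - M%:Z) =
    \sum_(0 <= i < M.+1) (if i is i'.+1 then w i%:Z + w (- i%:Z) else w 0).
  elim: M => [|M IH]; first by rewrite big_ord_recl big_ord0 addr0 big_nat1.
  rewrite big_nat_recr//= -IH doubleS big_ord_recr big_ord_recl/=.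
  transitivity (w (- M.+1%:Z) + \sum_(k < M.*2.+1) w (k%:Z - M%:Z) + w M.+1%:Z); last by ring.
  congr (_ + _ + _).
  - by congr w; lia.
  - by apply: eq_bigr => k _; congr w; rewrite /bump/=; lia.
  - by congr w; lia.
have sE : s = (fun M => series v M.+1) by apply/funext => M; rewrite /s sumE.
have nd : nondecreasing_seq (fun M => \sum_(0 <= k < M) `|v k|).
  exact: nondecreasing_series.
have bd : has_ubound (range (fun M => \sum_(0 <= k < M) `|v k|)).
  exists B => _ [M _ <-]; have := uB M; rewrite (sumE (fun i => `|u i|)).
  apply: le_trans; apply: (@le_trans _ _ (\sum_(0 <= k < M.+1) `|v k|)).
    by rewrite big_nat_recr//= lerDl.
  apply: ler_sum => -[|i] _ //=; exact: ler_normD.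
have cv : cvgn (series v) by apply: normed_cvg; exact: (nondecreasing_is_cvgn nd bd).
have cs : cvgn s.
  by rewrite sE; apply/cvg_ex; exists (limn (series v)); rewrite (cvg_shiftS (series v)).
split=> //; rewrite -lim_norm//; apply: limr_le; first exact: is_cvg_norm.
by apply: nearW => M; apply: le_trans (uB M); exact: ler_norm_sum.
Qed.

Section MartingaleTransform.
Context {R : realType} {d : measure_display} {T : measurableType d}
  {mu : {measure set T -> \bar R}} (D : dyadicSystem mu) (a : T -> R).
Implicit Types (j l : int) (F : T -> R) (f g : T -> R).
Local Notation vol := (vol D).
Local Notation cubex := (cubex D).
Local Notation avg := (avg D).
Local Notation level := (level D).
Local Notation mean := (mean D).
Local Notation locint := (locint D).
Local Notation osc := (osc D a).

Definition meandiff j F x := mean (j + 1) F x - mean j F x.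

(** The shape that [haar_psum] takes once the Haar functions of each cube are summed ([haar_psumE]):
    a martingale transform with multipliers [w j]. *)
Definition diffsum (w : int -> R) F (M : nat) x : R :=
  \sum_(k < M.*2.+1) w (k%:Z - M%:Z) * meandiff (k%:Z - M%:Z) F x.

Lemma level_meandiff j F : level (j + 1) (meandiff j F).
Proof.
move=> x y xy; rewrite /meandiff (level_mean D _ F x y xy).
by rewrite (level_le D j (j + 1) _ _ (level_mean D j F) x y xy) // lerDl.
Qed.

Lemma measurable_diffsum w F M : measurable_fun setT (diffsum w F M).
Proof.
apply: measurable_sum => k; apply: measurable_funM => //.
exact: (measurable_level D _ _ _ _ _ measurableT (level_meandiff _ F)).
Qed.

Lemma meandiff_le j F x : measurable_fun setT F ->
  ((`|meandiff j F x|)%:E <= (ratio D + 1)%:E * avg j (fun y => (`|F y|)%:E) x)%E.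
Proof.
move=> mF; have mF' : measurable_fun setT (fun y => (`|F y|)%:E).
  by apply/measurable_EFinP; exact: measurableT_comp.
apply: (@le_trans _ _ ((`|mean (j + 1) F x|)%:E + (`|mean j F x|)%:E)%E).
  by rewrite -EFinD lee_fin ler_normB.
have av0 : (0 <= avg j (fun y => (`|F y|)%:E) x)%E by exact: avg_ge0.
rewrite EFinD ge0_muleDl ?lee_fin ?(ltW (ratio_gt0 D))// mul1e leeD ?normr_mean_le//.
apply: (le_trans (normr_mean_le D (j + 1) F x mF)).
exact: avg_child.
Qed.

Lemma meandiff_lin j (c : R) f g x : locint f -> locint g ->
  meandiff j (fun y => c * f y - g y) x = c * meandiff j f x - meandiff j g x.
Proof.
move=> lf lg; rewrite /meandiff.
have E l : mean l (fun y => c * f y - g y) x = c * mean l f x - mean l g x.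
  by rewrite -(meanZ D l c f x lf) -(meanB D l _ g x (locintZ D c f lf) lg).
by rewrite !E; ring.
Qed.

Context (la : locint a).

Lemma avg_norm_le_osc j f x : measurable_fun setT f ->
  (avg j (fun y => (`|f y|)%:E) x <= avg j (fun y => (osc j y * `|f y|)%:E) x)%E.
Proof.
move=> mf; apply: le_avg => //.
- by apply/measurable_EFinP; exact: measurableT_comp.
- by apply: measurable_oscM => //; exact: measurableT_comp.
- by move=> y; rewrite lee_fin ler_peMl// osc_ge1.
Qed.

(** For [y] in the cube of [x] the two means of [a] agree, say to [m], and [|a x - a y| <= |a x - m|
    + |a y - m| <= osc j x * osc j y]. *)
Lemma avg_comm_le_osc j f x : measurable_fun setT f ->
  (avg j (fun y => (`|a x * f y - a y * f y|)%:E) x <=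
   (osc j x)%:E * avg j (fun y => (osc j y * `|f y|)%:E) x)%E.
Proof.
move=> mf; rewrite -avgZ ?osc_ge0//; last 2 first.
- by apply: measurable_oscM => //; exact: measurableT_comp.
- by move=> y; rewrite lee_fin mulr_ge0 ?osc_ge0.
(* That bound may fail outside the cube, whereas [le_avg] compares functions everywhere; the minimum
   has the same average and obeys the bound at every point. *)
rewrite [leLHS](avg_eq D _ _
  (fun y => (Num.min `|a x * f y - a y * f y| (osc j x * (osc j y * `|f y|)))%:E)).
  apply: le_avg.
  - apply/measurable_EFinP; apply: measurable_minr.
      apply: measurableT_comp => //; apply: measurable_funB; apply: measurable_funM => //.
      exact: la.1.
    apply: measurable_funM => //; apply: measurable_funM; first exact: measurable_osc.
    exact: measurableT_comp.
  - by apply: measurable_funeM; apply: measurable_oscM => //; exact: measurableT_comp.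
  - by move=> y; rewrite lee_fin le_min normr_ge0 mulr_ge0 ?osc_ge0// mulr_ge0 ?osc_ge0.
  - by move=> y; rewrite -EFinM lee_fin ge_min lexx orbT.
move=> y yx; congr (_%:E); apply/esym/min_idPl.
rewrite -mulrBl normrM mulrA ler_wpM2r// /osc.
have := level_mean D j a y x yx => <-.
set m := mean j a y.
have : `|a x - a y| <= `|a x - m| + `|a y - m|.
  by rewrite (_ : a x - a y = (a x - m) - (a y - m)) ?ler_normB//; ring.
move=> /le_trans; apply.
have := mulr_ge0 (normr_ge0 (a x - m)) (normr_ge0 (a y - m)).
have := normr_ge0 (a x - m); have := normr_ge0 (a y - m); lra.
Qed.

Variables (theta delta p P C : R).
Local Notation dom := (dominated D delta p P).
Hypotheses (d0 : 0 <= delta) (d1 : delta <= 1).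

Lemma oscsum_term j f M x : (absz j <= M)%N ->
  (oscterm D a theta j (fun y => `|f y|%R) x <= oscsum D a theta M (fun y => `|f y|%R) x)%E.
Proof.
move=> jM; rewrite /oscsum.
have [k kE] : exists k : 'I_M.*2.+1, k%:Z - M%:Z = j.
  have kM : (absz (j + M%:Z)%R < M.*2.+1)%N by lia.
  by exists (Ordinal kM) => /=; lia.
rewrite (bigD1 k)//= kE leeDl// sume_ge0// => i _.
exact: oscterm_ge0.
Qed.

Context (f : T -> R) (H : T -> \bar R) (mf : measurable_fun setT f)
  (dH : dom C%:E H)
  (fH : forall M x, (oscsum D a theta M (fun y => `|f y|%R) x <= H x)%E).

(** The bound [w + G] for [H] is finite almost everywhere, hence so is the term of scale [j]; its
    average is constant on cubes, and [ae_level] makes it finite everywhere. Local integrability of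
    [f] and of [a f] rests on this. *)
Lemma oscM_avg_fin j x : (avg j (fun y => (osc j y * `|f y|)%:E) x < +oo)%E.
Proof.
have [w [G [aw mG G0 GC wG]]] := dH.
have w0 y : (0 <= w y)%E by exact: admissible_ge0 aw.
have H1 : {ae mu, forall x, (w x + G x)%E \is a fin_num}.
  apply: (ae_fin_num D) => [|y|i].
  - by apply: emeasurable_funD => //; exact: measurable_admissible aw.
  - by rewrite adde_ge0.
  have [->|/set0P[y yi]] := eqVneq (cube D 0 i) set0; first by rewrite integral_set0.
  have <- : cubex 0 y = cube D 0 i by rewrite /cubex yi.
  have mQ : measurable (cubex 0 y) by exact: mcubex.
  rewrite ge0_integralD//; last 2 first.
  - by apply: measurable_funTS; exact: measurable_admissible aw.
  - exact: measurable_funTS.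
  apply: lte_add_pinfty.
    by apply: le_lt_trans (integral_admissible D delta _ w 0 y d0 d1 aw) _; rewrite -EFinM ltry.
  apply: (@le_lt_trans _ _ C%:E); last exact: ltry.
  by apply: le_trans GC; exact: ge0_subset_integral.
suff : {ae mu, forall x, (avg j (fun y => (osc j y * `|f y|)%:E) x < +oo)%E}.
  move/(ae_level D j); apply=> y z yz.
  by rewrite (level_avg D j (fun y => (osc j y * `|f y|)%:E) y z yz).
apply: filterS H1 => y yfin.
have c0 : 0 < vol j `^ theta * osc j y.
  by rewrite mulr_gt0 ?powR_gt0 ?vol_gt0// (lt_le_trans ltr01)// osc_ge1.
have : (oscterm D a theta j (fun y => `|f y|%R) y < +oo)%E.
  apply: (le_lt_trans (oscsum_term j f (absz j) y _)) => //.
  apply: (le_lt_trans (fH _ _)).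
  have := wG 1 y ltr01; rewrite !powR1 !mul1e => /le_lt_trans; apply.
  by rewrite ltey_eq yfin.
rewrite /oscterm.
have : (0 <= avg j (fun y => (osc j y * `|f y|)%:E) y)%E.
  by apply: avg_ge0 => z; rewrite lee_fin mulr_ge0 ?osc_ge0.
move: (avg j _ y) => [r _ _|_|//]; first exact: ltry.
by rewrite gt0_muley ?ltxx// lte_fin.
Qed.

Lemma locint_of_avg F : measurable_fun setT F ->
  (forall j x, (avg j (fun y => (`|F y|)%:E) x < +oo)%E) -> locint F.
Proof.
move=> mF Foo; split=> // j i.
have [->|/set0P[x xi]] := eqVneq (cube D j i) set0.
  apply/integrableP; split; first exact: measurable_fun_set0.
  by rewrite integral_set0.
have <- : cubex j x = cube D j i by rewrite /cubex xi.
apply: (integrable_le _ F (fun y => `|F y|%:E)) => //; first exact: mcubex.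
  by apply/measurable_EFinP; exact: measurableT_comp.
by rewrite integral_cubex lte_mul_pinfty// ?lee_fin ?(ltW (vol_gt0 _ _)).
Qed.

Lemma oscsum_locint : locint f.
Proof.
apply: locint_of_avg => // j x.
exact: le_lt_trans (avg_norm_le_osc j f x mf) (oscM_avg_fin j x).
Qed.

(** On the cube of [x] write [a f = a(x) f - (a(x) f - a f)] and bound the second part by
    [avg_comm_le_osc]. *)
Lemma oscsum_locintM : locint (fun y => a y * f y).
Proof.
have maf : measurable_fun setT (fun y => a y * f y).
  by apply: measurable_funM => //; exact: la.1.
apply: locint_of_avg => // j x.
have H1 := avg_comm_le_osc j f x mf.
have fo := oscM_avg_fin j x.
have fi : (avg j (fun y => (`|f y|)%:E) x < +oo)%E.
  exact: le_lt_trans (avg_norm_le_osc j f x mf) fo.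
apply: (@le_lt_trans _ _ (avg j (fun y => (`|a x|)%:E * (`|f y|)%:E +
    (`|a x * f y - a y * f y|)%:E)%E x)).
  apply: le_avg => //.
  - by apply/measurable_EFinP; exact: measurableT_comp.
  - apply: emeasurable_funD.
      by apply: measurable_funeM; apply/measurable_EFinP; exact: measurableT_comp.
    apply/measurable_EFinP; apply: measurableT_comp => //; apply: measurable_funB => //.
    exact: measurable_funM.
  - move=> y; rewrite -EFinM -EFinD lee_fin -normrM.
    rewrite {1}(_ : a y * f y = a x * f y - (a x * f y - a y * f y)); last by ring.
    exact: ler_normB.
rewrite avgD//; last 2 first.
- by apply: measurable_funeM; apply/measurable_EFinP; exact: measurableT_comp.
- apply/measurable_EFinP; apply: measurableT_comp => //; apply: measurable_funB => //.
  exact: measurable_funM.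
rewrite avgZ//; last by apply/measurable_EFinP; exact: measurableT_comp.
apply: lte_add_pinfty; first by rewrite lte_mul_pinfty// lee_fin.
apply: (le_lt_trans H1); rewrite lte_mul_pinfty// lee_fin osc_ge0//.
Qed.

Lemma dominated_sym_sum (u : int -> R) (c : R) x : 0 <= c -> (H x < +oo)%E ->
  (forall j, ((`|u j|)%:E <= c%:E * oscterm D a theta j (fun y => `|f y|%R) x)%E) ->
  let s := fun M : nat => \sum_(k < M.*2.+1) u (k%:Z - M%:Z) in
  cvgn s /\ ((`|limn s|)%:E <= c%:E * H x)%E.
Proof.
move=> c0 Hx uc s.
have H0 : (0 <= H x)%E.
  by apply: le_trans (fH 0%N x); apply: sume_ge0 => k _; exact: oscterm_ge0.
have Hf : H x \is a fin_num by rewrite ge0_fin_numE.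
have uB (M : nat) : \sum_(k < M.*2.+1) `|u (k%:Z - M%:Z)| <= c * fine (H x).
  rewrite -lee_fin -sumEFin EFinM fineK//.
  apply: (@le_trans _ _ (c%:E * oscsum D a theta M (fun y => `|f y|%R) x)%E); last first.
    by rewrite lee_wpmul2l ?lee_fin.
  rewrite /oscsum ge0_sume_distrr; last by move=> i _; exact: oscterm_ge0.
  by apply: lee_sum => k _; exact: uc.
have [cs sB] := sym_sum_cvg u _ uB; split; first exact: cs.
by rewrite -(fineK Hf) -EFinM lee_fin.
Qed.

Let tr F x := limn (diffsum (fun j => vol j `^ theta) F ^~ x).

Lemma transform_term j x : ((`|vol j `^ theta * meandiff j f x|)%:E <=
  (ratio D + 1)%:E * oscterm D a theta j (fun y => `|f y|%R) x)%E.
Proof.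
rewrite normrM (ger0_norm (powR_ge0 _ _)) EFinM.
apply: (@le_trans _ _ ((vol j `^ theta)%:E * ((ratio D + 1)%:E *
   avg j (fun y => (osc j y * `|f y|)%:E) x))%E).
  rewrite lee_wpmul2l ?lee_fin ?powR_ge0//; apply: (le_trans (meandiff_le j f x mf)).
  rewrite lee_wpmul2l ?lee_fin ?addr_ge0 ?(ltW (ratio_gt0 D))//.
  exact: avg_norm_le_osc.
rewrite muleCA lee_wpmul2l ?lee_fin ?addr_ge0 ?(ltW (ratio_gt0 D))//.
rewrite /oscterm lee_wpmul2r//; last by rewrite lee_fin ler_peMr ?powR_ge0// osc_ge1.
by apply: avg_ge0 => y; rewrite lee_fin mulr_ge0 ?osc_ge0.
Qed.

(** For fixed [x] the number [a x] passes through the means, so the bracket is [meandiff] of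
    [y -> a x * f y - a y * f y], to which [avg_comm_le_osc] applies. *)
Lemma commutator_term j x : ((`|vol j `^ theta *
    (a x * meandiff j f x - meandiff j (fun y => a y * f y) x)|)%:E <=
  (ratio D + 1)%:E * oscterm D a theta j (fun y => `|f y|%R) x)%E.
Proof.
rewrite -(meandiff_lin j (a x) f _ x oscsum_locint oscsum_locintM).
rewrite normrM (ger0_norm (powR_ge0 _ _)) EFinM.
have mF : measurable_fun setT (fun y => a x * f y - a y * f y).
  by apply: measurable_funB; apply: measurable_funM => //; exact: la.1.
apply: (@le_trans _ _ ((vol j `^ theta)%:E * ((ratio D + 1)%:E *
   ((osc j x)%:E * avg j (fun y => (osc j y * `|f y|)%:E) x)))%E).
  rewrite lee_wpmul2l ?lee_fin ?powR_ge0//; apply: (le_trans (meandiff_le j _ x mF)).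
  rewrite lee_wpmul2l ?lee_fin ?addr_ge0 ?(ltW (ratio_gt0 D))//.
  exact: avg_comm_le_osc.
by rewrite muleCA /oscterm EFinM -muleA.
Qed.

Let rho1 : 0 <= ratio D + 1. Proof. by rewrite addr_ge0 ?(ltW (ratio_gt0 D)). Qed.
Let rho1' : 0 < ratio D + 1. Proof. by rewrite addr_gt0 ?ratio_gt0. Qed.

Lemma transform_le x : ((`|tr f x|)%:E <= (ratio D + 1)%:E * H x)%E.
Proof.
have [Hx|Hx] := ltP (H x) +oo%E.
  exact: (dominated_sym_sum _ _ x rho1 Hx (transform_term^~ x)).2.
by move: Hx; rewrite leye_eq => /eqP ->; rewrite gt0_muley ?leey// lte_fin.
Qed.

(** The series for [a f] converges as [a x] times the one for [f] minus that of the commutator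
    terms. Where [H] is infinite the bound is trivial. *)
Lemma commutator_le x : ((`|a x * tr f x - tr (fun y => a y * f y) x|)%:E <=
  (ratio D + 1)%:E * H x)%E.
Proof.
have [Hx|Hx] := ltP (H x) +oo%E; last first.
  by move: Hx; rewrite leye_eq => /eqP ->; rewrite gt0_muley ?leey// lte_fin.
have [cf _] := dominated_sym_sum _ _ x rho1 Hx (transform_term^~ x).
have [cc] := dominated_sym_sum _ _ x rho1 Hx (commutator_term^~ x).
set s := fun M : nat => _ in cf; set c := fun M : nat => _ in cc * => cB.
suff -> : tr (fun y => a y * f y) x = a x * tr f x - limn c.
  by rewrite opprB addrCA subrr addr0.
rewrite /tr (_ : diffsum _ _ ^~ x = (fun M => a x * s M - c M)); last first.
  apply/funext => M; rewrite /s /c /diffsum mulr_sumr -sumrB.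
  by apply: eq_bigr => k _; ring.
apply: cvg_lim => //; apply: cvgB; last exact: cc.
by apply: cvgM; [exact: cvg_cst|exact: cf].
Qed.

End MartingaleTransform.

Section Telescoping.
Context {R : realType} {d : measure_display} {T : measurableType d}
  {mu : {measure set T -> \bar R}} (D : dyadicSystem mu).

Lemma diffsum1 (g : T -> R) M x :
  diffsum D (fun=> 1) g M x = mean D M.+1%:Z g x - mean D (- M%:Z) g x.
Proof.
rewrite /diffsum; under eq_bigr do rewrite mul1r /meandiff.
pose v (k : nat) := mean D (k%:Z - M%:Z) g x.
rewrite (eq_bigr (fun k : 'I__ => v k.+1 - v k)); last first.
  by move=> k _; rewrite /v; congr (mean D _ g x - _); lia.
rewrite -(big_mkord xpredT (fun k => v k.+1 - v k)) telescope_sumr//.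
by rewrite /v; congr (mean D _ g x - mean D _ g x); lia.
Qed.

(** The coarse end of the telescoped sum vanishes in the limit by [dominated_mean_cvg0]. *)
Lemma diffsum1_cvg (delta p P C : R) (h : T -> \bar R) (g : T -> R) :
  0 <= delta -> delta <= 1 -> 0 < p -> 0 < C ->
  dominated D delta p P C%:E h -> measurable_fun setT g ->
  (forall y, ((`|g y|)%:E <= h y)%E) ->
  {ae mu, forall x, limn (diffsum D (fun=> 1) g ^~ x) = g x}.
Proof.
move=> d0 d1 p0 C0 dh mg gh.
have lg := dominated_locint D delta p P C d0 d1 h g dh mg gh.
have := mean_cvg_ae D g lg; apply: filterS => x gx.
apply: cvg_lim => //.
under eq_fun do rewrite diffsum1.
rewrite -[g x]subr0; apply: cvgB.
  by rewrite (cvg_shiftS (fun M : nat => mean D M%:Z g x)).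
exact: (dominated_mean_cvg0 D delta p P C d0 d1 h g x).
Qed.

End Telescoping.

(** * Dyadic cubes in Euclidean space *)

Section ConsMeasure.
Context {R : realType} (n : nat).
Local Notation RR := (measurableTypeR R).
Local Notation consT := (fun p : RR * n.-tuple RR => [tuple of p.1 :: p.2]).
Variable m : {sigma_finite_measure set (n.-tuple RR) -> \bar R}.

Lemma measurable_consT : measurable_fun setT consT.
Proof. by apply: measurable_cons; [exact: measurable_fst|exact: measurable_snd]. Qed.

(** One step of the recursion defining [lebn], over any sigma-finite [m], so that the measure
    structure and sigma-finiteness can be carried through the induction on [n]. *)
Definition cons_measure := pushforward ((@lebesgue_measure R) \x m)%E consT.

Let cons_measure0 : cons_measure set0 = 0%E.
Proof. by rewrite /cons_measure/pushforward preimage_set0 measure0. Qed.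

Let cons_measure_ge0 A : (0 <= cons_measure A)%E.
Proof. by rewrite /cons_measure /pushforward measure_ge0. Qed.

Let cons_measure_sigma_additive : semi_sigma_additive cons_measure.
Proof.
have mpre A : measurable A -> measurable (consT @^-1` A).
  by move=> mA; rewrite -[X in measurable X]setTI; exact: measurable_consT.
move=> F mF tF mUF; rewrite /cons_measure/pushforward preimage_bigcup.
apply: measure_semi_sigma_additive.
- by move=> k; exact: mpre.
- apply/trivIsetP => i j _ _ ij; rewrite -preimage_setI.
  by move/trivIsetP : tF => /(_ i j I I ij) ->; rewrite preimage_set0.
- by rewrite -preimage_bigcup; exact: mpre.
Qed.

HB.instance Definition _ := isMeasure.Build _ _ _ cons_measure
  cons_measure0 cons_measure_ge0 cons_measure_sigma_additive.

Let cons_measure_sigma_finite : sigma_finite setT cons_measure.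
Proof.
have [F TF Foo] : sigma_finite setT ((@lebesgue_measure R) \x m)%E.
  have /sigma_finiteP[F [TF ndF Foo]] := sigma_finiteT (@lebesgue_measure R).
  have /sigma_finiteP[G [TG ndG Goo]] := sigma_finiteT m.
  exists (fun k => F k `*` G k).
    apply/seteqP; split => // -[x y] _.
    have : [set: RR] x by []. have : [set: n.-tuple RR] y by [].
    rewrite TF TG => -[k _ Gky] [l _ Flx]; exists (maxn k l) => //; split.
      by move: x Flx; exact/subsetPset/ndF/leq_maxr.
    by move: y Gky; exact/subsetPset/ndG/leq_maxl.
  move=> k; have [mF Fk] := Foo k; have [mG Gk] := Goo k.
  split; first exact: measurableX.
  by rewrite product_measure1E// lte_mul_pinfty// ge0_fin_numE.
pose g (x : n.+1.-tuple RR) : RR * n.-tuple RR := (thead x, [tuple of behead x]).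
have mg : measurable_fun setT g.
  apply/measurable_fun_pairP; split; first exact: measurable_tnth.
  exact: measurable_behead.
have gK : cancel consT g.
  by move=> [r x]; rewrite /g /= theadE; congr pair; exact: val_inj.
have mpre k : measurable (g @^-1` (F k)).
  by rewrite -[X in measurable X]setTI; apply: mg => //; have [] := Foo k.
exists (fun k => g @^-1` (F k)); first by rewrite -preimage_bigcup -TF preimage_setT.
move=> k; split => //; rewrite /cons_measure/pushforward -comp_preimage.
have -> : (g \o consT) @^-1` F k = F k.
  by apply/seteqP; split => x /=; rewrite gK.
by have [] := Foo k.
Qed.

HB.instance Definition _ := Measure_isSigmaFinite.Build _ _ _ cons_measure
  cons_measure_sigma_finite.

End ConsMeasure.

Section Lebn.
Context {R : realType}.
Local Notation RR := (measurableTypeR R).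

Lemma lebn_sigma_finite_measure (n : nat) :
  exists m : {sigma_finite_measure set (n.-tuple RR) -> \bar R},
    (m : set _ -> \bar R) = @lebn R n.
Proof.
elim: n => [|n [m mE]]; first by exists (\d_ ([tuple] : 0.-tuple RR)).
by exists (cons_measure n m); rewrite /= /cons_measure mE.
Qed.

Let lebn0 n : @lebn R n set0 = 0%E.
Proof. by have [m <-] := lebn_sigma_finite_measure n; rewrite measure0. Qed.

Let lebn_ge0 n A : (0 <= @lebn R n A)%E.
Proof. by have [m <-] := lebn_sigma_finite_measure n; exact: measure_ge0. Qed.

Let lebn_sigma_additive n : semi_sigma_additive (@lebn R n).
Proof. have [m <-] := lebn_sigma_finite_measure n; exact: measure_semi_sigma_additive. Qed.

HB.instance Definition _ n := isMeasure.Build _ _ _ (@lebn R n)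
  (@lebn0 n) (@lebn_ge0 n) (@lebn_sigma_additive n).

Lemma measurable_dcube n j (m : n.-tuple int) : measurable (@dcube R n j m).
Proof.
have -> : @dcube R n j m = \bigcap_(i : 'I_n)
    ((fun x : n.-tuple RR => tnth x i) @^-1`
      `[(tnth m i)%:~R * (2 : R) ^ (- j), ((tnth m i) + 1)%:~R * (2 : R) ^ (- j)[%classic).
  apply/seteqP; split => x /=.
    by move=> H i _ /=; rewrite in_itv/=; have [-> ->] := H i.
  by move=> H i; have := H i I; rewrite /= in_itv/= => /andP[].
apply: fin_bigcap_measurable => // i _.
by rewrite -[X in measurable X]setTI; exact: measurable_tnth.
Qed.

Lemma lebn_dcube n j (m : n.-tuple int) : @lebn R n (dcube j m) = (dvol n j)%:E.
Proof.
elim: n m => [|n IH] m.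
  rewrite /= diracE mem_set; last by move=> [].
  by rewrite /dvol mulr0 oppr0 expr0z.
have [l lE] := lebn_sigma_finite_measure n.
rewrite /= /pushforward -lE.
have mS i : tnth m (lift ord0 i) = tnth [tuple of behead m] i.
  by rewrite {1}(tuple_eta m) tnthS.
set I0 := `[(thead m)%:~R * (2 : R) ^ (- j), ((thead m) + 1)%:~R * (2 : R) ^ (- j)[%classic.
have -> : (fun p : RR * n.-tuple RR => [tuple of p.1 :: p.2]) @^-1` dcube j m =
    I0 `*` dcube j [tuple of behead m].
  apply/seteqP; split => [[r x] /= H|[r x] /= [rI xm]].
    split; first by rewrite /I0/= in_itv/=; have [H1 H2] := H ord0; rewrite H1 H2.
    by move=> i; have := H (lift ord0 i); rewrite mS tnthS.
  move=> i; case: (unliftP ord0 i) => [k ->|->].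
    by rewrite mS tnthS; exact: xm.
  by move: rI; rewrite /I0/= in_itv/= => /andP.
rewrite product_measure1E; [|exact: measurable_itv|exact: measurable_dcube].
rewrite [X in (_ * X)%E](_ : _ = (dvol n j)%:E); last by rewrite lE IH.
rewrite /I0 [X in (X * _)%E]lebesgue_measure_itv/= lte_fin ltr_pM2r ?exprz_gt0// ltr_int ltrDl ltr01.
rewrite -EFinD -EFinM -mulrBl -intrB addrAC subrr add0r mul1r /dvol.
by rewrite -expfzDr//; congr ((_ ^ _)%:E); lia.
Qed.

Definition dcell (n : nat) (j : int) (x : n.-tuple RR) : n.-tuple int :=
  [tuple Num.floor ((2 : R) ^ j * tnth x i) | i < n].

Lemma dcubeE n j m (x : n.-tuple RR) : dcube j m x <-> dcell n j x = m.
Proof.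
have p2 : (0 : R) < 2 ^ j by rewrite exprz_gt0.
have E i : ((tnth m i)%:~R * (2 : R) ^ (- j) <= tnth x i /\
     tnth x i < ((tnth m i) + 1)%:~R * (2 : R) ^ (- j)) <->
    Num.floor ((2 : R) ^ j * tnth x i) = tnth m i.
  rewrite -invr_expz ler_pdivrMr// ltr_pdivlMr// (mulrC (tnth x i)).
  split; first by move=> H; apply: floor_def; apply/andP.
  by move=> <-; apply/andP; exact: floor_itv.
split=> [H|xm i]; last by apply/E; rewrite -xm tnth_mktuple.
by apply: eq_from_tnth => i; rewrite tnth_mktuple; apply/E; exact: H.
Qed.

Lemma dcube_dcell n j m : @dcube R n j m = [set x | dcell n j x = m].
Proof. by apply/seteqP; split => x /dcubeE. Qed.

Lemma floor_half (j : int) (t : R) :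
  Num.floor (2 ^ j * t) = (Num.floor (2 ^ (j + 1) * t) %/ 2)%Z.
Proof.
apply: floor_def; have := floor_itv (2 ^ (j + 1) * t).
set k := Num.floor _; rewrite expfzDr// expr1z mulrAC => /andP[k1 k2].
have := divz_eq k 2; have := modz_ge0 k (isT : 2 != 0 :> int).
have := ltz_pmod k (isT : 0 < 2 :> int).
set h := (k %/ 2)%Z; set e := (k %% 2)%Z => e2 e0 kE.
apply/andP; split.
  rewrite -(ler_pM2r (_ : 0 < 2 :> R))//; apply: le_trans k1.
  by rewrite -[2]/(2%:~R) -intrM ler_int; lia.
rewrite -(ltr_pM2r (_ : 0 < 2 :> R))//; apply: (lt_le_trans k2).
by rewrite -[2]/(2%:~R) -intrM ler_int; lia.
Qed.

Lemma dcell_nest n j (x y : n.-tuple RR) :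
  dcell n (j + 1) x = dcell n (j + 1) y -> dcell n j x = dcell n j y.
Proof.
move=> xy; apply: eq_from_tnth => i; rewrite !tnth_mktuple [LHS]floor_half [RHS]floor_half.
by have := congr1 (fun t => tnth t i) xy; rewrite !tnth_mktuple => ->.
Qed.

(** Each coordinate is the limit of the lower corners [floor(2^j x_i) 2^-j], which are constant on
    cubes and thus measurable for the sigma-algebra that the cubes generate. *)
Lemma dcube_generate n : @measurable _ (n.-tuple RR) `<=`
  <<s [set A | exists j m, A = @dcube R n j m] >>.
Proof.
pose G := [set A | exists j m, A = @dcube R n j m].
suff H : measurable_fun setT (id : g_sigma_algebraType G -> n.-tuple RR).
  by move=> A mA; have := H measurableT A mA; rewrite setTI.
apply/measurable_fun_tnthP => i.
pose u (j : nat) (x : g_sigma_algebraType G) : R :=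
  (tnth (dcell n j%:Z x) i)%:~R * (2 : R) ^ (- j%:Z).
apply: (@measurable_fun_cvg _ _ _ _ u) => [j _ B mB|x _].
  rewrite setTI (_ : u j @^-1` B = \bigcup_m (dcube j%:Z m `&`
      [set x | B ((tnth m i)%:~R * (2 : R) ^ (- j%:Z))])); last first.
    apply/seteqP; split => [x Bx|x [m _ [/dcubeE xm Bm]]].
      by exists (dcell n j x) => //; split => //; exact/dcubeE.
    by rewrite /preimage/= /u xm.
  apply: countable_bigcupT_measurable => [|m]; first exact: countableP.
  have [Bm|Bm] := pselect (B ((tnth m i)%:~R * (2 : R) ^ (- j%:Z))); last first.
    by rewrite (_ : _ `&` _ = set0)// -subset0 => x [].
  rewrite (_ : _ `&` _ = dcube j%:Z m); last by apply/seteqP; split => [x []|x].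
  by apply: sub_sigma_algebra; exists j%:Z, m.
rewrite /u /=; apply/cvgrPdist_le => e e0.
have c2 : (fun j : nat => (2 : R) ^ (- j%:Z)) @ \oo --> 0.
  under eq_fun do rewrite -invr_expz -exprnP -exprVn.
  by apply: cvg_expr; rewrite ger0_norm ?invr_ge0// invf_lt1// ltr1n.
have /cvgrPdist_le/(_ e e0) := c2; apply: filterS => j.
have p2 : (0 : R) < 2 ^ j%:Z by rewrite exprz_gt0.
rewrite sub0r normrN => /(le_trans (ler_norm _)); apply: le_trans.
rewrite tnth_mktuple; have /andP[f1 f2] := floor_itv ((2 : R) ^ j%:Z * tnth x i).
have xE : tnth x i = (2 ^ j%:Z * tnth x i) * 2 ^ (- j%:Z).
  by rewrite -invr_expz mulrAC mulfV ?mul1r// gt_eqF.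
rewrite {1}xE -mulrBl normrM ger0_norm ?subr_ge0// (ger0_norm (ltW _)) ?exprz_gt0//.
rewrite -[leRHS]mul1r ler_wpM2r ?exprz_ge0// lerBlDl ltW//.
by move: f2; rewrite intrD.
Qed.

Lemma dyadic_ratio n (j : int) : ((2 : R) ^+ n) ^ (- j) = dvol n j.
Proof. by rewrite /dvol exprnP exprz_exp; congr (_ ^ _); lia. Qed.

Variables (n : nat) (n0 : (0 < n)%N).

Let ratio1 : 1 < (2 : R) ^+ n.
Proof. by rewrite exprn_egt1 ?ltr1n// -lt0n. Qed.

Let measurable_dcell j (m : n.-tuple int) : measurable [set x : n.-tuple RR | dcell n j x = m].
Proof. by rewrite -dcube_dcell; exact: measurable_dcube. Qed.

Let lebn_dcell j (m : n.-tuple int) :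
  @lebn R n [set x : n.-tuple RR | dcell n j x = m] = (((2 : R) ^+ n) ^ (- j))%:E.
Proof. by rewrite -dcube_dcell lebn_dcube dyadic_ratio. Qed.

Let dcell_generate : @measurable _ (n.-tuple RR) `<=`
  <<s [set A | exists j m, A = [set x : n.-tuple RR | dcell n j x = m]] >>.
Proof.
have := @dcube_generate n; congr (_ `<=` <<s _ >>); apply/seteqP.
by split => A [j [m ->]]; exists j, m; rewrite dcube_dcell.
Qed.

Definition dyadicRn : dyadicSystem (@lebn R n) :=
  DyadicSystem _ _ _ _ (n.-tuple int) (dcell n) ((2 : R) ^+ n) [tuple 0 | _ < n]
    ratio1 measurable_dcell lebn_dcell (dcell_nest n) dcell_generate.

Lemma vol_dyadicRn j : vol dyadicRn j = dvol n j.
Proof. exact: dyadic_ratio. Qed.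

Lemma cube_dyadicRn j (m : n.-tuple int) : cube dyadicRn j m = dcube j m.
Proof. by rewrite dcube_dcell. Qed.

End Lebn.

(** * Haar expansions *)

Section Haar.
Context {R : realType} (n : nat).
Local Notation RR := (measurableTypeR R).
Local Notation Rn := (n.-tuple RR).

(** Floors turn the two halves of the unit interval into binary digits, which match the indices of
    the next generation of cubes. *)
Lemma haar1E e (t : R) : haar1 e t =
  (Num.floor (2 * t) == 0)%:R + (- 1) ^+ e * (Num.floor (2 * t) == 1)%:R.
Proof.
by rewrite /haar1 !floor_eq; case: ifP => _; case: ifP => _.
Qed.

Lemma haar1_le1 e (t : R) : `|haar1 e t| <= 1.
Proof.
rewrite haar1E; have [->|_] := eqVneq (Num.floor (2 * t)) 0.
  by rewrite mulr0 addr0 normr1.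
by case: eqP => _; rewrite add0r normrM normrX normrN normr1 expr1n mul1r ?normr1 ?normr0.
Qed.

(** The kernel of the projection onto functions constant on the two halves of [[0, 1)]; its product
    over the coordinates appears in [sum_haarQ]. *)
Lemma sum_haar1 (s t : R) : \sum_(e : bool) haar1 e s * haar1 e t =
  2 * ((Num.floor (2 * s) == Num.floor (2 * t)) &&
       ((Num.floor (2 * s) == 0) || (Num.floor (2 * s) == 1)))%:R.
Proof.
rewrite big_bool/= !haar1E /=; case: (eqVneq (Num.floor (2 * s)) 0) => [->|s0].
  case: (eqVneq (Num.floor (2 * t)) 0) => [->|t0] /=; first by ring.
  by case: (_ == 1) => /=; ring.
case: (eqVneq (Num.floor (2 * s)) 1) => [->|s1]/=; last by rewrite andbF /=; ring.
case: (eqVneq (Num.floor (2 * t)) 0) => [->|t0] /=; first by ring.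
by rewrite eq_sym; case: eqP => _ /=; ring.
Qed.

Lemma haar1_false (t : R) :
  haar1 false t = ((Num.floor (2 * t) == 0) || (Num.floor (2 * t) == 1))%:R.
Proof.
rewrite haar1E expr0 mul1r; case: eqVneq => [->|_]; first by rewrite addr0.
by rewrite add0r.
Qed.

Lemma haar1_digit j (t : R) (m : int) :
  Num.floor (2 * (2 ^ j * t - m%:~R)) = Num.floor (2 ^ (j + 1) * t) - 2 * m.
Proof.
have -> : 2 * (2 ^ j * t - m%:~R) = 2 ^ (j + 1) * t + (- (2 * m))%:~R.
  by rewrite expfzDr// expr1z intrN intrM; ring.
by rewrite floorDrz ?intr_int// intrKfloor.
Qed.

Lemma floor_digit j (t : R) (m : int) :
  (Num.floor (2 ^ (j + 1) * t) - 2 * m == 0) || (Num.floor (2 ^ (j + 1) * t) - 2 * m == 1) =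
  (Num.floor (2 ^ j * t) == m).
Proof.
rewrite (floor_half j t); set k := Num.floor _.
have := divz_eq k 2; have := modz_ge0 k (isT : 2 != 0 :> int).
have := ltz_pmod k (isT : 0 < 2 :> int).
set h := (k %/ 2)%Z; set e := (k %% 2)%Z => e2 e0 kE; lia.
Qed.

Local Notation arg j m x i := (2 ^ j * tnth x i - (tnth m i)%:~R : R).
Let K (j : int) : R := Num.sqrt (2 ^ (j * n%:Z)).

Lemma haarQE e j m (x : Rn) :
  haarQ e j m x = K j * \prod_(i < n) haar1 (tnth e i) (arg j m x i).
Proof.
rewrite /haarQ /haar; congr (_ * _); apply: eq_bigr => i _.
by rewrite tnth_mktuple.
Qed.

Lemma haarQ_supp e j m (x : Rn) : dcell n j x != m -> haarQ e j m x = 0.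
Proof.
move=> xm; rewrite haarQE.
have [i xi] : exists i, tnth (dcell n j x) i != tnth m i.
  by apply/existsP; apply: contraNT xm => /existsPn H;
    apply/eqP/eq_from_tnth => i; apply/eqP; rewrite -[_ == _]negbK; exact: H.
rewrite (bigD1 i)//= [X in _ * (X * _)](_ : _ = 0) ?mul0r ?mulr0//.
move: xi; rewrite tnth_mktuple -floor_digit negb_or => /andP[h0 h1].
by rewrite haar1E haar1_digit (negbTE h0) (negbTE h1) mulr0 addr0.
Qed.

Lemma haarQ_le e j m (x : Rn) : `|haarQ e j m x| <= K j * \1_(dcube j m) x.
Proof.
have [xm|xm] := eqVneq (dcell n j x) m; last first.
  by rewrite haarQ_supp// normr0 mulr_ge0 ?sqrtr_ge0.
rewrite indicE mem_set ?mulr1; last exact/dcubeE.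
rewrite haarQE normrM ger0_norm ?sqrtr_ge0// ler_piMr ?sqrtr_ge0// normr_prod.
by apply: prodr_ile1 => i _; rewrite normr_ge0 haar1_le1.
Qed.

Lemma haarQ_cell e j m (x y : Rn) : dcell n (j + 1) x = dcell n (j + 1) y ->
  haarQ e j m x = haarQ e j m y.
Proof.
move=> xy; rewrite !haarQE; congr (_ * _); apply: eq_bigr => i _.
rewrite !haar1E !haar1_digit.
by have := congr1 (fun t => tnth t i) xy; rewrite !tnth_mktuple => ->.
Qed.

Lemma sum_tuple_prod (F : 'I_n -> bool -> R) :
  \sum_(e : n.-tuple bool) \prod_(i < n) F i (tnth e i) = \prod_(i < n) \sum_b F i b.
Proof.
rewrite bigA_distr_bigA (reindex (fun f : {ffun 'I_n -> bool} => [tuple f i | i < n])).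
  by apply: eq_bigr => f _; apply: eq_bigr => i _; rewrite tnth_mktuple.
exists (fun t => [ffun i => tnth t i]) => [f _|t _].
  by apply/ffunP => i; rewrite ffunE tnth_mktuple.
by apply: eq_from_tnth => i; rewrite tnth_mktuple ffunE.
Qed.

Let KK j : K j * K j = (dvol n j)^-1.
Proof. by rewrite -expr2 sqr_sqrtr ?exprz_ge0// /dvol invr_expz opprK. Qed.

Lemma prod_cond (Q : 'I_n -> bool) (c : R) :
  \prod_(i < n) (c * (Q i)%:R) = c ^+ n * [forall i, Q i]%:R.
Proof.
rewrite big_split/= prodr_const card_ord; congr (_ * _).
case: (boolP [forall i, Q i]) => [/forallP H|].
  by rewrite big1// => i _; rewrite H.
by rewrite negb_forall => /existsP[i Qi]; rewrite (bigD1 i)//= (negbTE Qi) mul0r.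
Qed.

Lemma dcell_eqb l (x y : Rn) : (dcell n l x == dcell n l y) =
  [forall i, Num.floor (2 ^ l * tnth x i) == Num.floor (2 ^ l * tnth y i)].
Proof.
apply/eqP/forallP => [xy i|H].
  by have := congr1 (fun t => tnth t i) xy; rewrite !tnth_mktuple => ->.
by apply: eq_from_tnth => i; rewrite !tnth_mktuple; apply/eqP.
Qed.

(* The Haar functions of a cube, together with its normalised indicator, form an
   orthonormal basis of the functions that are constant on its children. *)
Lemma sum_haarQ j (x y : Rn) : let m := dcell n j x in
  \sum_(e : n.-tuple bool | e != [tuple false | _ < n]) haarQ e j m x * haarQ e j m y =
  (dvol n (j + 1))^-1 * (dcell n (j + 1) y == dcell n (j + 1) x)%:R -
  (dvol n j)^-1 * (dcell n j y == dcell n j x)%:R.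
Proof.
move=> m; apply/eqP; rewrite eq_sym subr_eq; apply/eqP.
transitivity (\sum_(e : n.-tuple bool) haarQ e j m x * haarQ e j m y); last first.
  (* The excluded index gives the normalised indicator of the cube itself, that is, the averaging
     kernel of generation [j]. *)
  rewrite (bigD1 [tuple false | _ < n])//= [LHS]addrC; congr (_ + _).
  rewrite !haarQE mulrACA KK -big_split/=; congr (_ * _).
  rewrite (eq_bigr (fun i => 1 * (Num.floor (2 ^ j * tnth y i) ==
      Num.floor (2 ^ j * tnth x i))%:R)); last first.
    move=> i _; rewrite tnth_mktuple !haar1_false !haar1_digit !floor_digit.
    by rewrite /m !tnth_mktuple eqxx.
  by rewrite prod_cond expr1n mul1r dcell_eqb.
symmetry; under eq_bigr do rewrite !haarQE mulrACA KK -big_split/=.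
rewrite -mulr_sumr (sum_tuple_prod (fun i b => haar1 b (arg j m x i) * haar1 b (arg j m y i))).
under eq_bigr do rewrite sum_haar1 !haar1_digit floor_digit.
rewrite prod_cond mulrA; congr (_ * _%:R).
  by rewrite /dvol !invr_expz !opprK exprnP -expfzDr//; congr (_ ^ _); lia.
rewrite eq_sym dcell_eqb; congr (nat_of_bool _); apply: eq_forallb => i.
by rewrite /m tnth_mktuple eqxx andbT (inj_eq (addIr _)).
Qed.

Variable n0 : (0 < n)%N.
Local Notation D := (dyadicRn n n0).

Lemma integrable_haarQ F e j m : locint D F ->
  (@lebn R n).-integrable setT (fun y => (F y * haarQ e j m y)%:E).
Proof.
move=> [mF iF]; have mh : measurable_fun setT (haarQ e j m : Rn -> R).
  apply: (measurable_level D _ _ (j + 1)) => // x y xy; exact: haarQ_cell.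
have mQ : measurable (dcube j m : set Rn) by exact: measurable_dcube.
have mFn : measurable_fun setT (fun y => (`|F y|)%:E).
  by apply/measurable_EFinP; exact: measurableT_comp.
apply: (integrable_le _ (fun y => F y * haarQ e j m y)
  (fun y => ((K j)%:E * ((`|F y|)%:E * (\1_(dcube j m) y)%:E))%E)) => //.
- exact: measurable_funM.
- apply: measurable_funeM; apply: emeasurable_funM => //.
  by apply/measurable_EFinP; exact: measurable_indic.
- move=> y; rewrite -!EFinM lee_fin normrM mulrCA ler_wpM2l//.
  exact: haarQ_le.
rewrite ge0_integralZl//.
- rewrite lte_mul_pinfty ?lee_fin ?sqrtr_ge0//.
  have /integrableP[_] := iF j m.
  rewrite cube_dyadicRn integral_mkcond; congr (_ < _)%E; apply: eq_integral => y _.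
  by rewrite patchE indicE; case: (y \in _); rewrite ?mule1 ?mule0.
- apply: emeasurable_funM => //.
  by apply/measurable_EFinP; exact: measurable_indic.
- by rewrite lee_fin sqrtr_ge0.
Qed.

Lemma integral_cell_mean F j (x : Rn) : locint D F ->
  (@lebn R n).-integrable setT
    (fun y => (F y * ((dvol n j)^-1 * (dcell n j y == dcell n j x)%:R))%:E) /\
  (\int[@lebn R n]_y (F y * ((dvol n j)^-1 * (dcell n j y == dcell n j x)%:R))%:E =
   (mean D j F x)%:E)%E.
Proof.
move=> lF; have mQ : measurable (cubex D j x) by exact: mcubex.
have E y : (F y * ((dvol n j)^-1 * (dcell n j y == dcell n j x)%:R))%:E =
    ((dvol n j)^-1%:E * ((EFin \o F) \_ (cubex D j x)) y)%E.
  rewrite patchE; have [yx|yx] := eqVneq (dcell n j y) (dcell n j x).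
    by rewrite mem_set// -EFinM mulr1 mulrC.
  rewrite memNset; last by move=> h; move/eqP: yx; apply.
  by rewrite !mulr0 mule0.
have iF : (@lebn R n).-integrable setT ((EFin \o F) \_ (cubex D j x)).
  by rewrite -integrable_mkcond//; exact: lF.2.
split.
  by apply: eq_integrable (integrableZl measurableT (dvol n j)^-1 iF) => // y _; rewrite E.
under eq_integral do rewrite E.
rewrite integralZl// -integral_mkcond -avg_mean//.
by rewrite /avg vol_dyadicRn.
Qed.

(** Only the cube containing [x] contributes to the sum over [m]; summed over [e], the kernel of
    [sum_haarQ] turns the inner products into a difference of means. *)
Lemma haar_psumE w F M (x : Rn) : locint D F ->
  haar_psum w F M x = diffsum D w F M x.
Proof.
move=> lF; rewrite /haar_psum exchange_big/=; apply: eq_bigr => k _.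
set j := k%:Z - M%:Z; pose c := dcell n j x.
rewrite (eq_bigr (fun e => w j * (inner F (haarQ e j c) * haarQ e j c x))); last first.
  move=> e _; rewrite -(@fsbig_widen _ _ _ _ [set c])//.
    by rewrite fsbig_set1 mulrA.
  move=> m [_ /= mc]; rewrite /= haarQ_supp ?mulr0//.
  by apply/eqP => h; apply: mc.
rewrite -mulr_sumr; congr (_ * _); apply: EFin_inj.
rewrite -sumEFin.
have iF e : (@lebn R n).-integrable setT (fun y => (F y * haarQ e j c y)%:E).
  exact: integrable_haarQ.
have fE e : (inner F (haarQ e j c) * haarQ e j c x)%:E =
   (\int[@lebn R n]_y ((haarQ e j c x)%:E * (F y * haarQ e j c y)%:E))%E.
  rewrite integralZl// EFinM muleC /inner fineK//.
  exact: integrable_fin_num.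
under eq_bigr do rewrite fE.
rewrite -integral_sum//; last by move=> e; exact: integrableZl.
have [i1 e1] := integral_cell_mean F (j + 1) x lF.
have [i2 e2] := integral_cell_mean F j x lF.
rewrite /meandiff EFinB -e1 -e2 -integralB//.
apply: eq_integral => y _.
under eq_bigr do rewrite -EFinM mulrCA.
rewrite sumEFin -mulr_sumr sum_haarQ -EFinB; congr EFin; ring.
Qed.

End Haar.

(** * The block space estimates *)

Section Euclidean.
Context {R : realType} (n : nat) (n0 : (0 < n)%N).
Local Notation RR := (measurableTypeR R).
Local Notation Rn := (n.-tuple RR).
Local Notation D := (@dyadicRn R n n0).
Implicit Types (a f g A : Rn -> R) (lam : nat -> R) (j : int) (m : n.-tuple int).

Lemma dcube_nonempty j m : exists x : Rn, dcell n j x = m.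
Proof.
exists [tuple (tnth m i)%:~R * (2 : R) ^ (- j) | i < n]; apply/dcubeE => i.
by rewrite tnth_mktuple ltr_pM2r ?exprz_gt0// ltr_int ltrDl ltr01.
Qed.

Lemma cubex_dyadicRn j (x : Rn) : cubex D j x = dcube j (dcell n j x).
Proof. exact: cube_dyadicRn. Qed.

Lemma dcube_bounded j m : exists k : nat,
  @dcube R n j m `<=` [set x | forall i, (- k%:R <= tnth x i <= k%:R)%R].
Proof.
pose b i : R := (`|tnth m i| + 1)%:~R * 2 ^ (- j).
have b0 i : 0 <= b i by rewrite mulr_ge0 ?exprz_ge0// ler0z addr_ge0.
pose B := \sum_i b i.
have B0 : 0 <= B by exact: sumr_ge0.
exists (Num.bound B) => x xm i.
have bB : b i <= (Num.bound B)%:R.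
  rewrite (le_trans _ (ltW (archi_boundP B0)))// /B (bigD1 i)//= lerDl.
  exact: sumr_ge0.
have [x1 x2] := xm i; apply/andP; split.
  apply: le_trans x1; rewrite lerNl; apply: le_trans bB.
  rewrite -mulNr ler_wpM2r ?exprz_ge0// -intrN ler_int; lia.
apply: (le_trans (ltW x2)); apply: le_trans bB.
by rewrite ler_wpM2r ?exprz_ge0// ler_int; lia.
Qed.

Lemma locint_loc_integrable a : loc_integrable a -> locint D a.
Proof.
move=> [ma ia]; split=> // j m; rewrite cube_dyadicRn.
have [k mk] := dcube_bounded j m.
apply/integrableP; split; first by apply/measurable_EFinP; exact: measurable_funTS.
apply: le_lt_trans (ia k); apply: ge0_subset_integral => //.
- exact: measurable_dcube.
- have -> : [set x : Rn | forall i, (- k%:R <= tnth x i <= k%:R)%R] =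
      \bigcap_(i : 'I_n) ((fun x : Rn => tnth x i) @^-1` `[(- k%:R : R), k%:R]%classic).
    apply/seteqP; split => x /= H i; first by move=> _ /=; rewrite in_itv/=; exact: H.
    by have := H i I; rewrite /= in_itv.
  apply: fin_bigcap_measurable => // i _.
  by rewrite -[X in measurable X]setTI; exact: measurable_tnth.
- by apply/measurable_EFinP; apply: measurableT_comp => //; exact: measurable_funTS.
Qed.

Lemma dmean_mean j f (x : Rn) : locint D f -> dmean j (dcell n j x) f = mean D j f x.
Proof.
move=> lf; apply: EFin_inj; rewrite -avg_mean// /avg vol_dyadicRn cubex_dyadicRn.
rewrite /dmean EFinM fineK//.
have := lf.2 j (dcell n j x); rewrite cube_dyadicRn => h.
by apply: integrable_fin_num h; exact: measurable_dcube.
Qed.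

Lemma bmo_BMO_dyadic a : BMO_dyadic a -> exists2 K : R, 0 < K & bmo D a K.
Proof.
move=> [/locint_loc_integrable la [K aK]].
exists (Num.max K 1); first by rewrite lt_max ltr01 orbT.
split=> // j; pose b c y := `|a y - c|.
have lb c : locint D (b c).
  apply: locint_norm; apply: (locintB D a (cst c)) => //; exact: locint_cst.
have E x : avg D j (fun y => (`|a y - mean D j a y|)%:E) x =
    (dmean j (dcell n j x) (fun y => `|a y - dmean j (dcell n j x) a|))%:E.
  rewrite (dmean_mean j a x la); set c := mean D j a x.
  transitivity ((dmean j (dcell n j x) (b c))%:E); last by [].
  rewrite (dmean_mean j (b c) x (lb c)) -(avg_mean D j (b c) x (lb c)).
  by apply: avg_eq => y yx /=; rewrite /b (level_mean D j a y x yx).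
apply: (ae_level D j _ _ _) => [|x y xy]; last first.
  by rewrite (level_avg D j _ x y xy).
apply: filterS aK => x; rewrite E => xK.
apply: (@le_trans _ _ K%:E); last by rewrite lee_fin le_max lexx.
apply: le_trans xK; apply: ereal_sup_ubound.
by exists (j, dcell n j x) => //=; apply/dcubeE.
Qed.

Section Exponents.
Variables (alpha r r0 p p0 : R).
Hypotheses (alpha0 : 0 < alpha) (r1 : 1 < r) (rr0 : r <= r0) (p1 : 1 < p) (pp0 : p <= p0)
  (r0E : r0^-1 = p0^-1 - alpha / n%:R) (rpE : r / r0 = p / p0).
Local Notation q := (conjexp r).
Local Notation P := (conjexp p).
Local Notation delta := (1 - r / r0).
Local Notation gamma := (p^-1 - r^-1).

Let r_gt0 : 0 < r. Proof. exact: lt_trans r1. Qed.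
Let p_gt0 : 0 < p. Proof. exact: lt_trans p1. Qed.
Let r0_gt0 : 0 < r0. Proof. exact: lt_le_trans rr0. Qed.
Let p0_gt0 : 0 < p0. Proof. exact: lt_le_trans pp0. Qed.

Lemma conjexp_gt1 (u : R) : 1 < u -> 1 < conjexp u.
Proof. by move=> u1; rewrite /conjexp ltr_pdivlMr ?subr_gt0// mul1r gtrDl oppr_lt0. Qed.

Lemma conjexpV (u : R) : 1 < u -> (conjexp u)^-1 = 1 - u^-1.
Proof.
by move=> u1; rewrite /conjexp; field; rewrite !gt_eqF ?subr_gt0// (lt_trans ltr01).
Qed.

Let d0 : 0 <= delta.
Proof. by rewrite subr_ge0 ler_pdivrMr// mul1r. Qed.
Let d1 : delta < 1.
Proof. by rewrite gtrDl oppr_lt0 divr_gt0. Qed.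
Let deltaE : delta = 1 - p / p0. Proof. by rewrite rpE. Qed.
Let r0V : r0^-1 = (1 - delta) / r.
Proof. by rewrite subKr mulrAC mulfV ?mul1r// gt_eqF. Qed.
Let p0V : p0^-1 = (1 - delta) / p.
Proof. by rewrite deltaE subKr mulrAC mulfV ?mul1r// gt_eqF. Qed.
(** [1/p0 - 1/r0 = (1 - delta)(1/p - 1/r)], since [r / r0 = p / p0] gives both pairs of exponents
    the same [delta]. *)
Let thetaE : alpha / n%:R = gamma * (1 - delta).
Proof.
have H := r0E; have -> : alpha / n%:R = p0^-1 - r0^-1 by lra.
by rewrite [X in X - _ = _]p0V [X in _ - X = _]r0V; ring.
Qed.
Let gamma0 : 0 < gamma.
Proof.
have : 0 < gamma * (1 - delta) by rewrite -thetaE divr_gt0// ltr0n.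
by rewrite pmulr_lgt0// subKr divr_gt0.
Qed.
Let q1 : 1 < q. Proof. exact: conjexp_gt1. Qed.
Let P1 : 1 < P. Proof. exact: conjexp_gt1. Qed.
Let q_gt0 : 0 < q. Proof. exact: lt_trans q1. Qed.
Let P_gt0 : 0 < P. Proof. exact: lt_trans P1. Qed.
Let qr : q^-1 + r^-1 = 1. Proof. by rewrite conjexpV// subrK. Qed.
Let pP : p^-1 + P^-1 = 1. Proof. by rewrite conjexpV// addrC subrK. Qed.
Let r01 : 1 < r0. Proof. exact: lt_le_trans rr0. Qed.
Let p01 : 1 < p0. Proof. exact: lt_le_trans pp0. Qed.

Lemma block_of_is_block A : is_block (conjexp r0) q A ->
  exists j x0, block D q delta j x0 (fun y => `|A y|).
Proof.
move=> [mA [j [m [Am An]]]]; have [x0 x0m] := dcube_nonempty j m; exists j, x0; split => //.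
- exact: measurableT_comp.
- by move=> y; rewrite cubex_dyadicRn x0m => /Am ->; rewrite normr0.
move: An; rewrite /LpN; set I := (\int[_]_x _)%E.
have I0 : (0 <= I)%E by apply: integral_ge0 => x _; rewrite lee_fin powR_ge0.
have IE : I = ((I `^ q^-1) `^ q)%E by rewrite -poweRrM mulVf ?gt_eqF// poweRe1.
move=> IH; rewrite IE.
have : ((I `^ q^-1) `^ q <= ((dvol n j `^ (q^-1 - (conjexp r0)^-1))%:E) `^ q)%E.
  apply: gt0_ler_poweR (ltW q_gt0) _ _ _ _ IH.
    by rewrite in_itv/= poweR_ge0 leey.
  by rewrite in_itv/= lee_fin powR_ge0 leey.
move=> /le_trans; apply; rewrite poweR_EFin lee_fin -powRrM vol_dyadicRn.
rewrite le_eqVlt; apply/orP; left; apply/eqP; congr (_ `^ _).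
have -> : q^-1 - (conjexp r0)^-1 = - (delta * r^-1).
  by rewrite (conjexpV r0 r01); have := r0V; have := conjexpV r r1; lra.
have -> : q - 1 = q * r^-1.
  have -> : r^-1 = 1 - q^-1 by have := qr; lra.
  by field; rewrite gt_eqF.
by ring.
Qed.

Lemma is_block_of A j m : measurable_fun setT A ->
  (forall x, ~ cube D j m x -> A x = 0) ->
  (\int[@lebn R n]_x ((`|A x|) `^ P)%:E <= (vol D j `^ (- (delta / p) * P))%:E)%E ->
  is_block (conjexp p0) P A.
Proof.
move=> mA Am An; split=> //; exists j, m; split.
  by move=> x; rewrite -cube_dyadicRn; exact: Am.
rewrite /LpN; move: An; set I := (\int[_]_x _)%E => An.
have I0 : (0 <= I)%E by apply: integral_ge0 => x _; rewrite lee_fin powR_ge0.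
have : (I `^ P^-1 <= ((vol D j `^ (- (delta / p) * P))%:E) `^ P^-1)%E.
  have P0' : 0 <= P^-1 by rewrite invr_ge0 ltW.
  apply: gt0_ler_poweR P0' _ _ _ _ An.
    by rewrite in_itv/= I0 leey.
  by rewrite in_itv/= lee_fin powR_ge0 leey.
move=> /le_trans; apply; rewrite poweR_EFin lee_fin -powRrM vol_dyadicRn.
rewrite le_eqVlt; apply/orP; left; apply/eqP; congr (_ `^ _).
rewrite mulfK ?gt_eqF// !conjexpV//; have := p0V; lra.
Qed.

(** [g'] may differ from [g] on a null set, because the limit defining the commutator is identified
    only almost everywhere. *)
Lemma Hnorm_dominated (C : R) (h : Rn -> \bar R) g g' :
  dominated D delta p P C%:E h -> measurable_fun setT g ->
  (forall y, (`|g y|%:E <= h y)%E) -> {ae @lebn R n, forall x, g' x = g x} ->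
  (Hnorm (conjexp p0) P g' <= (4 * C)%:E)%E.
Proof.
move=> dh mg gh gg'.
have [lam [A [lam0 bA sl cA]]] :=
  dominated_blocks D delta p P C d0 (ltW d1) h g p1 P1 pP dh mg gh.
apply: (le_trans _ sl); apply: ereal_inf_lbound; exists lam, A; split; last first.
  by apply: eq_eseriesr => k _; rewrite ger0_norm.
split; [|split].
- move=> k; have [mA [j [m [Am An]]]] := bA k; exact: is_block_of mA Am An.
- under eq_eseriesr do rewrite ger0_norm//.
  exact: le_lt_trans sl (ltry _).
- by apply: filterS2 gg' cA => x ->.
Qed.

Lemma block_decomp_le f lam (A : nat -> Rn -> R) (u v : R) : block_decomp u v f lam A ->
  {ae @lebn R n, forall x, ((`|f x|)%:E <= \sum_(k <oo) (`|lam k| * `|A k x|)%:E)%E}.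
Proof.
move=> [_ [_ fA]]; apply: filterS fA => x fx.
have fx' : (\sum_(k < N) lam k * A k x)%:E @[N --> \oo] --> (f x)%:E.
  by apply: cvg_EFin; [exact: nearW|exact: fx].
have cx : (`|(\sum_(k < N) lam k * A k x)%:E|)%E @[N --> \oo] --> (`|(f x)%:E|)%E.
  exact: cvg_abse fx'.
have -> : ((`|f x|)%:E = limn (fun N => `|(\sum_(k < N) lam k * A k x)%:E|))%E.
  by apply/esym/cvg_lim.
apply: lime_le; first by apply/cvg_ex; exists (`|(f x)%:E|)%E.
apply: nearW => N /=.
apply: (@le_trans _ _ (\sum_(0 <= k < N) (`|lam k| * `|A k x|)%:E)%E).
  rewrite sumEFin lee_fin big_mkord; apply: (le_trans (ler_norm_sum _ _ _)).
  by apply: ler_sum => k _; rewrite normrM.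
by apply: nneseries_lim_ge => k _ _; rewrite lee_fin mulr_ge0.
Qed.

(** Stated for every decomposition of [f], as the infimum defining the norm need not be attained;
    one dominating [H] serves both operators. *)
Lemma operators_le a : BMO_dyadic a ->
  exists2 C : R, 0 < C & forall f lam (A : nat -> Rn -> R), measurable_fun setT f ->
    block_decomp (conjexp r0) q f lam A ->
    (Hnorm (conjexp p0) P (Idyad alpha f) <= C%:E * \sum_(0 <= k <oo) (`|lam k|)%:E)%E /\
    (Hnorm (conjexp p0) P (commut a alpha f) <= C%:E * \sum_(0 <= k <oo) (`|lam k|)%:E)%E.
Proof.
move=> /bmo_BMO_dyadic[K K0 aK].
have la : locint D a by case: aK.
have r0'1 := conjexp_gt1 r0 r01.
pose iu := q^-1 + delta / r.
have iuE : iu = (conjexp r0)^-1.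
  by rewrite /iu !conjexpV//; have := r0V; lra.
have iu0 : 0 < iu by rewrite iuE invr_gt0 (lt_trans ltr01).
have iu1 : iu < 1 by rewrite iuE invf_lt1// (lt_trans ltr01).
(* [1/s] is the midpoint of [iu = 1 / r0'] and 1, so [1 < s < r0'], and [r0' <= q] because
   [r <= r0]. *)
pose s := 2 / (1 + iu).
have s1 : 1 < s by rewrite /s ltr_pdivlMr; lra.
have sV : s^-1 = (1 + iu) / 2 by rewrite /s invf_div.
have eta0 : q^-1 + delta / r < s^-1 by rewrite sV -/iu; lra.
have sq : s < q.
  rewrite -ltf_pV2 ?posrE//; last exact: lt_trans s1.
  apply: le_lt_trans eta0; rewrite lerDl divr_ge0 ?(ltW r_gt0)//.
have prE : p^-1 = gamma + r^-1 by rewrite subrK.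
have [C0 C00 HC] := block_dominated D a p P q r s delta gamma K
  p1 P1 pP q1 r1 qr d0 d1 gamma0 prE s1 sq eta0 K0 aK.
pose rho : R := ratio D + 1.
have rho0 : 0 < rho by rewrite addr_gt0 ?ratio_gt0.
exists (4 * (rho * C0)) => [|f lam A mf fA]; first by rewrite !mulr_gt0.
have mnf : measurable_fun setT (fun y => `|f y|) by exact: measurableT_comp.
have [H [H0 dH fH]] := decomp_dominated D a p P delta (gamma * (1 - delta)) C0 q
  (fun y => `|f y|) (fun k => `|lam k|) (fun k y => `|A k y|) HC (ltW C00) la
  mnf (fun=> normr_ge0 _) (fun=> normr_ge0 _) (fun k => block_of_is_block _ (fA.1 k))
  (block_decomp_le _ _ _ _ _ fA).
set S := (\sum_(0 <= k <oo) (`|lam k|)%:E)%E in dH *.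
have S0 : (0 <= S)%E by apply: nneseries_ge0 => k _ _; rewrite lee_fin.
have SE : S = (fine S)%:E by rewrite fineK// ge0_fin_numE// fA.2.1.
rewrite SE -EFinM in dH *; set C1 := C0 * fine S in dH.
have C10 : 0 <= C1 by rewrite mulr_ge0 ?(ltW C00)// fine_ge0.
have -> : ((4 * (rho * C0))%:E * (fine S)%:E = (4 * (rho * C1))%:E)%E.
  by rewrite -EFinM /C1; congr EFin; ring.
have d1' := ltW d1.
have lf := oscsum_locint D a la (gamma * (1 - delta)) delta p P C1 d0 d1' f H mf dH fH.
have laf := oscsum_locintM D a la (gamma * (1 - delta)) delta p P C1 d0 d1' f H mf dH fH.
have IE F : locint D F -> Idyad alpha F =
    fun x => limn (diffsum D (fun j => vol D j `^ (gamma * (1 - delta))) F ^~ x).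
  move=> lF; apply/funext => x; rewrite /Idyad; congr (limn _); apply/funext => M.
  rewrite (haar_psumE n n0)// /diffsum; apply: eq_bigr => k _.
  by rewrite thetaE vol_dyadicRn.
have mI F : locint D F -> measurable_fun setT (Idyad alpha F).
  by move=> lF; rewrite IE//; apply: measurable_limn => M; exact: measurable_diffsum.
have dh : dominated D delta p P (rho * C1)%:E (fun x => (rho%:E * H x)%E).
  by rewrite EFinM; apply: dominatedZ => //; exact: ltW.
split.
  apply: (Hnorm_dominated _ _ _ _ dh (mI f lf)); last exact: aeW.
  move=> y; rewrite IE//.
  exact: (transform_le D a la (gamma * (1 - delta)) f H mf fH).
pose g x := a x * Idyad alpha f x - Idyad alpha (fun z => a z * f z) x.
have mg : measurable_fun setT g.
  apply: measurable_funB; last exact: mI.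
  by apply: measurable_funM; [exact: la.1|exact: mI].
have gh y : (`|g y|%:E <= rho%:E * H y)%E.
  rewrite /g !IE//.
  exact: (commutator_le D a la (gamma * (1 - delta)) delta p P C1 d0 d1' f H mf dH fH).
apply: (Hnorm_dominated _ _ _ _ dh mg gh).
have lg := dominated_locint D delta p P (rho * C1) d0 d1' _ g dh mg gh.
(* [C1] is 0 when all coefficients vanish, while [diffsum1_cvg] asks for a positive constant. *)
have dh' : dominated D delta p P (rho * C1 + 1)%:E (fun x => (rho%:E * H x)%E).
  by apply: dominated_leC dh; rewrite lee_fin lerDl.
have C10' : 0 < rho * C1 + 1 by rewrite ltr_wpDl// mulr_ge0// ltW.
have := diffsum1_cvg D delta p P _ _ g d0 d1' p_gt0 C10' dh' mg gh.
apply: filterS => x <-; rewrite /commut; congr (limn _); apply/funext => M.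
exact: haar_psumE.
Qed.

End Exponents.
End Euclidean.

Theorem theorem6 (R : realType) (n : nat) (alpha r r0 p p0 : R)
  (a : n.-tuple (measurableTypeR R) -> R) :
  0 < alpha -> alpha < n%:R ->
  1 < r -> r <= r0 -> 1 < p -> p <= p0 ->
  r0^-1 = p0^-1 - alpha / n%:R ->
  r / r0 = p / p0 ->
  BMO_dyadic a ->
  (exists C : R, 0 < C /\
     forall f : n.-tuple (measurableTypeR R) -> R,
       measurable_fun setT f ->
       (LpN (conjexp r0) f < +oo)%E ->
       (Hnorm (conjexp r0) (conjexp r) f < +oo)%E ->
       (Hnorm (conjexp p0) (conjexp p) (Idyad alpha f)
          <= C%:E * Hnorm (conjexp r0) (conjexp r) f)%E) /\
  (exists C : R, 0 < C /\
     forall f : n.-tuple (measurableTypeR R) -> R,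
       measurable_fun setT f ->
       (LpN (conjexp r0) f < +oo)%E ->
       (Hnorm (conjexp r0) (conjexp r) f < +oo)%E ->
       (Hnorm (conjexp p0) (conjexp p) (commut a alpha f)
          <= C%:E * Hnorm (conjexp r0) (conjexp r) f)%E).
Proof.
move=> alpha0 alphan r1 rr0 p1 pp0 r0E rpE aB.
have n0 : (0 < n)%N by have := lt_trans alpha0 alphan; rewrite ltr0n.
have [C C0 H] := operators_le n n0 alpha r r0 p p0 alpha0 r1 rr0 p1 pp0 r0E rpE a aB.
have inf_le (y : \bar R) f : (forall lam A, block_decomp (conjexp r0) (conjexp r) f lam A ->
    (y <= C%:E * \sum_(0 <= k <oo) (`|lam k|)%:E)%E) ->
    (y <= C%:E * Hnorm (conjexp r0) (conjexp r) f)%E.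
  move=> yC; rewrite -lee_pdivrMl//; apply: le_ereal_inf_tmp => _ [lam [A [fA ->]]].
  by rewrite lee_pdivrMl//; exact: yC fA.
split; exists C; split=> // f mf _ _; apply: inf_le => lam A fA.
  exact: (H f lam A mf fA).1.
exact: (H f lam A mf fA).2.
Qed.
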